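(* Let $Q$ be a tame quiver without oriented cycles and $\mathbf{k}$ a finite field. Let $P,P'$ be indecomposable preprojective $\mathbf{k}Q$-modules of defect $-1$, and let $R=\bigoplus_kR_k$ be a regular $\mathbf{k}Q$-module whose indecomposable summands $R_k$ lie in pairwise distinct tubes. Then there exists a short exact sequence $$0\longrightarrow P\longrightarrow P'\longrightarrow R\longrightarrow 0$$ if and only if $[P]+[R]=[P']$ in $K_0(\mathbf{k}Q)$ and $\mathrm{Hom}(P',\mathrm{top}\,R_k)\neq0$ for each $k$. In this case, $F_{RP}^{P'}=1$.
   Context: A tame quiver is a (connected) quiver whose underlying graph is an extended Dynkin diagram of type $\widetilde{\mathbb{A}},\widetilde{\mathbb{D}},\widetilde{\mathbb{E}}_6,\widetilde{\mathbb{E}}_7$ or $\widetilde{\mathbb{E}}_8$. $\mathbf{k}Q$-modules are finite dimensional left modules over the path algebra; each indecomposable one is preprojective, regular or preinjective. $K_0(\mathbf{k}Q)$ is the Grothendieck group of finite dimensional modules and $[M]$ the class of $M$. The defect of $M$ is $\langle\delta,[M]\rangle$, where $\langle-,-\rangle$ is the Euler form and $\delta$ is the minimal positive imaginary root (so indecomposable preprojectives have negative defect). The regular modules form an exact abelian subcategory which is a direct product of tubes; for an indecomposable regular module $R_k$ in a tube $\mathcal{T}$, $\mathrm{top}\,R_k$ denotes its relative top, i.e. its top as an object of $\mathcal{T}$ (a quasi-simple regular module). Hall number: $F_{MN}^{L}=|\{X\subseteq L\mid X\cong N,\ L/X\cong M\}|$. *)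

(* Defs.v *)
From HB Require Import structures.
From mathcomp Require Import all_boot all_order all_algebra.
From mathcomp Require Import boolp.
From Stdlib Require Import Relation_Operators.

Set Implicit Arguments.
Unset Strict Implicit.
Unset Printing Implicit Defensive.

Import Order.TTheory GRing.Theory Num.Theory.
Local Open Scope ring_scope.

Record quiver := Quiver {
  vertex : finType;
  arrow : finType;
  src : arrow -> vertex;
  tgt : arrow -> vertex
}.

Definition acyclic (Q : quiver) : Prop :=
  forall a : arrow Q,
    ~~ connect [rel i j | [exists b : arrow Q, (src b == i) && (tgt b == j)]]
         (tgt a) (src a).

(* A finite multigraph on the vertices 0, ..., n-1 is given by [n] and the list
   of its edges; the orientation of the pairs is irrelevant. *)
Definition underlying_graph_is (Q : quiver) (n : nat) (E : seq (nat * nat)) :=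
  exists (phi : vertex Q -> 'I_n) (psi : arrow Q -> 'I_(size E)),
    [/\ bijective phi, bijective psi &
      forall a : arrow Q, let e := nth (0%N, 0%N) E (psi a) in
        ((phi (src a) : nat), (phi (tgt a) : nat)) = e \/
        ((phi (tgt a) : nat), (phi (src a) : nat)) = e].

Local Open Scope nat_scope.

(* The diagram indexed by n has n+1 vertices, labelled 0, ..., n. For n = 1 the
   cycle is a double edge. *)
Definition edges_A (n : nat) : seq (nat * nat) :=
  [seq (i, i.+1 %% n.+1) | i <- iota 0 n.+1].

(* For n >= 4: the chain 2 - 3 - ... - (n-2), with the leaves 0 and 1 attached
   to 2, and the leaves n-1 and n attached to n-2. *)
Definition edges_D (n : nat) : seq (nat * nat) :=
  [:: (0, 2); (1, 2)] ++ [seq (i, i.+1) | i <- iota 2 (n - 4)]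
  ++ [:: (n - 2, n - 1); (n - 2, n)].

(* Stars with branches of 2, 2, 2, resp. 1, 3, 3, resp. 1, 2, 5 edges around
   the vertex 0. *)
Definition edges_E6 : seq (nat * nat) :=
  [:: (0, 1); (1, 2); (0, 3); (3, 4); (0, 5); (5, 6)].
Definition edges_E7 : seq (nat * nat) :=
  [:: (0, 1); (0, 2); (2, 3); (3, 4); (0, 5); (5, 6); (6, 7)].
Definition edges_E8 : seq (nat * nat) :=
  [:: (0, 1); (0, 2); (2, 3); (0, 4); (4, 5); (5, 6); (6, 7); (7, 8)].

Definition tame (Q : quiver) : Prop :=
  [\/ exists2 n, 1 <= n & underlying_graph_is Q n.+1 (edges_A n),
      exists2 n, 4 <= n & underlying_graph_is Q n.+1 (edges_D n) |
      [\/ underlying_graph_is Q 7 edges_E6,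
          underlying_graph_is Q 8 edges_E7 |
          underlying_graph_is Q 9 edges_E8]].

Local Close Scope nat_scope.

Section EulerForm.
Variable Q : quiver.
Implicit Types x y : vertex Q -> int.

Definition euler x y : int :=
  \sum_i x i * y i - \sum_(a : arrow Q) x (src a) * y (tgt a).

(* For an extended Dynkin diagram the roots are the nonzero x with q(x) <= 1,
   where q(x) = <x, x> is nonnegative; the imaginary ones have q(x) = 0. *)
Definition positive_imaginary_root x : Prop :=
  [/\ exists i, x i != 0, forall i, 0 <= x i & euler x x = 0].

Definition minimal_positive_imaginary_root x : Prop :=
  positive_imaginary_root x /\
  forall y, positive_imaginary_root y -> (forall i, y i <= x i) -> y =1 x.

End EulerForm.

Section FiniteVspace.
Import VectorInternalTheory.
Variables (k : finFieldType) (V : vectType k).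
HB.instance Definition _ := [Countable of {vspace V} by <:].
HB.instance Definition _ := [Finite of {vspace V} by <:].
End FiniteVspace.

Section Representations.
Variables (k : finFieldType) (Q : quiver).

(* Finite dimensional left kQ-modules, in the form of representations of Q:
   [rspace M i] is e_i M, and [rmap M a] is the action of the arrow a. Paths
   are composed from right to left, like functions. *)
Record rep := Rep {
  rspace :> vertex Q -> vectType k;
  rmap : forall a : arrow Q, 'Hom(rspace (src a), rspace (tgt a))
}.

Record rep_hom (M N : rep) := Hom {
  hfun :> forall i, 'Hom(M i, N i);
  hcomm : forall a : arrow Q,
    (hfun (tgt a) \o rmap M a = rmap N a \o hfun (src a))%VF
}.

Definition hom_nonzero (M N : rep) : Prop :=
  exists (f : rep_hom M N) (i : vertex Q), f i != 0.

Definition injective_hom M N (f : rep_hom M N) := forall i, injective (f i).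
Definition surjective_hom M N (f : rep_hom M N) := forall i, limg (f i) = fullv.

Definition rep_iso (M N : rep) : Prop :=
  exists (f : rep_hom M N) (g : rep_hom N M),
    forall i, (g i \o f i)%VF = \1%VF /\ (f i \o g i)%VF = \1%VF.

Definition is_zero (M : rep) : Prop := forall i (v : M i), v = 0.

Definition short_exact N L M (f : rep_hom N L) (g : rep_hom L M) : Prop :=
  [/\ injective_hom f, surjective_hom g & forall i, limg (f i) = lker (g i)].

Definition rep0 : rep :=
  @Rep (fun=> 'rV[k]_0 : vectType k) (fun=> 0).

Definition dsum (M N : rep) : rep :=
  @Rep (fun i => (M i * N i)%type : vectType k)
       (fun a => linfun (fun v => (rmap M a v.1, rmap N a v.2))).

Definition bigdsum n (S : 'I_n -> rep) : rep := \big[dsum/rep0]_(j < n) S j.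

Definition indecomposable (M : rep) : Prop :=
  ~ is_zero M /\
  forall A B : rep, rep_iso M (dsum A B) -> is_zero A \/ is_zero B.

(* Subrepresentations are families of subspaces X with [stable X]. [subrep] and
   [quorep] are defined for all families, and meaningful for the stable ones.
   The quotient M i / X i is modelled on the complement (X i)^C of X i, with
   [daddv_pi (X i)^C (X i)] as the projection of M i onto it along X i. *)
Definition subspaces (M : rep) := {dffun forall i, {vspace M i}}.

Definition stable M (X : subspaces M) : Prop :=
  forall a : arrow Q, (rmap M a @: X (src a) <= X (tgt a))%VS.

Definition subrep M (X : subspaces M) : rep :=
  @Rep (fun i => subvs_of (X i) : vectType k)
       (fun a => linfun (vsproj (X (tgt a))) \o rmap M a
                 \o linfun (@vsval _ _ (X (src a))))%VF.

Definition quorep M (X : subspaces M) : rep :=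
  @Rep (fun i => subvs_of (X i)^C : vectType k)
       (fun a => linfun (vsproj (X (tgt a))^C)
                 \o daddv_pi (X (tgt a))^C (X (tgt a)) \o rmap M a
                 \o linfun (@vsval _ _ (X (src a))^C))%VF.

(* F_{MN}^L: N is the submodule, M the quotient. *)
Definition hall_number (M N L : rep) : nat :=
  #|[pred X : subspaces L |
      `[< [/\ stable X, rep_iso (subrep X) N & rep_iso (quorep X) M] >]]|.

(* The Grothendieck group, by generators [M] and relations [L] = [N] + [M] for
   the short exact sequences 0 -> N -> L -> M -> 0: its elements are the terms
   [K0], its equality is [K0_eq]. *)
Inductive K0 :=
  | K0_class of rep
  | K0_zero
  | K0_opp of K0
  | K0_add of K0 & K0.

Inductive K0_eq : K0 -> K0 -> Prop :=
  | K0_refl x : K0_eq x x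
  | K0_sym x y : K0_eq x y -> K0_eq y x
  | K0_trans x y z : K0_eq x y -> K0_eq y z -> K0_eq x z
  | K0_opp_congr x y : K0_eq x y -> K0_eq (K0_opp x) (K0_opp y)
  | K0_add_congr x x' y y' :
      K0_eq x x' -> K0_eq y y' -> K0_eq (K0_add x y) (K0_add x' y')
  | K0_add_assoc x y z :
      K0_eq (K0_add x (K0_add y z)) (K0_add (K0_add x y) z)
  | K0_add_comm x y : K0_eq (K0_add x y) (K0_add y x)
  | K0_add_zero x : K0_eq (K0_add K0_zero x) x
  | K0_add_opp x : K0_eq (K0_add (K0_opp x) x) K0_zero
  | K0_exact N L M (f : rep_hom N L) (g : rep_hom L M) :
      short_exact f g ->
      K0_eq (K0_class L) (K0_add (K0_class N) (K0_class M)).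

Definition dim_vector (M : rep) : vertex Q -> int :=
  fun i => (\dim {: M i})%:Z.

Definition defect (delta : vertex Q -> int) (M : rep) : int :=
  euler delta (dim_vector M).

Definition projective (P : rep) : Prop :=
  forall (L M : rep) (g : rep_hom L M) (h : rep_hom P M), surjective_hom g ->
    exists h' : rep_hom P L, forall i, (g i \o h' i)%VF = h i.

Definition injective_rep (I : rep) : Prop :=
  forall (N L : rep) (f : rep_hom N L) (h : rep_hom N I), injective_hom f ->
    exists h' : rep_hom L I, forall i, (h' i \o f i)%VF = h i.

Definition split_mono N L (f : rep_hom N L) : Prop :=
  exists r : rep_hom L N, forall i, (r i \o f i)%VF = \1%VF.

Definition split_epi L M (g : rep_hom L M) : Prop :=
  exists s : rep_hom M L, forall i, (g i \o s i)%VF = \1%VF.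

(* Auslander-Reiten sequences 0 -> N -> L -> M -> 0; here N = tau M. *)
Definition almost_split N L M (f : rep_hom N L) (g : rep_hom L M) : Prop :=
  [/\ short_exact f g, indecomposable N, indecomposable M, ~ split_epi g &
      (forall X (h : rep_hom X M), ~ split_epi h ->
         exists h' : rep_hom X L, forall i, (g i \o h' i)%VF = h i) /\
      (forall Y (h : rep_hom N Y), ~ split_mono h ->
         exists h' : rep_hom L Y, forall i, (h' i \o f i)%VF = h i)].

Definition is_tau (N M : rep) : Prop :=
  exists (L : rep) (f : rep_hom N L) (g : rep_hom L M), almost_split f g.

(* The modules tau^{-m} P, with P indecomposable projective. *)
Inductive indec_preprojective : rep -> Prop :=
  | preprojective_proj M :
      indecomposable M -> projective M -> indec_preprojective M
  | preprojective_tau N M :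
      is_tau N M -> indec_preprojective N -> indec_preprojective M.

(* The modules tau^m I, with I indecomposable injective. *)
Inductive indec_preinjective : rep -> Prop :=
  | preinjective_inj M :
      indecomposable M -> injective_rep M -> indec_preinjective M
  | preinjective_tau N M :
      is_tau N M -> indec_preinjective M -> indec_preinjective N.

Definition indec_regular (M : rep) : Prop :=
  [/\ indecomposable M, ~ indec_preprojective M & ~ indec_preinjective M].

(* The tubes are the blocks of the category of regular modules: two
   indecomposable regular modules lie in the same tube if and only if they are
   linked by a chain of nonzero homomorphisms, in either direction, between
   indecomposable regular modules. *)
Definition same_tube : rep -> rep -> Prop :=
  clos_refl_sym_trans rep
    (fun X Y => [/\ indec_regular X, indec_regular Y & hom_nonzero X Y]).

(* M is an object of the tube of the indecomposable regular module R. *)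
Definition in_tube (R M : rep) : Prop :=
  exists (n : nat) (S : 'I_n -> rep), rep_iso M (bigdsum S) /\
    forall j, indec_regular (S j) /\ same_tube R (S j).

Definition tube_sub (R : rep) (X : subspaces R) : Prop :=
  stable X /\ in_tube R (subrep X).

Definition tube_maximal_sub (R : rep) (X : subspaces R) : Prop :=
  [/\ tube_sub X, exists i, X i != fullv &
      forall Y : subspaces R, tube_sub Y -> (forall i, (X i <= Y i)%VS) ->
        Y = X \/ forall i, Y i = fullv].

Definition tube_radical (R : rep) : subspaces R :=
  [ffun i => (\bigcap_(X : subspaces R | `[< tube_maximal_sub X >]) X i)%VS].

(* top R = R / rad R, where R is indecomposable regular and rad R is the
   intersection of the maximal subobjects of R in its tube. *)
Definition relative_top (R : rep) : rep := quorep (tube_radical R).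

End Representations.

(* Main.v *)
(* Over a tame quiver regular representations are those of defect 0 all of
   whose subrepresentations have defect <= 0, and every indecomposable regular
   one has a single maximal regular subobject, whose quotient is the relative
   top; this rests on the Auslander-Reiten formulas.

   All nonzero subrepresentations of P' have negative defect, so the image of
   a non-injective map P' -> R is regular, and the map is onto as soon as no
   quasi-simple quotient of R kills it. Since Ext^1(P', -) vanishes on regular
   representations, maps to the tops lift to the R_k; as the R_k lie in distinct
   tubes, every quasi-simple quotient of R is the top of one R_k, and the lifts
   assemble to a surjection P' -> R. Its kernel has the dimension vector
   of P, and <P, P> = 1 gives a nonzero map from P to it, which is an
   isomorphism.

   The Hall number is 1 because Hom(P', E) is at most one-dimensional over the
   division algebra End(E) for every quasi-simple E, so that all nonzero maps
   P' -> E have the same kernel; going down the radical series, all surjections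
   P' -> R_k have the same kernel. The one-dimensionality comes from a
   representation L of dimension vector [P'] + delta: two independent maps
   al, be : P' -> L and a simple matrix t yield the monomorphism al t - be
   between powers of P' and L, whose cokernel is regular and maps onto E. *)

(* The field is finite, hence not algebraically closed: End(E) may be a proper extension of k, and a
   pencil of two maps P' -> L need not have an eigenvalue in k. The eigenvalue is replaced by a
   matrix t of size s without invariant subspaces; whatever is stable under t has dimensions
   divisible by s, so that a defect strictly between -s and 0 is excluded, just as for s = 1 no
   integer lies strictly between -1 and 0.

   No tube is classified. The diagram enters only through [tame_form], which forces an
   indecomposable of negative defect to be preprojective, since otherwise tau could be iterated
   forever. The facts on regular representations then follow from the defects of subobjects and from
   the Auslander-Reiten formulas. Almost split sequences are obtained by representing the functor Y
   -> D Ext^1(M, Y); acyclicity bounds the dimension of the representing object. *)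
From HB Require Import structures.
From mathcomp Require Import all_boot all_order all_algebra.
From mathcomp Require Import boolp zify ring lra.
From Stdlib Require Import Relation_Operators.
Require Import Defs.

Set Implicit Arguments.
Unset Strict Implicit.
Unset Printing Implicit Defensive.

Import Order.TTheory GRing.Theory Num.Theory.
Local Open Scope ring_scope.

(** * Linear algebra *)

Section DependentProduct.
Variables (k : fieldType) (I : finType) (V : I -> vectType k).

(** A name for the dependent product that can carry a vector space structure; the cochain spaces of
    a pair of representations are instances. *)
Definition dprod : Type := forall i, V i.
HB.instance Definition _ := gen_eqMixin dprod.
HB.instance Definition _ := gen_choiceMixin dprod.

Implicit Types x y z : dprod.

Lemma dprodP x y : (forall i, x i = y i) -> x = y.
Proof. exact: functional_extensionality_dep. Qed.

Let add x y : dprod := fun i => x i + y i.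
Let opp x : dprod := fun i => - x i.
Let scale (c : k) x : dprod := fun i => c *: x i.

Fact dprod_addA : associative add.
Proof. by move=> x y z; apply: dprodP => i; rewrite /add addrA. Qed.
Fact dprod_addC : commutative add.
Proof. by move=> x y; apply: dprodP => i; rewrite /add addrC. Qed.
Fact dprod_add0 : left_id (fun i => 0) add.
Proof. by move=> x; apply: dprodP => i; rewrite /add add0r. Qed.
Fact dprod_addN : left_inverse (fun i => 0) opp add.
Proof. by move=> x; apply: dprodP => i; rewrite /add addNr. Qed.
HB.instance Definition _ :=
  GRing.isZmodule.Build dprod dprod_addA dprod_addC dprod_add0 dprod_addN.

Fact dprod_scaleA (a b : k) x : scale a (scale b x) = scale (a * b) x.
Proof. by apply: dprodP => i; rewrite /scale scalerA. Qed.
Fact dprod_scale1 : left_id 1 scale.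
Proof. by move=> x; apply: dprodP => i; rewrite /scale scale1r. Qed.
Fact dprod_scaleDr : right_distributive scale +%R.
Proof. by move=> a x y; apply: dprodP => i; rewrite /scale scalerDr. Qed.
Fact dprod_scaleDl x : {morph scale^~ x : a b / a + b}.
Proof. by move=> a b; apply: dprodP => i; rewrite /scale scalerDl. Qed.
HB.instance Definition _ := GRing.Zmodule_isLmodule.Build k dprod
  dprod_scaleA dprod_scale1 dprod_scaleDr dprod_scaleDl.

Lemma dprodDE x y i : (x + y) i = x i + y i. Proof. by []. Qed.
Lemma dprodNE x i : (- x) i = - x i. Proof. by []. Qed.
Lemma dprodZE (c : k) x i : (c *: x) i = c *: x i. Proof. by []. Qed.
Lemma dprod0E i : (0 : dprod) i = 0. Proof. by []. Qed.
Definition dprodE := (dprodDE, dprodNE, dprodZE, dprod0E).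

Import VectorInternalTheory.

Let T := {i : I & 'I_(dim (V i))}.

Fact dprod_vect_iso : Vector.axiom #|{: T}| dprod.
Proof.
pose f x : 'rV[k]_#|{: T}| :=
  \row_j (v2r (x (tag (enum_val j))) 0 (tagged (enum_val j))).
pose g (r : 'rV[k]_#|{: T}|) : dprod :=
  fun i => r2v (\row_l r 0 (enum_rank (Tagged (fun i => 'I_(dim (V i))) l))).
exists f.
  move=> a x y; apply/rowP=> j.
  by rewrite /f !mxE !dprodE linearP !mxE.
exists g.
  move=> x; apply: dprodP => i; rewrite /g; apply: (canLR v2rK).
  by apply/rowP=> l; rewrite /f !mxE enum_rankK.
move=> r; apply/rowP=> j; rewrite /f /g !mxE r2vK !mxE.
by congr (r 0 _); case: (enum_val j) (enum_valK j) => i l /= ->.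
Qed.
HB.instance Definition _ := Lmodule_hasFinDim.Build k dprod dprod_vect_iso.

Lemma dim_dprod : \dim {: dprod} = (\sum_i \dim {: V i})%N.
Proof.
rewrite dimvf -[dim _]/#|{: T}| card_tagged sumnE big_map big_enum /=.
by apply: eq_bigr => i _; rewrite card_ord dimvf.
Qed.
End DependentProduct.

Section LinearAlgebra.
Variable k : fieldType.
Implicit Types U V W : vectType k.

Lemma dim_lfun U V : \dim {: 'Hom(U, V)} = (\dim {:U} * \dim {:V})%N.
Proof. by rewrite !dimvf. Qed.

Lemma dim_pair U V : \dim {: (U * V)%type} = (\dim {:U} + \dim {:V})%N.
Proof. by rewrite !dimvf. Qed.

Lemma lfun_lift U V W (f : 'Hom(U, V)) (g : 'Hom(W, V)) :
  (forall x, g x \in limg f) -> (f \o (f^-1 \o g))%VF = g.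
Proof. by move=> gf; apply/lfunP=> x; rewrite !comp_lfunE limg_lfunVK. Qed.

(** Here [f^-1] is only a pseudo-inverse: x and its image under f followed by [f^-1] differ by an
    element of the kernel of f, which g kills. *)
Lemma lfun_factor U V W (f : 'Hom(U, V)) (g : 'Hom(U, W)) :
  (forall x, f x = 0 -> g x = 0) -> ((g \o f^-1) \o f)%VF = g.
Proof.
move=> fg; apply/lfunP=> x; rewrite !comp_lfunE; apply/eqP.
rewrite -subr_eq0 -linearB; apply/eqP/fg.
by rewrite linearB /= limg_lfunVK ?subrr // memv_img ?memvf.
Qed.

Lemma lker_inj U V (f : 'Hom(U, V)) :
  (forall x, f x = 0 -> x = 0) -> injective f.
Proof.
move=> f0 x y fxy; apply/eqP; rewrite -subr_eq0; apply/eqP/f0.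
by rewrite linearB /= fxy subrr.
Qed.

Lemma inj_lker0 U V (f : 'Hom(U, V)) : injective f -> lker f = 0%VS.
Proof. by move/lker0P/eqP. Qed.

Lemma inj_eq0 U V (f : 'Hom(U, V)) x : injective f -> f x = 0 -> x = 0.
Proof. by move=> fi fx; apply: fi; rewrite fx linear0. Qed.

Lemma dim_inj_leq U V (f : 'Hom(U, V)) (X : {vspace U}) (Y : {vspace V}) :
  (forall x, x \in X -> f x \in Y) ->
  (forall x, x \in X -> f x = 0 -> x = 0) -> (\dim X <= \dim Y)%N.
Proof.
move=> fXY f0; rewrite -(@limg_dim_eq _ _ _ f X).
  by apply/dimvS/subvP=> _ /memv_imgP [x xX ->]; apply: fXY.
apply/eqP; rewrite -subv0; apply/subvP=> x /memv_capP [xX].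
by rewrite memv_ker memv0 => /eqP /(f0 _ xX) ->.
Qed.

Lemma dim_surj_leq U V (f : 'Hom(U, V)) (X : {vspace U}) (Y : {vspace V}) :
  (forall y, y \in Y -> exists2 x, x \in X & f x = y) -> (\dim Y <= \dim X)%N.
Proof.
move=> fY; apply: (@leq_trans (\dim (f @: X))); last first.
  by rewrite -(limg_ker_dim f X) leq_addl.
by apply/dimvS/subvP=> y /fY [x xX <-]; apply: memv_img.
Qed.

Lemma dim_bij U V (f : 'Hom(U, V)) :
  injective f -> limg f = fullv -> \dim {:U} = \dim {:V}.
Proof.
move=> /inj_lker0 fi fs.
by rewrite -(limg_ker_dim f fullv) capfv fi fs dimv0.
Qed.

Lemma limg_surj U V (f : 'Hom(U, V)) : limg f = fullv <-> forall y, exists x, f x = y.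
Proof.
split=> [fs y|fs].
  by have := memvf y; rewrite -fs => /memv_imgP [x _ ->]; exists x.
apply/eqP; rewrite eqEsubv subvf /=; apply/subvP=> y _.
by have [x <-] := fs y; rewrite memv_img ?memvf.
Qed.

(** Quotients are modelled on complements; this identifies the kernel of the model of the quotient
    map. *)
Lemma daddv_pi_compl0 V (X : {vspace V}) x :
  (daddv_pi X^C X x == 0) = (x \in X).
Proof.
have cap : (X :&: X^C = 0)%VS by apply: capv_compl.
have E : daddv_pi X X^C x + daddv_pi X^C X x = x
  by rewrite daddv_pi_add // addv_complf memvf.
apply/idP/idP => [/eqP z|xX]; first by rewrite -E z addr0 memv_pi.
by move: E; rewrite (daddv_pi_id cap xX) => E; apply/eqP/(@addrI _ x); rewrite addr0.
Qed.

(** Project v to the complement of X, take a coordinate that does not vanish there, and normalize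
    it. *)
Lemma exists_functional V (X : {vspace V}) (v : V) : v \notin X ->
  exists l : 'Hom(V, k^o), (forall x, x \in X -> l x = 0) /\ l v = 1.
Proof.
move=> vX; pose w := daddv_pi X^C X v.
have w0 : w != 0 by rewrite daddv_pi_compl0.
have [j wj] : exists j, coord (vbasis fullv) j w != 0.
  apply: contrapT => /forallNP n; move/eqP: w0; apply.
  rewrite (coord_vbasis (memvf w)) big1 // => j _.
  by have /negP := n j; rewrite negbK => /eqP ->; rewrite scale0r.
pose c : 'Hom(V, k^o) := linfun (coord (vbasis fullv) j : V -> k^o).
exists ((c w)^-1 *: (c \o daddv_pi X^C X)%VF); split.
  move=> x; rewrite -daddv_pi_compl0 scale_lfunE comp_lfunE => /eqP ->.
  by rewrite linear0 scaler0.
rewrite scale_lfunE comp_lfunE -/w; apply: mulVf.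
by rewrite /c lfunE.
Qed.

End LinearAlgebra.

Section LinearFunctions.
Variables (k : fieldType) (U V : vectType k) (f : U -> V) (fl : linear f).
HB.instance Definition _ := GRing.isLinear.Build k U V _ f fl.
(** Serves local functions that come with a mere proof of linearity, so that none of them needs a
    structure of its own. *)
Lemma linfunE x : linfun f x = f x. Proof. exact: lfunE. Qed.
End LinearFunctions.

(** * Homomorphisms, extensions and the Euler form *)

Section Homs.
Variables (k : finFieldType) (Q : quiver).
Implicit Types M N L X Y : rep k Q.

Lemma hom_ext M N (f g : rep_hom M N) : (forall i x, f i x = g i x) -> f = g.
Proof.
case: f g => [f fc] [g gc] /= fg.
have E : f = g by apply: functional_extensionality_dep => i; apply/lfunP/fg.
by subst g; congr Hom; apply: Prop_irrelevance.
Qed.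

Lemma hcommE M N (f : rep_hom M N) a x :
  f (tgt a) (rmap M a x) = rmap N a (f (src a) x).
Proof. by rewrite -!comp_lfunE hcomm. Qed.

Lemma mkhom_subproof M N (u : forall i, 'Hom(M i, N i)) :
  (forall a x, u (tgt a) (rmap M a x) = rmap N a (u (src a) x)) ->
  forall a, (u (tgt a) \o rmap M a = rmap N a \o u (src a))%VF.
Proof. by move=> uc a; apply/lfunP => x; rewrite !comp_lfunE uc. Qed.
Definition mkhom M N (u : forall i, 'Hom(M i, N i)) uc : rep_hom M N :=
  Hom (@mkhom_subproof M N u uc).

Lemma mkhomE M N (u : forall i, 'Hom(M i, N i)) uc i x :
  @mkhom M N u uc i x = u i x.
Proof. by []. Qed.

Definition idh M : rep_hom M M.
by exists (fun i => \1%VF) => a; rewrite comp_lfun1l comp_lfun1r. Defined.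

Definition comph M N L (g : rep_hom N L) (f : rep_hom M N) : rep_hom M L.
exists (fun i => g i \o f i)%VF => a.
by rewrite -comp_lfunA hcomm comp_lfunA hcomm comp_lfunA. Defined.

Definition zeroh M N : rep_hom M N.
by exists (fun i => 0) => a; rewrite comp_lfun0l comp_lfun0r. Defined.

Definition addh M N (f g : rep_hom M N) : rep_hom M N.
by exists (fun i => f i + g i) => a; rewrite comp_lfunDl comp_lfunDr !hcomm.
Defined.

Definition scaleh M N (c : k) (f : rep_hom M N) : rep_hom M N.
by exists (fun i => c *: f i) => a; rewrite -comp_lfunZl -comp_lfunZr hcomm.
Defined.

Lemma idhE M i x : idh M i x = x. Proof. exact: id_lfunE. Qed.
Lemma comphE M N L (g : rep_hom N L) (f : rep_hom M N) i x :
  comph g f i x = g i (f i x).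
Proof. exact: comp_lfunE. Qed.
Lemma zerohE M N i x : zeroh M N i x = 0. Proof. exact: zero_lfunE. Qed.
Lemma addhE M N (f g : rep_hom M N) i x : addh f g i x = f i x + g i x.
Proof. exact: add_lfunE. Qed.
Lemma scalehE M N c (f : rep_hom M N) i x : scaleh c f i x = c *: f i x.
Proof. exact: scale_lfunE. Qed.
Definition homE := (idhE, comphE, zerohE, addhE, scalehE).

Lemma comphA M N L X (h : rep_hom L X) (g : rep_hom N L) (f : rep_hom M N) :
  comph h (comph g f) = comph (comph h g) f.
Proof. by apply: hom_ext => i x; rewrite !homE. Qed.
Lemma comph1 M N (f : rep_hom M N) : comph f (idh M) = f.
Proof. by apply: hom_ext => i x; rewrite !homE. Qed.
Lemma comp1h M N (f : rep_hom M N) : comph (idh N) f = f.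
Proof. by apply: hom_ext => i x; rewrite !homE. Qed.

Lemma hom_eq0 M N (f : rep_hom M N) : (forall i x, f i x = 0) -> f = zeroh M N.
Proof. by move=> f0; apply: hom_ext => i x; rewrite homE. Qed.

Lemma hom_nonzeroP M N :
  hom_nonzero M N <-> exists f : rep_hom M N, f <> zeroh M N.
Proof.
split=> [[f [i /eqP fi]]|[f f0]]; exists f; first by move=> f0; apply: fi; rewrite f0.
apply: contrapT => /forallNP fi; apply: f0; apply: hom_eq0 => i x.
by have /negP := fi i; rewrite negbK => /eqP ->; rewrite zero_lfunE.
Qed.

Lemma split_monoP N L (f : rep_hom N L) :
  split_mono f <-> exists r, comph r f = idh N.
Proof.
split=> [[r rf]|[r rf]]; exists r.
  by apply: hom_ext => i x; rewrite !homE -comp_lfunE rf id_lfunE.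
by move=> i; apply/lfunP=> x; rewrite -[LHS]/(comph r f i x) rf.
Qed.

Lemma split_epiP L M (g : rep_hom L M) :
  split_epi g <-> exists s, comph g s = idh M.
Proof.
split=> [[r rf]|[r rf]]; exists r.
  by apply: hom_ext => i x; rewrite !homE -comp_lfunE rf id_lfunE.
by move=> i; apply/lfunP=> x; rewrite -[LHS]/(comph g r i x) rf.
Qed.

(** C0 and C1 are the terms of the two-term complex that the standard resolution of length one over
    a path algebra induces; Hom and Ext^1 become a kernel and a cokernel of linear algebra. *)
Definition C0 M N := dprod (fun i => 'Hom(M i, N i) : vectType k).
Definition C1 M N :=
  dprod (fun a : arrow Q => 'Hom(M (src a), N (tgt a)) : vectType k).
HB.instance Definition _ M N := Vector.on (C0 M N).
HB.instance Definition _ M N := Vector.on (C1 M N).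

Lemma C0P M N (u v : C0 M N) : (forall i x, u i x = v i x) -> u = v.
Proof. by move=> uv; apply: dprodP => i; apply/lfunP/uv. Qed.
Lemma C1P M N (u v : C1 M N) : (forall a x, u a x = v a x) -> u = v.
Proof. by move=> uv; apply: dprodP => i; apply/lfunP/uv. Qed.
Lemma C0DE M N (u v : C0 M N) i x : (u + v) i x = u i x + v i x.
Proof. exact: add_lfunE. Qed.
Lemma C0NE M N (u : C0 M N) i x : (- u) i x = - u i x.
Proof. exact: opp_lfunE. Qed.
Lemma C0ZE M N c (u : C0 M N) i x : (c *: u) i x = c *: u i x.
Proof. exact: scale_lfunE. Qed.
Lemma C00E M N i x : (0 : C0 M N) i x = 0. Proof. exact: zero_lfunE. Qed.
Lemma C1DE M N (u v : C1 M N) i x : (u + v) i x = u i x + v i x.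
Proof. exact: add_lfunE. Qed.
Lemma C1NE M N (u : C1 M N) i x : (- u) i x = - u i x.
Proof. exact: opp_lfunE. Qed.
Lemma C1ZE M N c (u : C1 M N) i x : (c *: u) i x = c *: u i x.
Proof. exact: scale_lfunE. Qed.
Lemma C10E M N i x : (0 : C1 M N) i x = 0. Proof. exact: zero_lfunE. Qed.
Definition CE := (C0DE, C0NE, C0ZE, C00E, C1DE, C1NE, C1ZE, C10E).

Definition dfun M N (u : C0 M N) : C1 M N :=
  fun a => ((u (tgt a) \o rmap M a) - (rmap N a \o u (src a)))%VF.
Lemma dfunE M N (u : C0 M N) a x :
  dfun u a x = u (tgt a) (rmap M a x) - rmap N a (u (src a) x).
Proof. by rewrite /dfun !lfun_simp. Qed.
Lemma dfun_linear M N : linear (@dfun M N).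
Proof.
move=> c u v; apply: C1P => a x; rewrite !(CE, dfunE).
by rewrite linearD linearZ /= scalerBr opprD addrACA.
Qed.
Definition dlin M N : 'Hom(C0 M N, C1 M N) := linfun (@dfun M N).
Lemma dlinE M N (u : C0 M N) a x :
  dlin M N u a x = u (tgt a) (rmap M a x) - rmap N a (u (src a) x).
Proof. by rewrite (linfunE (@dfun_linear M N)) dfunE. Qed.

Definition Z0 M N : {vspace C0 M N} := lker (dlin M N).
Definition B1 M N : {vspace C1 M N} := limg (dlin M N).

(* [hd] and [ed] are the dimensions of Hom and Ext^1, the kernel and cokernel
   of [dlin M N]. *)
Definition hd M N := \dim (Z0 M N).
Definition ed M N := (\dim {: C1 M N} - \dim (B1 M N))%N.

Lemma hom_Z0 M N (f : rep_hom M N) : (hfun f : C0 M N) \in Z0 M N.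
Proof.
rewrite memv_ker; apply/eqP/C1P => a x.
by rewrite dlinE hcommE subrr CE.
Qed.

Lemma Z0_hom M N (u : C0 M N) : u \in Z0 M N -> exists f : rep_hom M N, u = hfun f.
Proof.
rewrite memv_ker => /eqP uZ.
have uc a x : u (tgt a) (rmap M a x) = rmap N a (u (src a) x).
  by apply/eqP; rewrite -subr_eq0 -dlinE uZ CE.
by exists (mkhom uc).
Qed.

Lemma B1P M N (z : C1 M N) :
  z \in B1 M N <-> exists u : C0 M N, forall a x,
    z a x = u (tgt a) (rmap M a x) - rmap N a (u (src a) x).
Proof.
split=> [/memv_imgP [u _ ->]|[u zu]]; first by exists u => a x; rewrite dlinE.
by have -> : z = dlin M N u; [apply: C1P => a x; rewrite dlinE|rewrite memv_img ?memvf].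
Qed.

Definition dv M : vertex Q -> int := dim_vector M.
Definition tdim M := (\sum_i \dim {: M i})%N.

(** Rank and nullity of [dlin]: the dimensions of C0 and C1 are the two sums in the Euler form. *)
Lemma euler_formula M N :
  (hd M N)%:Z - (ed M N)%:Z = euler (dv M) (dv N).
Proof.
have := limg_ker_dim (dlin M N) fullv; rewrite capfv -/(Z0 M N) -/(B1 M N).
have := dimvS (subvf (B1 M N)); rewrite /hd /ed !dim_dprod.
have -> : euler (dv M) (dv N) = (\sum_i \dim {: 'Hom(M i, N i)})%N%:Z -
   (\sum_(a : arrow Q) \dim {: 'Hom(M (src a), N (tgt a))})%N%:Z.
  by rewrite /euler !(big_morph Posz PoszD (erefl _)); congr (_ - _); apply: eq_bigr => i _;
     rewrite dim_lfun PoszM.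
move: (\sum_i _)%N (\sum_i _)%N (\dim (Z0 _ _)) (\dim (B1 _ _)).
lia.
Qed.
End Homs.

#[global] Opaque mkhom idh comph zeroh addh scaleh.

(** * Subobjects, quotients and exact sequences *)

Section SubQuot.
Variables (k : finFieldType) (Q : quiver).
Implicit Types M N L A B C X Y : rep k Q.

Section Stable.
Variables (M : rep k Q) (X : subspaces M) (Xs : stable X).

Lemma stableE a x : x \in X (src a) -> rmap M a x \in X (tgt a).
Proof. by move=> xX; apply: (subvP (Xs a)); apply: memv_img. Qed.

Definition subi : rep_hom (subrep X) M.
Proof.
exists (fun i => linfun (@vsval _ _ (X i)) : 'Hom(subrep X i, M i)) => a.
apply/lfunP => x; rewrite /= !comp_lfunE !lfunE /= vsprojK //.
exact/stableE/subvsP.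
Defined.

Lemma subiE i (x : subrep X i) : subi i x = vsval x.
Proof. by rewrite lfunE. Qed.

Lemma subi_inj : injective_hom subi.
Proof. by move=> i x y; rewrite !subiE => /subvs_inj. Qed.

Lemma subi_img i : limg (subi i) = X i.
Proof.
apply/vspaceP=> x; apply/memv_imgP/idP => [[y _ ->]|xX].
  by rewrite subiE subvsP.
by exists (Subvs xX : subrep X i); rewrite ?memvf // subiE.
Qed.

Definition quop : rep_hom M (quorep X).
Proof.
exists (fun i => linfun (vsproj (X i)^C) \o daddv_pi (X i)^C (X i)
          : 'Hom(M i, quorep X i))%VF => a.
apply/lfunP => x; rewrite /= !comp_lfunE !lfunE /= vsprojK ?memv_pi //.
(* A vector and its projection differ by an element of X, which the arrow keeps in X. *)
congr vsproj; apply/eqP; rewrite -subr_eq0 -!linearB /= daddv_pi_compl0.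
apply: stableE; rewrite -daddv_pi_compl0 linearB /= daddv_pi_proj ?subrr //.
by rewrite capvC capv_compl.
Defined.

Lemma quopE i x : quop i x = vsproj (X i)^C (daddv_pi (X i)^C (X i) x).
Proof. by rewrite !comp_lfunE !lfunE. Qed.

Lemma quop_surj : surjective_hom quop.
Proof.
move=> i; apply/limg_surj=> y; exists (vsval y).
by rewrite quopE daddv_pi_id ?vsvalK ?subvsP // capvC capv_compl.
Qed.

Lemma quop_ker i : lker (quop i) = X i.
Proof.
apply/vspaceP=> x; rewrite memv_ker quopE -daddv_pi_compl0.
by rewrite -(inj_eq (@subvs_inj _ _ _)) vsprojK ?memv_pi.
Qed.

End Stable.

Lemma sub_exists M (X : forall i, {vspace M i}) :
  (forall a x, x \in X (src a) -> rmap M a x \in X (tgt a)) ->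
  exists S (j : rep_hom S M), injective_hom j /\ forall i, limg (j i) = X i.
Proof.
move=> Xs; pose Y : subspaces M := [ffun i => X i].
have Ys : stable Y.
  by move=> a; apply/subvP=> _ /memv_imgP [x xX ->]; move: xX; rewrite !ffunE => /Xs.
exists (subrep Y), (subi Ys); split=> [|i]; first exact: subi_inj.
by rewrite subi_img ffunE.
Qed.

Lemma quo_exists M (X : forall i, {vspace M i}) :
  (forall a x, x \in X (src a) -> rmap M a x \in X (tgt a)) ->
  exists C (p : rep_hom M C), surjective_hom p /\ forall i, lker (p i) = X i.
Proof.
move=> Xs; pose Y : subspaces M := [ffun i => X i].
have Ys : stable Y.
  by move=> a; apply/subvP=> _ /memv_imgP [x xX ->]; move: xX; rewrite !ffunE => /Xs.
exists (quorep Y), (quop Ys); split=> [|i]; first exact: quop_surj.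
by rewrite quop_ker ffunE.
Qed.

Lemma factor_mono N S M (j : rep_hom S M) (f : rep_hom N M) :
  injective_hom j -> (forall i x, f i x \in limg (j i)) ->
  exists g : rep_hom N S, comph j g = f.
Proof.
move=> ji fj; pose g i := ((j i)^-1 \o f i)%VF.
have jg i x : j i (g i x) = f i x by rewrite -comp_lfunE lfun_lift.
suff gc a x : g (tgt a) (rmap N a x) = rmap S a (g (src a) x).
  by exists (mkhom gc); apply: hom_ext => i x; rewrite homE mkhomE jg.
by apply: (ji (tgt a)); rewrite jg hcommE hcommE jg.
Qed.

Lemma factor_epi M C N (p : rep_hom M C) (f : rep_hom M N) :
  surjective_hom p -> (forall i x, p i x = 0 -> f i x = 0) ->
  exists g : rep_hom C N, comph g p = f.
Proof.
move=> ps fp; pose g i := (f i \o (p i)^-1)%VF.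
have gp i x : g i (p i x) = f i x by rewrite -comp_lfunE lfun_factor //; apply: fp.
suff gc a x : g (tgt a) (rmap C a x) = rmap N a (g (src a) x).
  by exists (mkhom gc); apply: hom_ext => i x; rewrite homE mkhomE gp.
have [y <-] := (limg_surj (p (src a))).1 (ps _) x.
by rewrite -hcommE !gp hcommE.
Qed.

Lemma ker_exists M N (f : rep_hom M N) :
  exists K (j : rep_hom K M),
    injective_hom j /\ forall i, limg (j i) = lker (f i).
Proof.
apply: sub_exists => a x; rewrite !memv_ker hcommE => /eqP ->.
by rewrite linear0.
Qed.

Lemma coker_exists M N (f : rep_hom M N) :
  exists C (p : rep_hom N C),
    surjective_hom p /\ forall i, lker (p i) = limg (f i).
Proof.
apply: quo_exists => a _ /memv_imgP [x _ ->].
by rewrite -hcommE memv_img ?memvf.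
Qed.

Lemma epi_ses L M (g : rep_hom L M) : surjective_hom g ->
  exists N (f : rep_hom N L), short_exact f g.
Proof. by move=> gs; have [K [j [ji jg]]] := ker_exists g; exists K, j; split. Qed.

Lemma mono_ses N L (f : rep_hom N L) : injective_hom f ->
  exists M (g : rep_hom L M), short_exact f g.
Proof. by move=> fi; have [C [p [ps pf]]] := coker_exists f; exists C, p; split. Qed.

(** The kernel is part of the factorization because most arguments below compare the defects of
    kernel and image. *)
Lemma im_exists M N (f : rep_hom M N) :
  exists I K (p : rep_hom M I) (j : rep_hom I N) (i : rep_hom K M),
    [/\ short_exact i p, injective_hom j & f = comph j p].
Proof.
have [I [j [ji jf]]] : exists S (j : rep_hom S N),
    injective_hom j /\ forall i, limg (j i) = limg (f i).
  apply: sub_exists => a _ /memv_imgP [x _ ->].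
  by rewrite -hcommE memv_img ?memvf.
have [|p jp] := factor_mono (f := f) ji.
  by move=> i x; rewrite jf memv_img ?memvf.
have ps : surjective_hom p.
  move=> i; apply/limg_surj=> y.
  have : j i y \in limg (f i) by rewrite -jf memv_img ?memvf.
  case/memv_imgP=> x _ jy; exists x; apply: (ji i).
  by rewrite jy -jp homE.
by have [K [i ip]] := epi_ses ps; exists I, K, p, j, i.
Qed.

Section Exact.
Variables (N L M : rep k Q) (f : rep_hom N L) (g : rep_hom L M).
Hypothesis fg : short_exact f g.

Lemma ses_inj : injective_hom f. Proof. by case: fg. Qed.
Lemma ses_surj : surjective_hom g. Proof. by case: fg. Qed.
Lemma ses_comp i x : g i (f i x) = 0.
Proof.
have [_ _ fgi] := fg; apply/eqP; rewrite -memv_ker -fgi.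
by rewrite memv_img ?memvf.
Qed.
Lemma ses_ker i x : g i x = 0 -> exists y, x = f i y.
Proof.
have [_ _ fgi] := fg; move/eqP; rewrite -memv_ker -fgi.
by case/memv_imgP=> y _ ->; exists y.
Qed.
Lemma ses_lift i y : exists x, g i x = y.
Proof. exact: (limg_surj (g i)).1 (ses_surj i) y. Qed.

Lemma ses_factor_l X (u : rep_hom X L) : comph g u = zeroh X M ->
  exists v, u = comph f v.
Proof.
move=> gu; have [|v <-] := factor_mono (f := u) ses_inj; last by exists v.
have [_ _ fgi] := fg; move=> i x.
by rewrite fgi memv_ker -(comphE g u) gu homE.
Qed.

Lemma ses_factor_r X (u : rep_hom L X) : comph u f = zeroh N X ->
  exists v, u = comph v g.
Proof.
move=> uf; have [|v <-] := factor_epi (f := u) ses_surj; last by exists v.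
move=> i x /ses_ker [y ->].
by rewrite -(comphE u f) uf homE.
Qed.

Lemma ses_dim i : \dim {: L i} = (\dim {: N i} + \dim {: M i})%N.
Proof.
have [fi gs fgi] := fg; rewrite -(limg_ker_dim (g i) fullv) capfv gs -fgi.
by rewrite limg_dim_eq // capfv inj_lker0.
Qed.

Lemma ses_dv i : dv L i = dv N i + dv M i.
Proof. by rewrite /dv /dim_vector ses_dim PoszD. Qed.

Lemma ses_tdim : tdim L = (tdim N + tdim M)%N.
Proof. by rewrite /tdim -big_split; apply: eq_bigr => i _; rewrite ses_dim. Qed.

End Exact.

Lemma dim_tdim M i : (\dim {: M i} <= tdim M)%N.
Proof. by rewrite /tdim (bigD1 i) //= leq_addr. Qed.

Lemma is_zeroP M : is_zero M <-> tdim M = 0%N.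
Proof.
split=> [M0|M0 i x]; last first.
  have := dim_tdim M i; rewrite M0 leqn0 dimv_eq0 => /eqP V0.
  by apply/eqP; rewrite -memv0 -V0 memvf.
rewrite /tdim big1 // => i _; apply/eqP; rewrite dimv_eq0 -subv0.
by apply/subvP=> x _; rewrite (M0 i x) mem0v.
Qed.

Lemma nonzeroP M : ~ is_zero M <-> (0 < tdim M)%N.
Proof. by rewrite is_zeroP lt0n; split=> [/eqP|/eqP]. Qed.

Lemma inj_dim M N (f : rep_hom M N) i : injective_hom f ->
  (\dim {: M i} <= \dim {: N i})%N.
Proof.
by move=> fi; apply: (@dim_inj_leq _ _ _ (f i)) => x _; rewrite ?memvf // => /inj_eq0; apply.
Qed.

Lemma surj_dim M N (f : rep_hom M N) i : surjective_hom f ->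
  (\dim {: N i} <= \dim {: M i})%N.
Proof.
move=> fs; apply: (@dim_surj_leq _ _ _ (f i)) => y _.
by have [x <-] := (limg_surj (f i)).1 (fs i) y; exists x; rewrite ?memvf.
Qed.

Lemma inj_tdim M N (f : rep_hom M N) : injective_hom f -> (tdim M <= tdim N)%N.
Proof. by move=> fi; apply: leq_sum => i _; apply: inj_dim fi. Qed.

Lemma surj_tdim M N (f : rep_hom M N) : surjective_hom f -> (tdim N <= tdim M)%N.
Proof. by move=> fi; apply: leq_sum => i _; apply: surj_dim fi. Qed.

Lemma inj_tdim_surj M N (f : rep_hom M N) : injective_hom f ->
  (tdim N <= tdim M)%N -> surjective_hom f.
Proof.
move=> fi le; have [C [g fg]] := mono_ses fi.
have C0 : is_zero C by apply/is_zeroP; have := ses_tdim fg; lia.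
move=> i; apply/limg_surj=> y; have [|x ->] := ses_ker fg (x := y) (i := i).
  exact: C0.
by exists x.
Qed.

Lemma surj_tdim_inj M N (f : rep_hom M N) : surjective_hom f ->
  (tdim M <= tdim N)%N -> injective_hom f.
Proof.
move=> fs le; have [K [g gf]] := epi_ses fs.
have K0 : is_zero K by apply/is_zeroP; have := ses_tdim gf; lia.
move=> i; apply: lker_inj => x /(ses_ker gf) [y ->].
by rewrite (K0 _ y) linear0.
Qed.

Lemma bij_inverse M N (f : rep_hom M N) : injective_hom f -> surjective_hom f ->
  exists g, comph g f = idh M /\ comph f g = idh N.
Proof.
move=> fi fs; have [|g gf] := factor_epi (f := idh M) fs.
  by move=> i x /inj_eq0; rewrite homE => ->.
exists g; split=> //; apply: hom_ext => i y; rewrite !homE.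
have [x <-] := (limg_surj (f i)).1 (fs i) y.
by rewrite -[in LHS](comphE g f) gf homE.
Qed.

Lemma rep_isoP M N : rep_iso M N <->
  exists f : rep_hom M N, injective_hom f /\ surjective_hom f.
Proof.
split=> [[f [g fg]]|[f [fi fs]]].
  exists f; split=> i.
    by apply: (can_inj (g := g i)) => x; rewrite -comp_lfunE (fg i).1 id_lfunE.
  by apply/limg_surj=> y; exists (g i y); rewrite -comp_lfunE (fg i).2 id_lfunE.
have [g [gf fg]] := bij_inverse fi fs; exists f, g => i.
by split; [have := congr1 (fun h => hfun h i) gf|have := congr1 (fun h => hfun h i) fg].
Qed.

Lemma iso_dim M N i : rep_iso M N -> \dim {: M i} = \dim {: N i}.
Proof. by case/rep_isoP=> f [fi fs]; apply: dim_bij (fi i) (fs i). Qed.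
Lemma iso_dv M N : rep_iso M N -> dv M = dv N.
Proof. by move=> e; apply/funext => i; rewrite /dv /dim_vector (iso_dim i e). Qed.
Lemma iso_tdim M N : rep_iso M N -> tdim M = tdim N.
Proof. by move=> e; apply: eq_bigr => i _; apply: iso_dim e. Qed.

Lemma rep_iso_sym M N : rep_iso M N -> rep_iso N M.
Proof. by case=> f [g fg]; exists g, f => i; have [] := fg i. Qed.
Lemma inj_comp M N L (g : rep_hom N L) (f : rep_hom M N) :
  injective_hom f -> injective_hom g -> injective_hom (comph g f).
Proof. by move=> fi gi i x y; rewrite !homE => /gi /fi. Qed.
Lemma surj_comp M N L (g : rep_hom N L) (f : rep_hom M N) :
  surjective_hom f -> surjective_hom g -> surjective_hom (comph g f).
Proof.
move=> fs gs i; apply/limg_surj=> z.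
have [y <-] := (limg_surj _).1 (gs i) z; have [x <-] := (limg_surj _).1 (fs i) y.
by exists x; rewrite homE.
Qed.
Lemma rep_iso_trans M N L : rep_iso M N -> rep_iso N L -> rep_iso M L.
Proof.
move=> /rep_isoP [f [fi fs]] /rep_isoP [g [gi gs]]; apply/rep_isoP.
by exists (comph g f); split; [apply: inj_comp|apply: surj_comp].
Qed.
End SubQuot.

#[global] Opaque subi quop.

(** Well-ordering for arbitrary predicates on arbitrary types; extremal summands, subobjects and
    quotients are chosen with it. *)
Lemma minimize_nat (T : Type) (P : T -> Prop) (m : T -> nat) :
  (exists x, P x) -> exists x, P x /\ forall y, P y -> (m x <= m y)%N.
Proof.
case=> x; have [n] := ubnP (m x); elim: n x => // n IH x /ltnSE le Px.
have [[y [Py lt]]|no] := pselect (exists y, P y /\ (m y < m x)%N).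
  exact: IH (leq_trans lt le) Py.
exists x; split=> // y Py; rewrite leqNgt; apply/negP => lt.
by apply: no; exists y.
Qed.

Lemma maximize_nat (T : Type) (P : T -> Prop) (m : T -> nat) b :
  (exists x, P x) -> (forall x, P x -> (m x <= b)%N) ->
  exists x, P x /\ forall y, P y -> (m y <= m x)%N.
Proof.
move=> exP bP; have [x [Px xm]] := minimize_nat (fun x => b - m x)%N exP.
exists x; split=> // y Py; have := xm y Py; have := bP x Px; have := bP y Py; lia.
Qed.

Section MoreLinearAlgebra.
Variable k : fieldType.
Implicit Types U V W : vectType k.

(** Take a subspace of largest dimension inside P: adjoining the line of any further x with P x
    cannot enlarge it. *)
Lemma closed_vspace V (P : V -> Prop) :
  P 0 -> (forall x y, P x -> P y -> P (x + y)) ->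
  (forall c x, P x -> P (c *: x)) -> exists X : {vspace V}, forall x, x \in X <-> P x.
Proof.
move=> P0 PD PZ.
have [||X [XP Xm]] := @maximize_nat {vspace V}
   (fun X => forall x, x \in X -> P x) (fun X => \dim X) (\dim {:V}).
- by exists 0%VS => x; rewrite memv0 => /eqP ->.
- by move=> X _; apply/dimvS/subvf.
exists X => x; split=> [|Px]; first exact: XP.
have := Xm (X + <[x]>)%VS; have le : (X <= X + <[x]>)%VS by apply: addvSl.
rewrite (geq_leqif (dimv_leqif_sup le)) subv_add => /(_ _)/andP [] //.
by move=> _ /memv_addP [y /XP Py [_ /vlineP [c ->] ->]]; apply/PD/PZ.
Qed.

(** Each of X and a complement of W0 embeds in the dual of the other through the pairing, which
    gives both inequalities. *)
Lemma pairing_dim U W (X : {vspace U}) (W0 : {vspace W}) (b : U -> W -> k^o) :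
  (forall x, linear (b x)) -> (forall w, linear (b^~ w)) ->
  (forall x w, x \in X -> w \in W0 -> b x w = 0) ->
  (forall x, x \in X -> (forall w, b x w = 0) -> x = 0) ->
  (forall w, (forall x, x \in X -> b x w = 0) -> w \in W0) ->
  (\dim X + \dim W0 = \dim {:W})%N.
Proof.
move=> bl br b0 bX bW.
have le1 : (\dim X <= \dim W0^C)%N.
  pose r x (w : subvs_of W0^C) : k^o := b x (vsval w).
  have rl x : linear (r x) by move=> c u v; rewrite /r linearP bl.
  pose f x : 'Hom(subvs_of W0^C, k^o) := linfun (r x).
  have fl : linear f.
    move=> c x y; apply/lfunP => w; rewrite add_lfunE scale_lfunE.
    by rewrite /f !(linfunE (rl _)) /r br.
  have -> : \dim W0^C = \dim {: 'Hom(subvs_of W0^C, k^o)}.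
    by rewrite dim_lfun !dimvf muln1.
  apply: (@dim_inj_leq _ _ _ (linfun f)) => x xX; rewrite ?memvf //.
  rewrite (linfunE fl) => /lfunP fx; apply: bX => // w.
  have : w \in (W0 + W0^C)%VS by rewrite addv_complf memvf.
  case/memv_addP=> w0 w0W [w1 w1W ->]; rewrite -[w0]scale1r bl b0 // scaler0 add0r.
  by have := fx (Subvs w1W); rewrite /f (linfunE (rl _)) /r zero_lfunE.
have le2 : (\dim W0^C <= \dim X)%N.
  pose r w (x : subvs_of X) : k^o := b (vsval x) w.
  have rl x : linear (r x) by move=> c u v; rewrite /r linearP br.
  pose f x : 'Hom(subvs_of X, k^o) := linfun (r x).
  have fl : linear f.
    move=> c x y; apply/lfunP => w; rewrite add_lfunE scale_lfunE.
    by rewrite /f !(linfunE (rl _)) /r bl.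
  have -> : \dim X = \dim {: 'Hom(subvs_of X, k^o)}.
    by rewrite dim_lfun !dimvf muln1.
  apply: (@dim_inj_leq _ _ _ (linfun f)) => w wC; rewrite ?memvf //.
  rewrite (linfunE fl) => /lfunP fx.
  have wW : w \in W0.
    apply: bW => x xX.
    by have := fx (Subvs xX); rewrite /f (linfunE (rl _)) /r zero_lfunE.
  by apply/eqP; rewrite -memv0 -(capv_compl W0) memv_cap wW.
have := dimv_compl W0; have := dimvS (subvf W0); lia.
Qed.
End MoreLinearAlgebra.

(** * Direct sums and indecomposable summands *)

Section DirectSums.
Variables (k : finFieldType) (Q : quiver).
Implicit Types M N L A B C X Y : rep k Q.

Lemma rmap_dsumE A B a v :
  rmap (dsum A B) a v = (rmap A a v.1, rmap B a v.2).
Proof. by rewrite linfunE // => c x y; rewrite /= !linearP. Qed.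

Lemma fst_linear (U V : vectType k) : linear (fun v : U * V => v.1).
Proof. by []. Qed.
Lemma snd_linear (U V : vectType k) : linear (fun v : U * V => v.2).
Proof. by []. Qed.
Definition fsth A B : rep_hom (dsum A B) A.
Proof.
refine (@mkhom _ _ (dsum A B) A (fun i => linfun (fun v : A i * B i => v.1)) _) => a x.
by rewrite !(linfunE (@fst_linear _ _)) rmap_dsumE.
Defined.
Definition sndh A B : rep_hom (dsum A B) B.
Proof.
refine (@mkhom _ _ (dsum A B) B (fun i => linfun (fun v : A i * B i => v.2)) _) => a x.
by rewrite !(linfunE (@snd_linear _ _)) rmap_dsumE.
Defined.
Lemma inl_linear (U V : vectType k) : linear (fun u => (u, 0) : (U * V)%type).
Proof. by move=> c u v; congr (_, _); rewrite /= scaler0 addr0. Qed.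
Lemma inr_linear (U V : vectType k) : linear (fun u => (0, u) : (V * U)%type).
Proof. by move=> c u v; congr (_, _); rewrite /= scaler0 addr0. Qed.
Definition inlh A B : rep_hom A (dsum A B).
Proof.
refine (@mkhom _ _ A (dsum A B) (fun i => linfun (fun u => (u, 0) : (A i * B i)%type)) _) => a x.
by rewrite !(linfunE (@inl_linear _ _)) rmap_dsumE linear0.
Defined.
Definition inrh A B : rep_hom B (dsum A B).
Proof.
refine (@mkhom _ _ B (dsum A B) (fun i => linfun (fun u => (0, u) : (A i * B i)%type)) _) => a x.
by rewrite !(linfunE (@inr_linear _ _)) rmap_dsumE linear0.
Defined.
Lemma fsthE A B i v : fsth A B i v = v.1. Proof. by rewrite mkhomE (linfunE (@fst_linear _ _)). Qed.
Lemma sndhE A B i v : sndh A B i v = v.2. Proof. by rewrite mkhomE (linfunE (@snd_linear _ _)). Qed.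
Lemma inlhE A B i x : inlh A B i x = (x, 0). Proof. by rewrite mkhomE (linfunE (@inl_linear _ _)). Qed.
Lemma inrhE A B i x : inrh A B i x = (0, x). Proof. by rewrite mkhomE (linfunE (@inr_linear _ _)). Qed.

#[global] Opaque fsth sndh inlh inrh.
Definition copairh A B X (f : rep_hom A X) (g : rep_hom B X) : rep_hom (dsum A B) X :=
  addh (comph f (fsth A B)) (comph g (sndh A B)).
Lemma copairhE A B X (f : rep_hom A X) (g : rep_hom B X) i v :
  copairh f g i v = f i v.1 + g i v.2.
Proof. by rewrite !homE fsthE sndhE. Qed.
Lemma copair2E A B X (f : rep_hom A X) (g : rep_hom B X) i (x : A i) (y : B i) :
  copairh f g i (x, y) = f i x + g i y.
Proof. by rewrite copairhE. Qed.
Definition pairh A B X (f : rep_hom X A) (g : rep_hom X B) : rep_hom X (dsum A B) :=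
  addh (comph (inlh A B) f) (comph (inrh A B) g).
Lemma pairhE A B X (f : rep_hom X A) (g : rep_hom X B) i x :
  pairh f g i x = (f i x, g i x).
Proof.
rewrite !homE inlhE inrhE; congr (_, _) => /=; by rewrite ?addr0 ?add0r.
Qed.

Lemma dsum_dim A B i : \dim {: dsum A B i} = (\dim {: A i} + \dim {: B i})%N.
Proof. exact: dim_pair. Qed.
Lemma tdim_dsum A B : tdim (dsum A B) = (tdim A + tdim B)%N.
Proof. by rewrite /tdim -big_split; apply: eq_bigr => i _; apply: dsum_dim. Qed.
Lemma dv_dsum A B i : dv (dsum A B) i = dv A i + dv B i.
Proof. by rewrite /dv /dim_vector dsum_dim PoszD. Qed.

Lemma inlh_inj A B : injective_hom (inlh A B).
Proof. by move=> i x y; rewrite !inlhE => -[]. Qed.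
Lemma inrh_inj A B : injective_hom (inrh A B).
Proof. by move=> i x y; rewrite !inrhE => -[]. Qed.
Lemma sndh_surj A B : surjective_hom (sndh A B).
Proof. by move=> i; apply/limg_surj=> x; exists (0, x); rewrite sndhE. Qed.

Lemma dsum_ses A B : short_exact (inlh A B) (sndh A B).
Proof.
split; [exact: inlh_inj|exact: sndh_surj|move=> i].
apply/vspaceP=> x; rewrite memv_ker sndhE; apply/memv_imgP/eqP.
  by case=> y _ ->; rewrite inlhE.
by case: x => x y /= ->; exists x; rewrite ?memvf ?inlhE.
Qed.

Lemma copair_inj A B M (f : rep_hom A M) (g : rep_hom B M) :
  (forall i x y, f i x = g i y -> x = 0 /\ y = 0) -> injective_hom (copairh f g).
Proof.
move=> fg i; apply: lker_inj => -[x y]; rewrite copairhE /= => /eqP.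
rewrite addr_eq0 -linearN => /eqP /fg [-> /eqP]; rewrite oppr_eq0 => /eqP -> //.
Qed.

(** The first hypothesis packs the injectivity of f and g and the trivial intersection of their
    images; a dimension count does the rest. *)
Lemma dsum_internal A B M (f : rep_hom A M) (g : rep_hom B M) :
  (forall i x y, f i x = g i y -> x = 0 /\ y = 0) ->
  (tdim M <= tdim A + tdim B)%N -> rep_iso M (dsum A B).
Proof.
move=> /copair_inj fg le; apply/rep_iso_sym/rep_isoP; exists (copairh f g).
by split=> //; apply: inj_tdim_surj => //; rewrite tdim_dsum.
Qed.

Lemma ses_split N L M (f : rep_hom N L) (g : rep_hom L M) :
  short_exact f g -> split_epi g -> rep_iso L (dsum N M).
Proof.
move=> fg /split_epiP [s gs]; apply: (dsum_internal (f := f) (g := s)).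
  move=> i x y E; have y0 : y = 0.
    by rewrite -[y]homE -gs homE -E (ses_comp fg).
  by split=> //; move: E; rewrite y0 linear0 => /inj_eq0; apply; apply: ses_inj fg i.
by rewrite (ses_tdim fg).
Qed.

Lemma ses_split_mono N L M (f : rep_hom N L) (g : rep_hom L M) :
  short_exact f g -> split_mono f -> split_epi g.
Proof.
move=> fg /split_monoP [r rf].
(* The endomorphism 1 - f r kills the image of f; the map it induces on M is a section of g. *)
have [|v v_def] := ses_factor_r fg (u := addh (idh L) (scaleh (-1) (comph f r))).
  apply: hom_ext => i x; rewrite !homE -(comphE r f) rf homE.
  by rewrite scaleN1r subrr.
apply/split_epiP; exists v; apply: hom_ext => i y.
have [x <-] := ses_lift fg y; rewrite !homE -(comphE v g) -v_def !homE.
by rewrite linearD linearZ /= (ses_comp fg) scaler0 addr0.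
Qed.

Lemma indec_ses N L M (f : rep_hom N L) (g : rep_hom L M) :
  indecomposable L -> short_exact f g -> split_epi g -> is_zero N \/ is_zero M.
Proof. by case=> _ Li fg sg; apply: Li; apply: ses_split fg sg. Qed.

Lemma iso_zero M N : rep_iso M N -> is_zero M -> is_zero N.
Proof. by move=> e; rewrite !is_zeroP (iso_tdim e). Qed.

(* Splitting off a nonzero summand of least dimension. *)
Lemma indec_summand M : ~ is_zero M ->
  exists A B, indecomposable A /\ rep_iso M (dsum A B).
Proof.
move=> M0.
have [|[A B] /= [[A0 eM] Am]] := @minimize_nat (rep k Q * rep k Q)
    (fun p => ~ is_zero p.1 /\ rep_iso M (dsum p.1 p.2)) (fun p => tdim p.1).
  exists (M, rep0 k Q); split=> //=; apply: (dsum_internal (f := idh M) (g := zeroh _ _)).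
    by move=> i x y; rewrite !homE; split=> //; apply/rowP => -[].
  exact: leq_addr.
exists A, B; split=> //; split=> // C D eA.
have [C0|C0] := pselect (is_zero C); [by left|right].
have /(_ (C, dsum D B)) /= := Am; have := iso_tdim eA; rewrite tdim_dsum => tA.
move=> h; apply/is_zeroP; suff /h : ~ is_zero C /\ rep_iso M (dsum C (dsum D B)) by lia.
split=> //; move: eM eA => /rep_iso_sym/rep_isoP [f [fi fs]] /rep_iso_sym/rep_isoP [g [gi gs]].
pose u := comph f (comph (inlh A B) (comph g (inlh C D))).
pose v := comph f (copairh (comph (inlh A B) (comph g (inrh C D))) (inrh A B)).
apply: (dsum_internal (f := u) (g := v)).
  move=> i x [y z]; rewrite !comphE copair2E !comphE => /fi.
  rewrite !inlhE !inrhE => -[]; rewrite addr0 add0r => /gi -[-> <-] <-.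
  by split.
have := ses_tdim (dsum_ses A B).
have := inj_tdim fi; have := surj_tdim fs; rewrite !tdim_dsum; lia.
Qed.

End DirectSums.

#[global] Opaque copairh pairh.

(** * Dimensions of Hom and Ext^1 along exact sequences *)

Section Exactness.
Variables (k : finFieldType) (Q : quiver).
Implicit Types M N L A B C X Y : rep k Q.

Definition post0 X M N (f : rep_hom M N) (u : C0 X M) : C0 X N :=
  fun i => (f i \o u i)%VF.
Definition pre0 X M N (f : rep_hom M N) (u : C0 N X) : C0 M X :=
  fun i => (u i \o f i)%VF.
Definition post1 X M N (f : rep_hom M N) (z : C1 X M) : C1 X N :=
  fun a => (f (tgt a) \o z a)%VF.
Definition pre1 X M N (f : rep_hom M N) (z : C1 N X) : C1 M X :=
  fun a => (z a \o f (src a))%VF.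

Lemma post0E X M N (f : rep_hom M N) (u : C0 X M) i x : post0 f u i x = f i (u i x).
Proof. exact: comp_lfunE. Qed.
Lemma pre0E X M N (f : rep_hom M N) (u : C0 N X) i x : pre0 f u i x = u i (f i x).
Proof. exact: comp_lfunE. Qed.
Lemma post1E X M N (f : rep_hom M N) (z : C1 X M) a x :
  post1 f z a x = f (tgt a) (z a x).
Proof. exact: comp_lfunE. Qed.
Lemma pre1E X M N (f : rep_hom M N) (z : C1 N X) a x :
  pre1 f z a x = z a (f (src a) x).
Proof. exact: comp_lfunE. Qed.
Definition ppE := (post0E, pre0E, post1E, pre1E).

Lemma post0_linear X M N (f : rep_hom M N) : linear (@post0 X M N f).
Proof. by move=> c u v; apply: C0P => i x; rewrite !(ppE, CE) linearP. Qed.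
Lemma pre0_linear X M N (f : rep_hom M N) : linear (@pre0 X M N f).
Proof. by move=> c u v; apply: C0P => i x; rewrite !(ppE, CE). Qed.
Lemma post1_linear X M N (f : rep_hom M N) : linear (@post1 X M N f).
Proof. by move=> c u v; apply: C1P => i x; rewrite !(ppE, CE) linearP. Qed.
Lemma pre1_linear X M N (f : rep_hom M N) : linear (@pre1 X M N f).
Proof. by move=> c u v; apply: C1P => i x; rewrite !(ppE, CE). Qed.

Lemma post1_B1 X M N (f : rep_hom M N) (z : C1 X M) :
  z \in B1 X M -> post1 f z \in B1 X N.
Proof.
case/B1P=> u zu; apply/B1P; exists (post0 f u) => a x.
by rewrite !ppE zu linearB /= hcommE.
Qed.
Lemma pre1_B1 X M N (f : rep_hom M N) (z : C1 N X) :
  z \in B1 N X -> pre1 f z \in B1 M X.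
Proof.
case/B1P=> u zu; apply/B1P; exists (pre0 f u) => a x.
by rewrite !ppE zu hcommE.
Qed.

Lemma post0_hom X M N (f : rep_hom M N) (g : rep_hom X M) :
  post0 f (hfun g : C0 X M) = hfun (comph f g).
Proof. by apply: C0P => i x; rewrite ppE. Qed.
Lemma pre0_hom X M N (f : rep_hom M N) (g : rep_hom N X) :
  pre0 f (hfun g : C0 N X) = hfun (comph g f).
Proof. by apply: C0P => i x; rewrite ppE. Qed.

Lemma hd_inj_r X M N (f : rep_hom M N) : injective_hom f -> (hd X M <= hd X N)%N.
Proof.
move=> fi; apply: (@dim_inj_leq _ _ _ (linfun (@post0 X M N f))) => u uZ;
  rewrite (linfunE (@post0_linear _ _ _ f)).
  by have [g ->] := Z0_hom uZ; rewrite post0_hom hom_Z0.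
move=> fu; apply: C0P => i x; rewrite CE; apply: (fi i); rewrite linear0.
by rewrite -post0E fu CE.
Qed.

Lemma hd_surj_l X M N (f : rep_hom M N) : surjective_hom f -> (hd N X <= hd M X)%N.
Proof.
move=> fs; apply: (@dim_inj_leq _ _ _ (linfun (@pre0 X M N f))) => u uZ;
  rewrite (linfunE (@pre0_linear _ _ _ f)).
  by have [g ->] := Z0_hom uZ; rewrite pre0_hom hom_Z0.
move=> fu; apply: C0P => i y; rewrite CE.
by have [x <-] := (limg_surj (f i)).1 (fs i) y; rewrite -pre0E fu CE.
Qed.

Lemma hd0P M N : hd M N = 0%N <-> forall f : rep_hom M N, f = zeroh M N.
Proof.
split=> [/eqP|f0].
  rewrite dimv_eq0 => /eqP Z f; apply: hom_eq0 => i x.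
  have := hom_Z0 f; rewrite Z memv0 => /eqP fE.
  by rewrite -[f i x]/((hfun f : C0 M N) i x) fE CE.
apply/eqP; rewrite dimv_eq0 -subv0; apply/subvP=> u /Z0_hom [f ->].
by rewrite (f0 f) memv0; apply/eqP/C0P=> i x; rewrite [RHS]CE; apply: zerohE.
Qed.

Lemma hd_nonzero M N : (0 < hd M N)%N -> exists f : rep_hom M N, f <> zeroh M N.
Proof.
move=> h0; apply: contrapT => /forallNP f0.
suff /hd0P E : forall f : rep_hom M N, f = zeroh M N by rewrite E in h0.
by move=> f; have := f0 f; move/contrapT.
Qed.

Lemma hd_gt0 M N (f : rep_hom M N) : f <> zeroh M N -> (0 < hd M N)%N.
Proof.
move=> f0; rewrite lt0n; apply/eqP => /hd0P /(_ f) //.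
Qed.

Lemma hd_iso_r X M N : rep_iso M N -> hd X M = hd X N.
Proof.
move=> e; have [f [fi _]] := (rep_isoP _ _).1 e.
have [g [gi _]] := (rep_isoP _ _).1 (rep_iso_sym e).
by apply/eqP; rewrite eqn_leq (hd_inj_r _ fi) (hd_inj_r _ gi).
Qed.

Lemma hd_iso_l X M N : rep_iso M N -> hd M X = hd N X.
Proof.
move=> e; have [f [_ fi]] := (rep_isoP _ _).1 e.
have [g [_ gi]] := (rep_isoP _ _).1 (rep_iso_sym e).
by apply/eqP; rewrite eqn_leq (hd_surj_l _ fi) (hd_surj_l _ gi).
Qed.

Lemma ed_iso_r X M N : rep_iso M N -> ed X M = ed X N.
Proof.
move=> e; have := euler_formula X M; have := euler_formula X N.
by rewrite (iso_dv e) (hd_iso_r X e) => <-; lia.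
Qed.

Lemma ed0P M N : ed M N = 0%N <-> forall z : C1 M N, z \in B1 M N.
Proof.
rewrite /ed; split=> [/eqP|zB]; last first.
  by have -> : B1 M N = fullv; [apply/vspaceP=> z; rewrite zB memvf|rewrite subnn].
rewrite subn_eq0 => le z; suff -> : B1 M N = fullv by rewrite memvf.
by apply/eqP; rewrite eqEdim subvf.
Qed.

Lemma codim_leq (V W : vectType k) (f : 'Hom(V, W)) (X : {vspace V}) (Y : {vspace W}) :
  limg f = fullv -> (f @: X <= Y)%VS ->
  (\dim {:W} - \dim Y <= \dim {:V} - \dim X)%N.
Proof.
move=> fs /dimvS; have := limg_ker_dim f X; have := limg_ker_dim f fullv.
rewrite fs capfv; have := dimvS (capvSr X (lker f)).
by have := dimvS (subvf X); have := dimvS (subvf Y); lia.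
Qed.

(** Ext^1 is right exact because it is a cokernel on C1 and every cochain lifts along a surjection;
    in the first argument, cochains extend along an injection. *)
Lemma ed_surj_r X M N (f : rep_hom M N) : surjective_hom f -> (ed X N <= ed X M)%N.
Proof.
move=> fs; apply: (@codim_leq _ _ (linfun (@post1 X M N f))).
  apply/limg_surj=> z.
  exists (fun a => ((f (tgt a))^-1 \o z a)%VF); rewrite (linfunE (@post1_linear _ _ _ f)).
  by apply: C1P => a x; rewrite ppE comp_lfunE limg_lfunVK // fs memvf.
apply/subvP=> _ /memv_imgP [z zB ->]; rewrite (linfunE (@post1_linear _ _ _ f)).
exact: post1_B1.
Qed.

Lemma ed_inj_l X M N (f : rep_hom M N) : injective_hom f -> (ed M X <= ed N X)%N.
Proof.
move=> fi; apply: (@codim_leq _ _ (linfun (@pre1 X M N f))).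
  apply/limg_surj=> z.
  exists (fun a => (z a \o (f (src a))^-1)%VF); rewrite (linfunE (@pre1_linear _ _ _ f)).
  by apply: C1P => a x; rewrite ppE comp_lfunE lker0_lfunK //; apply/lker0P.
apply/subvP=> _ /memv_imgP [z zB ->]; rewrite (linfunE (@pre1_linear _ _ _ f)).
exact: pre1_B1.
Qed.

Lemma dv_pos M i : 0 <= dv M i. Proof. by []. Qed.

Section Ses.
Variables (N L M : rep k Q) (f : rep_hom N L) (g : rep_hom L M).
Hypothesis fg : short_exact f g.

Lemma ses_hd_r X : (hd X L <= hd X N + hd X M)%N.
Proof.
pose p := linfun (@post0 X L M g).
rewrite /hd -(limg_ker_dim p (Z0 X L)) leq_add //.
  apply: (@dim_surj_leq _ _ _ (linfun (@post0 X N L f))) => u.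
  rewrite memv_cap memv_ker (linfunE (@post0_linear _ _ _ g)).
  case/andP=> /Z0_hom [h ->]; rewrite post0_hom => /eqP gh.
  have [|v ->] := ses_factor_l fg (u := h).
    by apply: hom_ext => i x; rewrite zerohE -[LHS]/((hfun (comph g h) : C0 X M) i x) gh CE.
  by exists (hfun v); rewrite ?hom_Z0 // (linfunE (@post0_linear _ _ _ f)) post0_hom.
apply/dimvS/subvP=> _ /memv_imgP [_ /Z0_hom [h ->] ->].
by rewrite (linfunE (@post0_linear _ _ _ g)) post0_hom hom_Z0.
Qed.

(** The number r is the rank of the restriction Hom(L, X) -> Hom(N, X); the last clause recognizes
    when every map extends. *)
Lemma ses_hd_l_rank X : exists2 r, (hd L X <= r + hd M X)%N & (r <= hd N X)%N /\
  (r = hd N X -> forall h : rep_hom N X, exists h', comph h' f = h).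
Proof.
pose p := linfun (@pre0 X N L f).
have sub : (p @: Z0 L X <= Z0 N X)%VS.
  apply/subvP=> _ /memv_imgP [_ /Z0_hom [h ->] ->].
  by rewrite (linfunE (@pre0_linear _ _ _ f)) pre0_hom hom_Z0.
exists (\dim (p @: Z0 L X)%VS).
  rewrite /hd -(limg_ker_dim p (Z0 L X)) addnC leq_add2l.
  apply: (@dim_surj_leq _ _ _ (linfun (@pre0 X L M g))) => u.
  rewrite memv_cap memv_ker (linfunE (@pre0_linear _ _ _ f)).
  case/andP=> /Z0_hom [h ->]; rewrite pre0_hom => /eqP gh.
  have [|v ->] := ses_factor_r fg (u := h).
    by apply: hom_ext => i x; rewrite zerohE -[LHS]/((hfun (comph h f) : C0 N X) i x) gh CE.
  by exists (hfun v); rewrite ?hom_Z0 // (linfunE (@pre0_linear _ _ _ g)) pre0_hom.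
split=> [|E h]; first exact: dimvS.
have /eqP ZE : (p @: Z0 L X)%VS == Z0 N X by rewrite eqEdim sub E leqnn.
have := hom_Z0 h; rewrite -ZE => /memv_imgP [_ /Z0_hom [h' ->]].
rewrite (linfunE (@pre0_linear _ _ _ f)) pre0_hom => hE; exists h'.
by apply: hom_ext => i x; rewrite -[RHS]/((hfun h : C0 N X) i x) hE.
Qed.

Lemma ses_hd_l X : (hd L X <= hd N X + hd M X)%N.
Proof. by have [r rle [rh _]] := ses_hd_l_rank X; apply: leq_trans rle _; rewrite leq_add2r. Qed.

(** If the restriction had full rank, the identity of N would extend to L and split f. *)
Lemma ses_hd_strict : ~ split_mono f -> (hd L N < hd N N + hd M N)%N.
Proof.
move=> ns; have [r rle [rh rE]] := ses_hd_l_rank N.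
have : r <> hd N N; last by lia.
by move/rE => /(_ (idh N)) [h' hf]; apply: ns; apply/split_monoP; exists h'.
Qed.

Lemma ses_euler_r X : euler (dv X) (dv L) = euler (dv X) (dv N) + euler (dv X) (dv M).
Proof.
rewrite /euler (eq_bigr (fun i => dv X i * dv N i + dv X i * dv M i)); last first.
  by move=> i _; rewrite (ses_dv fg) mulrDr.
rewrite [X in _ - X](eq_bigr (fun a => dv X (src a) * dv N (tgt a) + dv X (src a) * dv M (tgt a))).
  by rewrite !big_split /=; ring.
by move=> i _; rewrite (ses_dv fg) mulrDr.
Qed.

Lemma ses_euler_l X : euler (dv L) (dv X) = euler (dv N) (dv X) + euler (dv M) (dv X).
Proof.
rewrite /euler (eq_bigr (fun i => dv N i * dv X i + dv M i * dv X i)); last first.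
  by move=> i _; rewrite (ses_dv fg) mulrDl.
rewrite [X in _ - X](eq_bigr (fun a => dv N (src a) * dv X (tgt a) + dv M (src a) * dv X (tgt a))).
  by rewrite !big_split /=; ring.
by move=> i _; rewrite (ses_dv fg) mulrDl.
Qed.

(** A piece of the long exact sequence without a connecting map: the Euler form is additive and
    Ext^1(X, L) -> Ext^1(X, M) is onto. *)
Lemma ses_hd_le_r X : (hd X M + hd X N <= hd X L + ed X N)%N.
Proof.
have := ses_euler_r X; rewrite -!euler_formula.
by have := ed_surj_r X (ses_surj fg); lia.
Qed.

Lemma ses_hd_le_l X : (hd N X + hd M X <= hd L X + ed M X)%N.
Proof.
have := ses_euler_l X; rewrite -!euler_formula.
by have := ed_inj_l X (ses_inj fg); lia.
Qed.

Lemma ses_ed_r X : (ed X L <= ed X N + ed X M)%N.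
Proof. by have := ses_euler_r X; rewrite -!euler_formula; have := ses_hd_r X; lia. Qed.

(** Lift h linearly at each vertex. The failure to commute with the arrows is a cochain with values
    in N; it is a coboundary, and subtracting its primitive corrects the lift. *)
Lemma lift_ed0 X (h : rep_hom X M) : ed X N = 0%N ->
  exists h' : rep_hom X L, comph g h' = h.
Proof.
move=> /ed0P eX; pose v i : 'Hom(X i, L i) := ((g i)^-1 \o h i)%VF.
have gv i x : g i (v i x) = h i x.
  by rewrite /v comp_lfunE limg_lfunVK // (ses_surj fg) memvf.
pose dvl a : 'Hom(X (src a), L (tgt a)) :=
  ((v (tgt a) \o rmap X a) - (rmap L a \o v (src a)))%VF.
have dvlE a x : dvl a x = v (tgt a) (rmap X a x) - rmap L a (v (src a) x).
  by rewrite /dvl !lfun_simp.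
have gd a x : g (tgt a) (dvl a x) = 0.
  by rewrite dvlE linearB /= gv hcommE hcommE gv subrr.
pose w : C1 X N := fun a => ((f (tgt a))^-1 \o dvl a)%VF.
have fw a x : f (tgt a) (w a x) = dvl a x.
  have [y yE] := ses_ker fg (gd a x).
  by rewrite /w comp_lfunE yE lker0_lfunK //; apply/lker0P/(ses_inj fg).
have /B1P [u uE] := eX w.
pose h' i := (v i - (f i \o u i))%VF : 'Hom(X i, L i).
have h'E i x : h' i x = v i x - f i (u i x) by rewrite /h' !lfun_simp.
suff h'c a x : h' (tgt a) (rmap X a x) = rmap L a (h' (src a) x).
  exists (mkhom h'c); apply: hom_ext => i x.
  by rewrite comphE mkhomE h'E linearB /= gv (ses_comp fg) subr0.
rewrite !h'E linearB /= -hcommE; apply/eqP; rewrite -subr_eq0; apply/eqP.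
have := fw a x; rewrite uE linearB /= dvlE => /eqP; rewrite -subr_eq0 => /eqP E.
by rewrite -[RHS]oppr0 -E !opprB [LHS]addrACA [RHS]addrACA; congr (_ + _); rewrite addrC.
Qed.
End Ses.
End Exactness.

(** * Extensions by cocycles, and Fitting's lemma *)

Section Extensions.
Variables (k : finFieldType) (Q : quiver).
Implicit Types M N L A B C X Y : rep k Q.

Section Ext.
Variables (M N : rep k Q) (z : C1 M N).

(** The arrows act by block triangular matrices with z in the corner. *)
Definition extrep : rep k Q :=
  @Rep k Q (fun i => (N i * M i)%type : vectType k)
    (fun a => linfun (fun v => (rmap N a v.1 + z a v.2, rmap M a v.2))).

Lemma rmap_extE a v :
  rmap extrep a v = (rmap N a v.1 + z a v.2, rmap M a v.2).
Proof.
rewrite linfunE // => c x y; congr (_, _); rewrite /= !linearP //.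
by rewrite scalerDr addrACA.
Qed.

Definition exti : rep_hom N extrep.
Proof.
refine (@mkhom _ _ N extrep (fun i => linfun (fun u => (u, 0) : (N i * M i)%type)) _) => a x.
by rewrite !(linfunE (@inl_linear _ _ _)) rmap_extE /= !linear0 addr0.
Defined.
Definition extp : rep_hom extrep M.
Proof.
refine (@mkhom _ _ extrep M (fun i => linfun (fun v : N i * M i => v.2)) _) => a x.
by rewrite !(linfunE (@snd_linear _ _ _)) rmap_extE.
Defined.
Lemma extiE i x : exti i x = (x, 0).
Proof. by rewrite mkhomE (linfunE (@inl_linear _ _ _)). Qed.
Lemma extpE i x : extp i x = x.2.
Proof. by rewrite mkhomE (linfunE (@snd_linear _ _ _)). Qed.
#[global] Opaque exti extp.

Lemma ext_ses : short_exact exti extp.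
Proof.
split=> i; first by move=> x y; rewrite !extiE => -[].
  by apply/limg_surj=> x; exists (0, x); rewrite extpE.
apply/vspaceP=> x; rewrite memv_ker extpE; apply/memv_imgP/eqP.
  by case=> y _ ->; rewrite extiE.
by case: x => x y /= ->; exists x; rewrite ?memvf ?extiE.
Qed.

(** A lift of h has the form (u, h), and it commutes with the arrows exactly when the coboundary of
    u is z composed with h. *)
Lemma ext_lift X (h : rep_hom X M) :
  (exists h', comph extp h' = h) <-> pre1 h z \in B1 X N.
Proof.
split=> [[h' hE]|/B1P [u uE]].
  pose p i : 'Hom(extrep i, N i) := linfun (fun v : N i * M i => v.1).
  have pE i x : p i x = x.1 by rewrite (linfunE (@fst_linear _ _ _)).
  apply/B1P; exists (fun i => p i \o h' i)%VF => a x.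
  rewrite !comp_lfunE hcommE !pE rmap_extE.
  by rewrite -hE comphE extpE addrAC subrr add0r.
pose h' i : 'Hom(X i, extrep i) := linfun (fun x => (u i x, h i x) : (N i * M i)%type).
have h'E i x : h' i x = (u i x, h i x).
  by rewrite linfunE // => c y w; rewrite !linearP.
suff h'c a x : h' (tgt a) (rmap X a x) = rmap extrep a (h' (src a) x).
  by exists (mkhom h'c); apply: hom_ext => i x; rewrite comphE mkhomE h'E extpE.
rewrite !h'E rmap_extE /= hcommE; congr (_, _).
by have := uE a x; rewrite ppE => ->; rewrite addrC subrK.
Qed.

Lemma ext_extend Y (h : rep_hom N Y) :
  (exists h', comph h' exti = h) <-> post1 h z \in B1 M Y.
Proof.
split=> [[h' hE]|/B1P [u uE]].
  have il (U V : vectType k) : linear (fun u => (0, - u) : (V * U)%type).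
    by move=> c y w; congr (_, _); rewrite /= ?scaler0 ?addr0 // opprD scalerN.
  (* The sign matches the extension (n, m) -> h n - u m built in the other direction. *)
  pose p i : 'Hom(M i, extrep i) := linfun (fun u => (0, - u) : (N i * M i)%type).
  have pE i x : p i x = (0, - x) by rewrite (linfunE (il _ _)).
  apply/B1P; exists (fun i => h' i \o p i)%VF => a x.
  rewrite !comp_lfunE -hcommE !pE rmap_extE /=.
  rewrite -linearB -hE comphE extiE; congr (h' _ _); congr (_, _) => /=.
    by rewrite linear0 !add0r linearN opprK.
  by rewrite linearN subrr.
pose h' i : 'Hom(extrep i, Y i) := linfun (fun v : N i * M i => h i v.1 - u i v.2).
have h'E i x : h' i x = h i x.1 - u i x.2.
  rewrite linfunE // => c y w; rewrite /= !linearP.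
  by rewrite scalerDr addrACA.
suff h'c a x : h' (tgt a) (rmap extrep a x) = rmap Y a (h' (src a) x).
  exists (mkhom h'c); apply: hom_ext => i x.
  by rewrite comphE mkhomE h'E extiE linear0 subr0.
rewrite !h'E rmap_extE /= linearB linearD /= -hcommE.
have := uE a x.2; rewrite ppE => ->.
by rewrite -addrA; congr (_ + _); rewrite addrAC subrr add0r.
Qed.

Lemma ext_split : split_epi extp <-> z \in B1 M N.
Proof.
rewrite split_epiP ext_lift; have -> // : pre1 (idh M) z = z.
by apply: C1P => a x; rewrite ppE idhE.
Qed.
End Ext.

(** Choose a linear section of g at each vertex; its failure to commute with the arrows takes values
    in N and is the cocycle. *)
Lemma ses_cocycle N L M (f : rep_hom N L) (g : rep_hom L M) : short_exact f g ->
  exists (z : C1 M N) (phi : rep_hom (extrep z) L) (psi : rep_hom L (extrep z)),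
    [/\ comph phi (exti z) = f, comph g phi = extp z,
        comph phi psi = idh L & comph psi phi = idh _].
Proof.
move=> fg.
pose s i : 'Hom(M i, L i) := ((g i)^-1)%VF.
have gs i x : g i (s i x) = x by rewrite limg_lfunVK // (ses_surj fg) memvf.
pose w a : 'Hom(M (src a), L (tgt a)) :=
  ((rmap L a \o s (src a)) - (s (tgt a) \o rmap M a))%VF.
have wE a x : w a x = rmap L a (s (src a) x) - s (tgt a) (rmap M a x).
  by rewrite /w !lfun_simp.
pose z : C1 M N := fun a => ((f (tgt a))^-1 \o w a)%VF.
have fz a x : f (tgt a) (z a x) = w a x.
  have [|y yE] := ses_ker fg (x := w a x) (i := tgt a).
    by rewrite wE linearB /= hcommE !gs subrr.
  by rewrite /z comp_lfunE yE lker0_lfunK //; apply/lker0P/(ses_inj fg).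
pose p i : 'Hom(extrep z i, L i) := linfun (fun v : N i * M i => f i v.1 + s i v.2).
have pE i x : p i x = f i x.1 + s i x.2.
  by rewrite linfunE // => c y v; rewrite /= !linearP scalerDr addrACA.
have pc a x : p (tgt a) (rmap (extrep z) a x) = rmap L a (p (src a) x).
  rewrite !pE rmap_extE /= !linearD /= fz hcommE wE.
  by rewrite -!addrA; congr (_ + _); rewrite addNr addr0.
pose phi := mkhom pc.
have phii : injective_hom phi.
  move=> i; apply: lker_inj => -[x y]; rewrite mkhomE pE /= => E.
  have y0 : y = 0.
    by have := congr1 (g i) E; rewrite linearD /= (ses_comp fg) add0r gs linear0.
  move: E; rewrite y0 linear0 addr0 => /inj_eq0 -> //; exact: ses_inj fg i.
have phis : surjective_hom phi.
  apply: inj_tdim_surj => //; rewrite (ses_tdim fg) (ses_tdim (ext_ses z)) //.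
have [psi [E1 E2]] := bij_inverse phii phis.
exists z, phi, psi; split=> //.
  by apply: hom_ext => i x; rewrite comphE mkhomE pE extiE linear0 addr0.
apply: hom_ext => i x; rewrite comphE mkhomE pE linearD /=.
by rewrite (ses_comp fg) add0r gs extpE.
Qed.

Lemma projective_ed X : projective X <-> forall Y, ed X Y = 0%N.
Proof.
split=> [Xp Y|e0].
  apply/ed0P => z; apply/ext_split.
  have [s gs] := Xp _ _ (extp z) (idh X) (ses_surj (ext_ses z)).
  by exists s => i; rewrite gs; apply/lfunP => x; rewrite [RHS]id_lfunE idhE.
move=> L M g h gs; have [K [j jg]] := epi_ses gs.
have [h' <-] := lift_ed0 jg h (e0 K).
by exists h' => i; apply/lfunP => x; rewrite [RHS]comphE comp_lfunE.
Qed.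

Fixpoint iterh M (f : rep_hom M M) n : rep_hom M M :=
  if n is m.+1 then comph f (iterh f m) else idh M.

Lemma iterhD M (f : rep_hom M M) m n : iterh f (m + n) = comph (iterh f m) (iterh f n).
Proof.
elim: m => [|m IH]; first by rewrite comp1h.
by rewrite addSn /= IH comphA.
Qed.

Lemma end_inj_surj M (f : rep_hom M M) : injective_hom f -> surjective_hom f.
Proof. by move=> fi; apply: inj_tdim_surj. Qed.

(** A suitable power of f has complementary kernel and image, so that one of them vanishes. *)
Lemma fitting M (f : rep_hom M M) : indecomposable M ->
  injective_hom f \/ exists n, iterh f n = zeroh M M.
Proof.
move=> Mi; pose rk (f : rep_hom M M) := (\sum_i \dim (limg (f i)))%N.
(* For a positive power g of least total rank, the square of g has the same image as g; hence g is
   injective on its image, and the image meets the kernel in 0. *)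
have [|n [n0 nm]] := @minimize_nat nat (fun n => 0 < n)%N (fun n => rk (iterh f n)).
  by exists 1%N.
pose g := iterh f n; have [I [K [p [j [i [ip ji gE]]]]]] := im_exists g.
have gdim v : limg (g v) = limg (j v).
  apply/vspaceP=> x; apply/memv_imgP/memv_imgP => [[y _ ->]|[y _ ->]].
    by exists (p v y); rewrite ?memvf // gE comphE.
  have [w <-] := ses_lift ip y; exists w; rewrite ?memvf // gE comphE //.
have ggr v : limg (comph g g v) = limg (g v).
  have le w : (limg (comph g g w) <= limg (g w))%VS.
    by apply/subvP=> _ /memv_imgP [x _ ->]; rewrite comphE memv_img ?memvf.
  apply/eqP; rewrite eqEdim le /=.
  have := nm (n + n)%N; rewrite addn_gt0 n0 iterhD -/g => /(_ isT).
  rewrite /rk (bigD1 v) //= [X in (_ <= X)%N](bigD1 v) //= => le'.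
  rewrite -(leq_add2r (\sum_(i0 | i0 != v) \dim (limg (g i0)))%N).
  apply: leq_trans le' _; rewrite leq_add2l; apply: leq_sum => w _.
  exact/dimvS/le.
have ginj v x : g v (g v x) = 0 -> g v x = 0.
  move=> gg0; have dimE : \dim (g v @: limg (g v)) = \dim (limg (g v)).
    by rewrite -[X in _ = \dim X]ggr -limg_comp.
  have := limg_ker_dim (g v) (limg (g v)); rewrite dimE => /eqP.
  rewrite -[X in _ == X]add0n eqn_add2r dimv_eq0 => /eqP E.
  apply/eqP; rewrite -memv0 -E memv_cap memv_img ?memvf //= memv_ker.
  exact/eqP.
case: Mi => M0 /(_ K I) []; last first.
- move=> I0; right; exists n; apply: hom_eq0 => v x; rewrite -/g gE comphE.
  by rewrite (I0 v (p v x)) linear0.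
- move=> K0; left; have gi : injective_hom g.
    rewrite gE; apply: inj_comp ji; apply: surj_tdim_inj; first exact: ses_surj ip.
    by have := ses_tdim ip; move/is_zeroP: K0 => ->; rewrite add0n => ->.
  move=> v; apply: lker_inj => x fx; apply: (inj_eq0 (gi v)).
  have -> : g = comph (iterh f n.-1) f.
    by rewrite /g -[in LHS](prednK n0) -addn1 iterhD /= comph1.
  by rewrite comphE fx linear0.
apply: (dsum_internal (f := i) (g := j)); last by rewrite (ses_tdim ip).
move=> v x y E; have [w wy] := ses_lift ip y.
have y0 : y = 0.
  apply: (inj_eq0 (ji v)); rewrite -wy -comphE -gE; apply: ginj.
  by rewrite {2}gE comphE wy -E gE comphE (ses_comp ip) linear0.
by split=> //; move: E; rewrite y0 linear0 => /inj_eq0; apply; apply: ses_inj ip v.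
Qed.

(** With b inverse to f + g, either b f is injective or it is nilpotent. In the second case b f
    fixes the kernel of g pointwise, so that this kernel is 0. *)
Lemma indec_local M (f g : rep_hom M M) : indecomposable M ->
  injective_hom (addh f g) -> injective_hom f \/ injective_hom g.
Proof.
move=> Mi fgi; have [b [bE _]] := bij_inverse fgi (end_inj_surj fgi).
have [ui|[n un]] := fitting (comph b f) Mi.
  left=> i; apply: lker_inj => x fx; apply: (inj_eq0 (ui i)).
  by rewrite comphE fx linear0.
right=> i; apply: lker_inj => x gx.
have ux : comph b f i x = x.
  have := congr1 (fun h : rep_hom M M => h i x) bE.
  by rewrite !comphE addhE gx addr0 idhE.
have : iterh (comph b f) n i x = x.
  by elim: n {un} => [|n IH] /=; rewrite ?idhE // comphE IH ux.
by rewrite un zerohE.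
Qed.
End Extensions.

(** By [pairing_dim] the map from W to the dual of X has full rank, so that every functional on X is
    given by some w. *)
Lemma pairing_solve (k : fieldType) (U W : vectType k) (X : {vspace U}) (b : U -> W -> k^o) :
  (forall x, linear (b x)) -> (forall w, linear (b^~ w)) ->
  (forall x, x \in X -> (forall w, b x w = 0) -> x = 0) ->
  forall m : 'Hom(U, k^o), exists w, forall x, x \in X -> b x w = m x.
Proof.
move=> bl br bX m.
pose r w (x : subvs_of X) : k^o := b (vsval x) w.
have rl x : linear (r x) by move=> c u v; rewrite /r linearP br.
pose f x : 'Hom(subvs_of X, k^o) := linfun (r x).
have fl : linear f.
  move=> c x y; apply/lfunP => w; rewrite add_lfunE scale_lfunE.
  by rewrite /f !(linfunE (rl _)) /r bl.
have fE w x (xX : x \in X) : linfun f w (Subvs xX) = b x w.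
  by rewrite (linfunE fl) /f (linfunE (rl _)).
have dimX : (\dim X + \dim (lker (linfun f)) = \dim {: W})%N.
  apply: (@pairing_dim _ _ _ X (lker (linfun f)) b) => //.
    by move=> x w xX; rewrite memv_ker => /eqP fw; rewrite -(fE _ _ xX) fw zero_lfunE.
  move=> w bw; rewrite memv_ker; apply/eqP/lfunP => -[x xX].
  by rewrite fE zero_lfunE bw.
have fs : limg (linfun f) = fullv.
  apply/eqP; rewrite eqEdim subvf /= dim_lfun !dimvf muln1.
  have := limg_ker_dim (linfun f) fullv; rewrite capfv -dimX => /eqP.
  by rewrite addnC eqn_add2r => /eqP ->; rewrite -[dim _]/(\dim X).
have [w wE] := (limg_surj (linfun f)).1 fs (m \o linfun (@vsval _ _ X))%VF.
by exists w => x xX; rewrite -(fE _ _ xX) wE comp_lfunE lfunE.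
Qed.

(** * Auslander-Reiten sequences *)

Section AuslanderReiten.
Variables (k : finFieldType) (Q : quiver).
Implicit Types M N L A B C X Y : rep k Q.

(* The cocycles of almost split sequences. *)
Definition ARz M N (z : C1 M N) := [/\ z \notin B1 M N,
  forall X (h : rep_hom X M), ~ split_epi h -> pre1 h z \in B1 X N &
  forall Y (h : rep_hom N Y), ~ split_mono h -> post1 h z \in B1 M Y].

Lemma is_tauP N M :
  is_tau N M <-> [/\ indecomposable N, indecomposable M & exists z : C1 M N, ARz z].
Proof.
split=> [[L [f [g [fg Ni Mi ns [rs ls]]]]]|[Ni Mi [z [zB rz lz]]]].
  split=> //; have [z [phi [psi [Ef Eg E1 E2]]]] := ses_cocycle fg.
  exists z; split=> [|X h nh|Y h nh].
  - apply/negP => /ext_split /split_epiP [s Es]; apply: ns; apply/split_epiP.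
    by exists (comph phi s); rewrite comphA Eg.
  - have [h' hE] := rs X h nh; apply/ext_lift; exists (comph psi h').
    apply: hom_ext => i x; rewrite -hE [RHS]comp_lfunE -Eg !comphE.
    by rewrite -(comphE phi psi) E1 idhE.
  have [h' hE] := ls Y h nh; apply/ext_extend; exists (comph h' phi).
  by rewrite -comphA Ef; apply: hom_ext => i x; rewrite [LHS]comphE -hE [RHS]comp_lfunE.
exists (extrep z), (exti z), (extp z); split=> //; first exact: ext_ses.
  by move/ext_split; apply/negP.
split=> [X h /rz/ext_lift [h' <-]|Y h /lz/ext_extend [h' <-]]; exists h' => i;
  by apply/lfunP => x; rewrite [RHS]comphE comp_lfunE.
Qed.

(** Composition with arbitrary cochains of degree 0, not only with homomorphisms, so that pairings
    are bilinear on all of C0. *)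
Definition postc X M N (g : C0 M N) (z : C1 X M) : C1 X N :=
  fun a => (g (tgt a) \o z a)%VF.
Definition prec X M N (g : C0 M N) (z : C1 N X) : C1 M X :=
  fun a => (z a \o g (src a))%VF.

Lemma postc_linl X M N (z : C1 X M) : linear (fun g : C0 M N => postc g z).
Proof. by move=> c g h; apply: C1P => a x; rewrite !(CE, comp_lfunE). Qed.
Lemma postc_linr X M N (g : C0 M N) : linear (@postc X M N g).
Proof. by move=> c y z; apply: C1P => a x; rewrite !(CE, comp_lfunE) linearP. Qed.
Lemma prec_linl X M N (z : C1 N X) : linear (fun g : C0 M N => prec g z).
Proof. by move=> c g h; apply: C1P => a x; rewrite !(CE, comp_lfunE) linearP. Qed.
Lemma prec_linr X M N (g : C0 M N) : linear (@prec X M N g).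
Proof. by move=> c y z; apply: C1P => a x; rewrite !(CE, comp_lfunE). Qed.

Lemma dlin_B1 M N (u : C0 M N) : dfun u \in B1 M N.
Proof. by apply/B1P; exists u => a x; rewrite dfunE. Qed.

Section Formula.
Variables (M N : rep k Q) (z : C1 M N).
Hypothesis zAR : ARz z.

(** The extension given by u does not split, so z splits when pulled back along its projection to M;
    the splitting restricted to Y is g. *)
Lemma AR_nondeg1 Y (u : C1 M Y) : u \notin B1 M Y ->
  exists g : rep_hom Y N, z - post1 g u \in B1 M N.
Proof.
move=> uB; have [_ rz _] := zAR.
have /rz/B1P [w wE] : ~ split_epi (extp u) by move/ext_split; apply/negP.
pose g i : 'Hom(Y i, N i) := (w i \o exti u i)%VF.
have gE i y : g i y = w i (y, 0) by rewrite comp_lfunE extiE.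
have gc a y : g (tgt a) (rmap Y a y) = rmap N a (g (src a) y).
  have := wE a (y, 0); rewrite ppE extpE rmap_extE /= !linear0 addr0 => /esym/eqP.
  by rewrite subr_eq0 -!gE => /eqP.
exists (mkhom gc); apply/B1P.
pose j i : 'Hom(M i, extrep u i) := linfun (fun m => (0, m) : (Y i * M i)%type).
have jE i m : j i m = (0, m) by rewrite (linfunE (@inr_linear _ _ _)).
exists (fun i => w i \o j i)%VF => a x; rewrite !CE post1E mkhomE gE !comp_lfunE !jE.
have := wE a (0, x); rewrite ppE extpE rmap_extE /= linear0 add0r => ->.
rewrite addrAC -linearB; congr (w _ _ - _); congr (_, _) => /=.
  by rewrite subrr.
by rewrite subr0.
Qed.

(** Since g is nonzero, the projection c to its cokernel is not a split monomorphism. So c maps z to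
    a coboundary, and z can be moved into the image of g. *)
Lemma AR_nondeg2 Y (g : rep_hom Y N) : g <> zeroh Y N ->
  exists u : C1 M Y, z - post1 g u \in B1 M N.
Proof.
move=> g0; have [_ _ lz] := zAR; have [C [c [cs cg]]] := coker_exists g.
have /lz/B1P [v vE] : ~ split_mono c.
  case/split_monoP=> r rc; apply: g0; apply: hom_eq0 => i y.
  rewrite -[g i y](idhE (M := N)) -rc comphE.
  have : g i y \in lker (c i) by rewrite cg memv_img ?memvf.
  by rewrite memv_ker => /eqP ->; rewrite linear0.
pose v' i : 'Hom(M i, N i) := ((c i)^-1 \o v i)%VF.
have cv i x : c i (v' i x) = v i x by rewrite comp_lfunE limg_lfunVK // cs memvf.
pose w a := (z a - dfun (v' : C0 M N) a)%VF.
have wE a x : w a x = z a x - (v' (tgt a) (rmap M a x) - rmap N a (v' (src a) x)).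
  by rewrite add_lfunE opp_lfunE -dfunE.
pose u : C1 M Y := fun a => ((g (tgt a))^-1 \o w a)%VF.
exists u; suff -> : z - post1 g u = dfun (v' : C0 M N) by apply: dlin_B1.
apply: C1P => a x; rewrite !CE ppE /u comp_lfunE limg_lfunVK.
  by rewrite wE opprB addrC subrK dfunE.
rewrite -cg memv_ker wE 2!linearB /= cv hcommE cv.
by have := vE a x; rewrite ppE => ->; rewrite subrr.
Qed.

Lemma AR_nondeg3 Y (u : C1 Y N) : u \notin B1 Y N ->
  exists g : rep_hom M Y, z - pre1 g u \in B1 M N.
Proof.
move=> uB; have [_ _ lz] := zAR.
have /lz/B1P [w wE] : ~ split_mono (exti u).
  by move/(ses_split_mono (ext_ses u))/ext_split; apply/negP.
pose g i : 'Hom(M i, Y i) := (extp u i \o w i)%VF.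
have gE i y : g i y = (w i y).2 by rewrite comp_lfunE extpE.
have H a x : (z a x, 0) = (((w (tgt a) (rmap M a x)).1 - (rmap N a (w (src a) x).1 +
    u a (w (src a) x).2), (w (tgt a) (rmap M a x)).2 - rmap Y a (w (src a) x).2)
    : (N (tgt a) * Y (tgt a))%type).
  by have := wE a x; rewrite ppE extiE rmap_extE => ->.
have gc a y : g (tgt a) (rmap M a y) = rmap Y a (g (src a) y).
  by have [_ /esym/eqP] := H a y; rewrite subr_eq0 -!gE => /eqP.
(* The first component of the coboundary equation expresses z as a coboundary minus u composed with
   the second component of w, whence the sign. *)
exists (scaleh (-1) (mkhom gc)); apply/B1P.
pose p i : 'Hom(extrep u i, N i) := linfun (fun v : N i * Y i => v.1).
have pE i m : p i m = m.1 by rewrite (linfunE (@fst_linear _ _ _)).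
exists (fun i => p i \o w i)%VF => a x; rewrite !CE pre1E scalehE mkhomE gE !comp_lfunE !pE.
rewrite linearZ /= scaleN1r opprK.
by have [-> _] := H a x; rewrite opprD addrA subrK.
Qed.

Lemma AR_nondeg4 Y (g : rep_hom M Y) : g <> zeroh M Y ->
  exists u : C1 Y N, z - pre1 g u \in B1 M N.
Proof.
move=> g0; have [_ rz _] := zAR; have [K [c [ci cg]]] := ker_exists g.
have gc0 i x : g i (c i x) = 0.
  by apply/eqP; rewrite -memv_ker -cg memv_img ?memvf.
have /rz/B1P [v vE] : ~ split_epi c.
  case/split_epiP=> r rc; apply: g0; apply: hom_eq0 => i y.
  by rewrite -[y]idhE -rc comphE gc0.
pose v' i : 'Hom(M i, N i) := (v i \o (c i)^-1)%VF.
have cv i x : v' i (c i x) = v i x by rewrite comp_lfunE lker0_lfunK //; apply/lker0P.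
pose w a := (z a - dfun (v' : C0 M N) a)%VF.
have wE a x : w a x = z a x - (v' (tgt a) (rmap M a x) - rmap N a (v' (src a) x)).
  by rewrite add_lfunE opp_lfunE -dfunE.
pose u : C1 Y N := fun a => (w a \o (g (src a))^-1)%VF.
exists u; suff -> : z - pre1 g u = dfun (v' : C0 M N) by apply: dlin_B1.
have uE a x : u a (g (src a) x) = w a x.
  rewrite -comp_lfunE lfun_factor // => {}x /eqP; rewrite -memv_ker -cg.
  case/memv_imgP=> y _ ->; rewrite wE -hcommE !cv -vE ppE subrr //.
by apply: C1P => a x; rewrite !CE ppE uE wE opprB addrC subrK dfunE.
Qed.

Lemma AR_functional : exists l : 'Hom(C1 M N, k^o),
  (forall x, x \in B1 M N -> l x = 0) /\ l z = 1.
Proof. by have [zB _ _] := zAR; apply: exists_functional. Qed.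

(** Let l vanish on coboundaries and be 1 at z. Then (g, u) -> l (g u) is a perfect pairing of
    Hom(Y, N) with Ext^1(M, Y): by the preceding lemmas a nonzero g or a nonzero class u can be
    completed to a product equal to z up to a coboundary, where l is 1. *)
Lemma AR_formula1 Y : ed M Y = hd Y N.
Proof.
have [l [lB lz]] := AR_functional.
suff : (hd Y N + \dim (B1 M Y) = \dim {: C1 M Y})%N by rewrite /ed; lia.
apply: (@pairing_dim _ _ _ (Z0 Y N) (B1 M Y) (fun g u => l (postc g u))).
- by move=> g c u v; rewrite postc_linr linearP.
- by move=> u c g h; rewrite postc_linl linearP.
- by move=> _ u /Z0_hom [g ->] uB; exact: lB (post1_B1 g uB).
- move=> _ /Z0_hom [g ->] gu; have [->|/AR_nondeg2 [u]] := pselect (g = zeroh Y N).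
    by apply: C0P => i x; rewrite [RHS]CE zerohE.
  move/lB; rewrite linearB /= lz gu subr0 => /eqP; rewrite oner_eq0 //.
- move=> u gu; apply/negP => /negP /AR_nondeg1 [g] /lB.
  rewrite linearB /= lz (gu _ (hom_Z0 g)) subr0 => /eqP; rewrite oner_eq0 //.
Qed.

Lemma AR_formula2 Y : ed Y N = hd M Y.
Proof.
have [l [lB lz]] := AR_functional.
suff : (hd M Y + \dim (B1 Y N) = \dim {: C1 Y N})%N by rewrite /ed; lia.
apply: (@pairing_dim _ _ _ (Z0 M Y) (B1 Y N) (fun g u => l (prec g u))).
- by move=> g c u v; rewrite prec_linr linearP.
- by move=> u c g h; rewrite prec_linl linearP.
- by move=> _ u /Z0_hom [g ->] uB; exact: lB (pre1_B1 g uB).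
- move=> _ /Z0_hom [g ->] gu; have [->|/AR_nondeg4 [u]] := pselect (g = zeroh M Y).
    by apply: C0P => i x; rewrite [RHS]CE zerohE.
  move/lB; rewrite linearB /= lz gu subr0 => /eqP; rewrite oner_eq0 //.
- move=> u gu; apply/negP => /negP /AR_nondeg3 [g] /lB.
  rewrite linearB /= lz (gu _ (hom_Z0 g)) subr0 => /eqP; rewrite oner_eq0 //.
Qed.
End Formula.
End AuslanderReiten.

(** * Semisimple test representations *)

Section SemisimpleReps.
Variables (k : finFieldType) (Q : quiver).

Definition ssrep (x : vertex Q -> nat) : rep k Q :=
  @Rep k Q (fun i => 'rV[k]_(x i) : vectType k) (fun a => 0).

Lemma dim_ssrep x i : \dim {: ssrep x i} = x i.
Proof. by rewrite dimvf; apply: mul1n. Qed.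

(** Counts the vertices reachable from i, a rank function that drops strictly along every arrow of
    an acyclic quiver. *)
Definition height (i : vertex Q) :=
  #|[pred j | connect [rel i j | [exists b : arrow Q, (src b == i) && (tgt b == j)]] i j]|.

Lemma height_lt (a : arrow Q) : acyclic Q -> (height (tgt a) < height (src a))%N.
Proof.
move=> ac; apply: proper_card; apply/properP; split; last first.
  by exists (src a); rewrite inE ?connect0 //; apply: ac.
apply/subsetP=> j; rewrite !inE; apply: connect_trans; apply: connect1.
by apply/existsP; exists a; rewrite !eqxx.
Qed.

(** Such an x turns a bound on Hom from one fixed semisimple representation into a bound on the
    total dimension of the target. *)
Lemma test_vector : acyclic Q -> exists x : vertex Q -> nat,
  forall y : vertex Q -> int, (forall i, 0 <= y i) ->
    \sum_i y i <= euler (fun i => (x i)%:Z) y.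
Proof.
move=> ac; pose A := #|arrow Q|; pose n := #|vertex Q|.
(* Along an arrow x grows at least by the factor A + 1, with A the number of arrows, so that x at a
   vertex exceeds the sum of x over the sources of all arrows into it. *)
pose x i := ((A.+1) ^ (n - height i))%N; exists x => y y0.
have hn i : (height i <= n)%N by apply: max_card.
have xj j : ((\sum_(a : arrow Q | tgt a == j) x (src a)).+1 <= x j)%N.
  have [/card0_eq E|/card_gt0P [a0 /eqP a0j]] :=
      posnP #|[pred a : arrow Q | tgt a == j]|.
    by rewrite big_pred0 ?expn_gt0 // => a; have := E a; rewrite inE.
  have e0 : (0 < n - height j)%N.
    by have := height_lt a0 ac; have := hn (src a0); rewrite a0j; lia.
  rewrite /x -(prednK e0) expnS mulSn -addn1 addnC leq_add ?expn_gt0 //.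
  apply: (@leq_trans (\sum_(a : arrow Q | tgt a == j) A.+1 ^ (n - height j).-1)).
    apply: leq_sum => a /eqP aj; rewrite leq_exp2l ?ltnS //; last first.
      by rewrite -/A; apply/card_gt0P; exists a.
    by have := height_lt a ac; rewrite aj; have := hn (src a); lia.
  rewrite sum_nat_const leq_mul2r; apply/orP; right.
  exact: max_card.
rewrite /euler lerBrDr -lerBrDl -sumrB.
rewrite (partition_big (@tgt Q) predT) //=; apply: ler_sum => j _.
rewrite (eq_bigr (fun a => (x (src a))%:Z * y j)); last by move=> a /eqP ->.
rewrite -mulr_suml -[X in _ <= _ - X]mul1r -mulrBl; apply: ler_wpM2r => //.
by rewrite lerBrDr -(big_morph Posz PoszD (erefl _)) addrC; have := xj j; lia.
Qed.
End SemisimpleReps.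

(** * Existence of almost split sequences *)

Section ARExistence.
Variables (k : finFieldType) (Q : quiver).
Implicit Types M N L A B C X Y : rep k Q.
Hypothesis ac : acyclic Q.
Variable M : rep k Q.

(* Functionals on Ext^1(M, Y); a reduced pair (Y, l) of largest dimension
   represents the functor Y |-> D Ext^1(M, Y). *)
Definition dext Y (l : 'Hom(C1 M Y, k^o)) := forall u, u \in B1 M Y -> l u = 0.

Definition reduced Y (l : 'Hom(C1 M Y, k^o)) := dext l /\
  forall S (j : rep_hom S Y), injective_hom j ->
    (forall u : C1 M S, l (post1 j u) = 0) -> is_zero S.

Lemma post1_comp X Y Z (g : rep_hom Y Z) (f : rep_hom X Y) (u : C1 M X) :
  post1 (comph g f) u = post1 g (post1 f u).
Proof. by apply: C1P => a x; rewrite !post1E comphE. Qed.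

Lemma post1_lift X Y (p : rep_hom X Y) (u : C1 M Y) : surjective_hom p ->
  exists v : C1 M X, post1 p v = u.
Proof.
move=> ps; exists (fun a => (p (tgt a))^-1 \o u a)%VF; apply: C1P => a x.
by rewrite ppE comp_lfunE limg_lfunVK // ps memvf.
Qed.

Lemma post1_zero X Y (u : C1 M X) : post1 (zeroh X Y) u = 0.
Proof. by apply: C1P => a x; rewrite post1E zerohE CE. Qed.

(** Cochains lift along X -> im g, so the functional vanishes on the image of g, which is therefore
    0. *)
Lemma reduced_inj Y (l : 'Hom(C1 M Y, k^o)) X (g : rep_hom X Y) : reduced l ->
  (forall u : C1 M X, l (post1 g u) = 0) -> g = zeroh X Y.
Proof.
move=> [_ lr] gl; have [I [K [p [j [i [ip ji gE]]]]]] := im_exists g.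
have I0 : is_zero I.
  apply: (lr I j) => // u; have [v <-] := post1_lift u (ses_surj ip).
  by rewrite -post1_comp -gE.
by apply: hom_eq0 => v x; rewrite gE comphE (I0 v (p v x)) linear0.
Qed.

(** Sending g to the functional u -> l (g u) embeds Hom(X, Y) in the dual of Ext^1(M, X). *)
Lemma reduced_hd Y (l : 'Hom(C1 M Y, k^o)) X : reduced l -> (hd X Y <= ed M X)%N.
Proof.
move=> lr; have [le _] := lr.
pose r (f : C0 X Y) (w : subvs_of (B1 M X)^C) : k^o := l (postc f (vsval w)).
have rl f : linear (r f) by move=> c u v; rewrite /r linearP postc_linr linearP.
pose phi f : 'Hom(subvs_of (B1 M X)^C, k^o) := linfun (r f).
have pl : linear phi.
  move=> c x y; apply/lfunP => w; rewrite add_lfunE scale_lfunE.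
  by rewrite /phi !(linfunE (rl _)) /r postc_linl linearP.
have -> : ed M X = \dim {: 'Hom(subvs_of (B1 M X)^C, k^o)}.
  rewrite dim_lfun [X in (X * _)%N]dimvf -[dim (subvs_of _)]/(\dim (B1 M X)^C).
  by rewrite dimv_compl [\dim {: k^o}]dimvf muln1.
apply: (@dim_inj_leq _ _ _ (linfun phi)) => f; first by rewrite memvf.
case/Z0_hom=> {}f ->; rewrite (linfunE pl) => /lfunP f0.
suff -> : f = zeroh X Y by apply: C0P => i x; rewrite [RHS]CE zerohE.
apply: (reduced_inj lr) => u.
have : u \in (B1 M X + (B1 M X)^C)%VS by rewrite addv_complf memvf.
case/memv_addP=> v vB [w wC ->]; rewrite -[v]scale1r post1_linear linearP /=.
rewrite le ?scaler0 ?add0r; last exact: post1_B1.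
by have := f0 (Subvs wC); rewrite /phi (linfunE (rl _)) /r zero_lfunE.
Qed.

(** For the semisimple X with the test vector as dimension vector, the total dimension of Y is at
    most its Euler pairing with X, hence at most dim Hom(X, Y), which Ext^1(M, X) bounds
    independently of Y. *)
Lemma reduced_bound : exists b, forall Y (l : 'Hom(C1 M Y, k^o)),
  reduced l -> (tdim Y <= b)%N.
Proof.
have [x xP] := test_vector ac; exists (ed M (ssrep k x)) => Y l lr.
have := reduced_hd (ssrep k x) lr; have := xP (dv Y) (dv_pos Y).
have -> : (fun i => (x i)%:Z) = dv (ssrep k x).
  by apply/funext => i; rewrite /dv /dim_vector dim_ssrep.
rewrite -euler_formula -(big_morph Posz PoszD (erefl _)) -/(tdim Y).
by lia.
Qed.

(** Take a quotient of least dimension through which the functional factors; a nonzero subobject on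
    which it vanishes could still be divided out. *)
Lemma reduce Y (l : 'Hom(C1 M Y, k^o)) : dext l ->
  exists Z (p : rep_hom Y Z) (n : 'Hom(C1 M Z, k^o)),
    [/\ surjective_hom p, reduced n & forall u, l u = n (post1 p u)].
Proof.
move=> le.
have [|[Z [p n]] /= [[ps ne lE] Zm]] := @minimize_nat
  {Z : rep k Q & (rep_hom Y Z * 'Hom(C1 M Z, k^o))%type}
  (fun z => [/\ surjective_hom (tagged z).1, dext (tagged z).2 &
     forall u, l u = (tagged z).2 (post1 (tagged z).1 u)]) (fun z => tdim (tag z)).
  exists (existT _ Y (idh Y, l)); split=> //= [i|u].
    by apply/limg_surj=> x; exists x; rewrite idhE.
  by congr (l _); apply: C1P => a x; rewrite post1E idhE.
exists Z, p, n; split=> //; split=> // S j ji jn.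
have [C [q jq]] := mono_ses ji.
pose q1 := linfun (@post1 _ _ M Z C q).
have q1E u : q1 u = post1 q u by rewrite (linfunE (@post1_linear _ _ _ _ _ q)).
(* The functional descends to C: a cochain that q kills takes values in S, where n vanishes. *)
pose n' : 'Hom(C1 M C, k^o) := (n \o q1^-1)%VF.
have n'E u : n' (post1 q u) = n u.
  rewrite -q1E -[LHS]comp_lfunE lfun_factor // => {}u; rewrite q1E => qu.
  pose v : C1 M S := fun a => ((j (tgt a))^-1 \o u a)%VF.
  rewrite -(jn v); congr (n _); apply: C1P => a x; rewrite ppE comp_lfunE.
  have [|y ->] := ses_ker jq (x := u a x) (i := tgt a).
    by rewrite -post1E qu CE.
  by rewrite lker0_lfunK //; apply/lker0P/ji.
have := Zm (existT _ C (comph q p, n')) => /=.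
rewrite (ses_tdim jq) is_zeroP => H; suff /H : [/\ surjective_hom (comph q p), dext n' &
   forall u, l u = n' (post1 (comph q p) u)] by lia.
split; first exact: surj_comp (ses_surj jq).
  move=> w /B1P [u uE].
  pose u' : C0 M Z := fun i => ((q i)^-1 \o u i)%VF.
  have qu i x : q i (u' i x) = u i x.
    by rewrite comp_lfunE limg_lfunVK // (ses_surj jq) memvf.
  have -> : w = post1 q (dfun u').
    by apply: C1P => a x; rewrite ppE dfunE linearB /= qu hcommE qu uE.
  by rewrite n'E ne // dlin_B1.
by move=> u; rewrite post1_comp n'E lE.
Qed.

(** For a reduced (T, l) of largest dimension and any (X, l'), reduce the sum of the functionals on
    X + T to some Z. Then T embeds in Z because l is reduced, and fills it by maximality, so that X
    -> Z gives the map to T. *)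
Lemma tau_representable : exists T (l : 'Hom(C1 M T, k^o)), reduced l /\
  forall X (l' : 'Hom(C1 M X, k^o)), dext l' ->
    exists g : rep_hom X T, forall u, l' u = l (post1 g u).
Proof.
have [b bP] := reduced_bound.
have [||[T l] /= [lr Tm]] := @maximize_nat
  {Y : rep k Q & 'Hom(C1 M Y, k^o)} (fun z => reduced (tagged z))
  (fun z => tdim (tag z)) b.
- have z0 i (v : rep0 k Q i) : v = 0 by apply/rowP => -[].
  exists (existT _ (rep0 k Q) (0 : 'Hom(C1 M (rep0 k Q), k^o))); split=> [u _|S j ji _ i x]; first by rewrite zero_lfunE.
  by apply: (ji i); rewrite linear0; apply: z0.
- by move=> [Y l] /= lr; apply: bP lr.
exists T, l; split=> // X l' l'e; have [le lred] := lr.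
pose m0 (u : C1 M (dsum X T)) : k^o := l' (post1 (fsth X T) u) + l (post1 (sndh X T) u).
have m0l : linear m0.
  by move=> c u v; rewrite /m0 !post1_linear !linearP /= scalerDr addrACA.
pose m := linfun m0; have mE u : m u = m0 u by rewrite (linfunE m0l).
have [|Z [p [n [ps nr nE]]]] := @reduce (dsum X T) m.
  by move=> u uB; rewrite mE /m0 l'e ?le ?addr0 //; apply: post1_B1.
have ml u : m (post1 (inlh X T) u) = l' u.
  rewrite mE /m0 -!post1_comp.
  have -> : comph (fsth X T) (inlh X T) = idh X
    by apply: hom_ext => i x; rewrite comphE inlhE fsthE idhE.
  have -> : comph (sndh X T) (inlh X T) = zeroh X T
    by apply: hom_ext => i x; rewrite comphE inlhE sndhE zerohE.
  rewrite post1_zero linear0 addr0; congr (l' _).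
  by apply: C1P => a x; rewrite post1E idhE.
have mr u : m (post1 (inrh X T) u) = l u.
  rewrite mE /m0 -!post1_comp.
  have -> : comph (fsth X T) (inrh X T) = zeroh T X
    by apply: hom_ext => i x; rewrite comphE inrhE fsthE zerohE.
  have -> : comph (sndh X T) (inrh X T) = idh T
    by apply: hom_ext => i x; rewrite comphE inrhE sndhE idhE.
  rewrite post1_zero linear0 add0r; congr (l _).
  by apply: C1P => a x; rewrite post1E idhE.
pose t := comph p (inrh X T).
have nt u : n (post1 t u) = l u by rewrite post1_comp -nE mr.
have ti : injective_hom t.
  have [K [j [ji jt]]] := ker_exists t.
  have K0 : is_zero K.
    apply: (lred K j) => // u; rewrite -nt -post1_comp.
    have -> : comph t j = zeroh K Z.
      apply: hom_eq0 => i x; rewrite comphE; apply/eqP.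
      by rewrite -memv_ker -jt memv_img ?memvf.
    by rewrite post1_zero linear0.
  move=> i; apply: lker_inj => x /eqP; rewrite -memv_ker -jt.
  by case/memv_imgP => y _ ->; rewrite (K0 i y) linear0.
have tsu : surjective_hom t.
  by apply: inj_tdim_surj => //; apply: (Tm (existT _ Z n)).
have [t' [_ tt']] := bij_inverse ti tsu.
exists (comph t' (comph p (inlh X T))) => u.
by rewrite -nt -post1_comp !comphA tt' comp1h post1_comp -nE ml.
Qed.

(** T represents D Ext^1(M, -) and is nonzero as M is not projective. N is an indecomposable summand
    of T, and z is dual to a functional on Hom(N, T) that kills the radical maps. *)
Lemma AR_exists : indecomposable M -> ~ projective M -> exists N, is_tau N M.
Proof.
move=> Mi Mp; have [T [l [lr univ]]] := tau_representable; have [le lred] := lr.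
have T0 : ~ is_zero T.
  move=> T0; apply: Mp; apply/projective_ed => Y; apply/ed0P => z.
  apply: contrapT => /negP /exists_functional [l' [l'B l'z]].
  have [g gE] := univ Y l' l'B; move/eqP: l'z; rewrite gE.
  have -> : post1 g z = 0.
    by apply: C1P => a x; rewrite CE; apply: T0.
  by rewrite linear0 eq_sym oner_eq0.
have [N [B [Ni eT]]] := indec_summand T0; exists N.
have [i [p pi]] : exists (i : rep_hom N T) (p : rep_hom T N), comph p i = idh N.
  have [f [g fg]] := rep_iso_sym eT.
  exists (comph f (inlh N B)), (comph (fsth N B) g); apply: hom_ext => v x.
  by rewrite !comphE -(comp_lfunE (g v)) (fg v).1 id_lfunE inlhE fsthE idhE.
(* The maps N -> T that are not split monomorphisms; they form a subspace because End(N) is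
   local. *)
have [|||Rad RadP] := @closed_vspace _ (C0 N T)
    (fun u => exists f : rep_hom N T, u = hfun f /\
       forall c : rep_hom T N, ~ injective_hom (comph c f)).
- exists (zeroh N T); split; first by apply: C0P => v x; rewrite [LHS]CE zerohE.
  move=> c ci; case: Ni => N0 _; apply: N0 => v x; apply: (ci v).
  by rewrite !comphE !zerohE.
- move=> _ _ [f [-> fP]] [g [-> gP]]; exists (addh f g).
  split; first by apply: C0P => v x; rewrite [LHS]CE addhE.
  move=> c ci; have E : comph c (addh f g) = addh (comph c f) (comph c g).
    by apply: hom_ext => v x; rewrite comphE !addhE !comphE linearD.
  by move: ci; rewrite E => /(indec_local Ni) [/fP|/gP].
- move=> c _ [f [-> fP]]; exists (scaleh c f); split; first by apply: C0P => v x; rewrite [LHS]CE scalehE.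
  move=> d di; apply: (fP (scaleh c d)).
  suff -> : comph (scaleh c d) f = comph d (scaleh c f) by [].
  by apply: hom_ext => v x; rewrite !comphE !scalehE linearZ.
have iR : (hfun i : C0 N T) \notin Rad.
  apply/negP => /RadP [f [fE fP]]; apply: (fP p).
  have <- : i = f.
    by apply: hom_ext => v x; rewrite -[LHS]/((hfun i : C0 N T) v x) fE.
  by rewrite pi => v x y; rewrite !idhE.
have [m [mR mi]] := exists_functional iR.
(* The pairing of Hom(N, T) with cochains is nondegenerate on the left, so a cochain z exists with l
   (f z) = m f for all f. *)
have [|||z zE] := @pairing_solve _ _ _ (Z0 N T) (fun g u => l (@postc _ _ M N T g u)) _ _ _ m.
- by move=> g c u v; rewrite postc_linr linearP.
- by move=> u c g h; rewrite postc_linl linearP.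
- move=> _ /Z0_hom [g ->] gl.
  suff -> : g = zeroh N T by apply: C0P => v x; rewrite [RHS]CE zerohE.
  exact: (reduced_inj lr).
have {}zE (f : rep_hom N T) : l (post1 f z) = m (hfun f) by apply: zE (hom_Z0 f).
have zB : z \notin B1 M N.
  apply/negP => zB; have := zE i; rewrite mi le; last exact: post1_B1.
  by move/eqP; rewrite eq_sym oner_eq0.
(* Every functional on Ext^1(M, Y) comes from some g : Y -> T; its value at h z is m (g h), and g h
   is radical when h is not a split monomorphism. *)
have lz Y (h : rep_hom N Y) : ~ split_mono h -> post1 h z \in B1 M Y.
  move=> nh; apply: contrapT => /negP /exists_functional [l' [l'B l'z]].
  have [g gE] := univ Y l' l'B.
  move/eqP: l'z; rewrite gE -post1_comp zE mR ?(eq_sym 0) ?oner_eq0 //.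
  apply/RadP; exists (comph g h); split=> // c ci.
  have [d [dE _]] := bij_inverse ci (end_inj_surj ci).
  by apply: nh; apply/split_monoP; exists (comph d (comph c g)); rewrite -!comphA.
(* The right lifting property follows from the left one: if z pulled back along h did not split, the
   extension of z would map to the pulled-back one and back, the identity on N. The endomorphism
   [comph h v] induced on M is invertible, and then h splits, or nilpotent, and then z splits. *)
apply/is_tauP; split=> //; exists z; split=> // X h nh.
apply: contrapT => /negP zhB; pose z' := pre1 h z.
have ns : ~ split_mono (exti z').
  by move/(ses_split_mono (ext_ses z'))/ext_split; apply/negP.
have /ext_extend [r rE] := lz _ _ ns.
pose c0 j : 'Hom(extrep z' j, extrep z j) :=
  linfun (fun v : N j * X j => (v.1, h j v.2) : (N j * M j)%type).
have c0E j v : c0 j v = (v.1, h j v.2).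
  by rewrite linfunE // => d x y; rewrite /= linearP.
have c0c a v : c0 (tgt a) (rmap (extrep z') a v) = rmap (extrep z) a (c0 (src a) v).
  by rewrite !c0E !rmap_extE /= hcommE ppE.
pose c := mkhom c0c.
have pc : comph (extp z) c = comph h (extp z').
  by apply: hom_ext => j x; rewrite !comphE mkhomE c0E !extpE.
have ci : comph c (exti z') = exti z.
  by apply: hom_ext => j x; rewrite comphE mkhomE c0E !extiE /= linear0.
pose rho := comph c r.
have rhoi : comph rho (exti z) = exti z by rewrite -comphA rE ci.
have [|v vE] := ses_factor_r (ext_ses z) (u := comph (extp z') r).
  apply: hom_ext => j x; rewrite -comphA rE comphE zerohE.
  by rewrite (ses_comp (ext_ses z')).
have prho : comph (extp z) rho = comph (comph h v) (extp z).
  by rewrite comphA pc -!comphA vE.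
have [phii|[n phin]] := fitting (comph h v) Mi.
  have [d [_ dE]] := bij_inverse phii (end_inj_surj phii).
  by apply: nh; apply/split_epiP; exists (comph v d); rewrite comphA.
have prn : comph (extp z) (iterh rho n) = comph (iterh (comph h v) n) (extp z).
  elim: n {phin} => [|n IH] /=; first by rewrite comph1 comp1h.
  by rewrite comphA prho -comphA IH comphA.
have rin : comph (iterh rho n) (exti z) = exti z.
  by elim: n {phin prn} => [|n IH] /=; rewrite ?comp1h // -comphA IH.
have [|s sE] := ses_factor_l (ext_ses z) (u := iterh rho n).
  by rewrite prn phin; apply: hom_ext => j x; rewrite comphE !zerohE.
move/negP: zB; apply; apply/ext_split; apply: ses_split_mono (ext_ses z) _.
apply/split_monoP; exists s; apply: hom_ext => j x.
apply: (ses_inj (ext_ses z) (i := j)); rewrite -comphE comphA -sE rin.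
by rewrite idhE.
Qed.
End ARExistence.

(** * Duality with the opposite quiver *)

Section Adjoint.
Import VectorInternalTheory.
Variable k : fieldType.
Implicit Types U V W : vectType k.

(** The transpose in the coordinates that every [vectType] carries: each space is identified with
    its dual, and taking the adjoint twice gives back the same map. *)
Definition adj U V (f : 'Hom(U, V)) : 'Hom(V, U) := vector.Hom (f2mx f)^T.

Lemma f2mx_inj U V (f g : 'Hom(U, V)) : f2mx f = f2mx g -> f = g.
Proof. by case: f g => [f] [g] /= ->. Qed.

Lemma adjK U V (f : 'Hom(U, V)) : adj (adj f) = f.
Proof. by apply: f2mx_inj; rewrite /= trmxK. Qed.

Lemma lfun_mxE U V (A : 'M[k]_(dim U, dim V)) x :
  (vector.Hom A : 'Hom(U, V)) x = r2v (v2r x *m A).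
Proof. by rewrite unlock. Qed.

Lemma f2mx_comp U V W (f : 'Hom(U, V)) (g : 'Hom(V, W)) :
  f2mx (g \o f)%VF = f2mx f *m f2mx g.
Proof.
suff -> : (g \o f)%VF = vector.Hom (f2mx f *m f2mx g) by [].
apply/lfunP => x; rewrite comp_lfunE; case: f => f; case: g => g /=.
by rewrite !lfun_mxE r2vK mulmxA.
Qed.

Lemma f2mx1 U : f2mx (\1%VF : 'End(U)) = 1%:M.
Proof.
suff -> : (\1%VF : 'End(U)) = vector.Hom 1%:M by [].
by apply/lfunP => x; rewrite lfun_mxE mulmx1 v2rK id_lfunE.
Qed.

Lemma f2mxP U V c (f g : 'Hom(U, V)) : f2mx (c *: f + g) = c *: f2mx f + f2mx g.
Proof.
suff -> : c *: f + g = vector.Hom (c *: f2mx f + f2mx g) by [].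
apply/lfunP => x; rewrite lfun_mxE mulmxDr -scalemxAr linearP /= !lfun_simp.
by case: f g => [f] [g] /=; rewrite !lfun_mxE.
Qed.

Lemma adj_comp U V W (f : 'Hom(U, V)) (g : 'Hom(V, W)) :
  adj (g \o f)%VF = (adj f \o adj g)%VF.
Proof. by apply: f2mx_inj; rewrite f2mx_comp /= f2mx_comp trmx_mul. Qed.

Lemma adj1 U : adj (\1%VF : 'End(U)) = \1%VF.
Proof. by apply: f2mx_inj; rewrite f2mx1 /= f2mx1 trmx1. Qed.

Lemma adj_linear U V : linear (@adj U V).
Proof. by move=> c f g; apply: f2mx_inj; rewrite f2mxP /= f2mxP linearP. Qed.
HB.instance Definition _ U V :=
  GRing.isLinear.Build k 'Hom(U, V) 'Hom(V, U) _ (@adj U V) (@adj_linear U V).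
End Adjoint.

Section Biproducts.
Variables (k : finFieldType) (Q : quiver).
Implicit Types M A B : rep k Q.

(** Direct sums by equations between homomorphisms, a form that transposition preserves. *)
Lemma biprodP M A B : rep_iso M (dsum A B) <->
  exists (i : rep_hom A M) (p : rep_hom M A) (j : rep_hom B M) (q : rep_hom M B),
    [/\ comph p i = idh A, comph q j = idh B & addh (comph i p) (comph j q) = idh M].
Proof.
split=> [[f [g fg]]|[i [p [j [q [pi qj s]]]]]].
  have gf v x : g v (f v x) = x by rewrite -comp_lfunE (fg v).1 id_lfunE.
  have fgE v x : f v (g v x) = x by rewrite -comp_lfunE (fg v).2 id_lfunE.
  exists (comph g (inlh A B)), (comph (fsth A B) f), (comph g (inrh A B)), (comph (sndh A B) f).
  split; apply: hom_ext => v x; rewrite !homE ?inlhE ?inrhE ?fgE ?fsthE ?sndhE //.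
  rewrite -linearD -[RHS]gf; congr (g v _); case: (f v x) => y z.
  by congr (_, _); rewrite /= ?addr0 ?add0r.
have pj v y : p v (j v y) = 0.
  have := congr1 (fun h : rep_hom M M => p v (h v (j v y))) s.
  rewrite !homE linearD /= -!(comphE p i) pi -(comphE q j) qj !homE => /eqP.
  by rewrite -subr_eq0 addrK => /eqP.
apply: (dsum_internal (f := i) (g := j)).
  move=> v x y E; have x0 : x = 0 by rewrite -[x]idhE -pi comphE E pj.
  by split=> //; rewrite -[y]idhE -qj comphE -E x0 linear0 linear0.
have pqi : injective_hom (pairh p q).
  move=> v; apply: lker_inj => x; rewrite pairhE => -[px qx].
  by rewrite -[x]idhE -s !homE px qx !linear0 addr0.
by have := inj_tdim pqi; rewrite tdim_dsum.
Qed.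
End Biproducts.

Section Duality.
Variables (k : finFieldType) (V A : finType).

Section Dual.
Variables s t : A -> V.
Notation Q := (Quiver s t).
Notation Q' := (Quiver t s).
Implicit Types M N : rep k Q.

(** The k-linear dual over the opposite quiver, on the same spaces, so that the double dual is equal
    to M and not only isomorphic to it. *)
Definition dual M : rep k Q' :=
  @Rep k Q' (rspace M) (fun a => adj (rmap M a)).

Definition dualh M N (f : rep_hom M N) : rep_hom (dual N) (dual M).
Proof.
exists ((fun i => adj (f i)) : forall i, 'Hom(dual N i, dual M i)) => a.
by rewrite /= -!adj_comp (hcomm f a).
Defined.

Lemma dualhE M N (f : rep_hom M N) i : dualh f i = adj (f i).
Proof. by []. Qed.

Lemma dualh_comp L M N (f : rep_hom L M) (g : rep_hom M N) :
  dualh (comph g f) = comph (dualh f) (dualh g).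
Proof. by apply: hom_ext => i x; rewrite comphE -comp_lfunE !dualhE -adj_comp. Qed.
Lemma dualh1 M : dualh (idh M) = idh (dual M).
Proof. by apply: hom_ext => i x; rewrite idhE dualhE adj1 id_lfunE. Qed.
Lemma dualhD M N (f g : rep_hom M N) : dualh (addh f g) = addh (dualh f) (dualh g).
Proof. by apply: hom_ext => i x; rewrite addhE !dualhE -add_lfunE -linearD. Qed.
Lemma dualh_inj M N (f g : rep_hom M N) : dualh f = dualh g -> f = g.
Proof.
move=> E; have H i : f i = g i.
  rewrite -[LHS]adjK -[RHS]adjK -[adj (f i)]/(dualh f i) -[adj (g i)]/(dualh g i).
  by rewrite E.
by apply: hom_ext => i x; rewrite H.
Qed.

Lemma dualh_full M N (h : rep_hom (dual N) (dual M)) : exists f, h = dualh f.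
Proof.
have fc (a : arrow Q) : ((adj (h (tgt a)) : 'Hom(M (tgt a), N (tgt a))) \o rmap M a
    = rmap N a \o (adj (h (src a)) : 'Hom(M (src a), N (src a))))%VF.
  apply: (can_inj (@adjK _ _ _)); rewrite !adj_comp !adjK.
  exact/esym/(hcomm h a).
exists (@Hom k Q M N (fun i => adj (h i)) fc).
by apply: hom_ext => i x; rewrite dualhE /= adjK.
Qed.

Lemma dual_zero M : is_zero (dual M) <-> is_zero M.
Proof. by rewrite !is_zeroP. Qed.
End Dual.

Lemma dualK (s t : A -> V) (M : rep k (Quiver s t)) : dual (dual M) = M.
Proof.
case: M => [sp mp]; congr (@Rep k (Quiver s t) sp _).
by apply: functional_extensionality_dep => a; apply: adjK.
Qed.

Lemma dual_ex (s t : A -> V) (M : rep k (Quiver t s)) :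
  exists M' : rep k (Quiver s t), M = dual M'.
Proof. by exists (dual M); rewrite dualK. Qed.

Section Dual2.
Variables s t : A -> V.
Notation Q := (Quiver s t).
Notation Q' := (Quiver t s).
Implicit Types M N : rep k Q.

Lemma dual_indec M : indecomposable M -> indecomposable (dual M).
Proof.
case=> M0 Mi; split; first by rewrite dual_zero.
move=> B C; have [B' ->] := dual_ex B; have [C' ->] := dual_ex C.
move=> /biprodP [i [p [j [q [pi qj sm]]]]]; rewrite !dual_zero; apply: Mi; apply/biprodP.
have [i' Ei] := dualh_full i; have [p' Ep] := dualh_full p.
have [j' Ej] := dualh_full j; have [q' Eq] := dualh_full q.
exists p', i', q', j'; split; apply: dualh_inj.
- by rewrite dualh_comp -Ei -Ep pi dualh1.
- by rewrite dualh_comp -Ej -Eq qj dualh1.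
- by rewrite dualhD !dualh_comp -Ei -Ep -Ej -Eq sm dualh1.
Qed.

Definition dual1 M N (z : C1 M N) : C1 (dual N) (dual M) := fun a => adj (z a).

Lemma dual1_B1 M N (z : C1 M N) : z \in B1 M N -> dual1 z \in B1 (dual N) (dual M).
Proof.
case/B1P=> u zu; apply/B1P.
have dE (a : arrow Q) : dual1 z a =
    ((adj (rmap M a) \o adj (u (tgt a))) - (adj (u (src a)) \o adj (rmap N a)))%VF.
  have zE : z a = ((u (tgt a) \o rmap M a) - (rmap N a \o u (src a)))%VF.
    by apply/lfunP => x; rewrite zu !lfun_simp.
  by rewrite /dual1 zE linearB /= !adj_comp.
(* Transposition exchanges the two terms of a coboundary, whence the sign. *)
exists (fun i => - adj (u i) : 'Hom(dual N i, dual M i)) => a x; rewrite dE.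
rewrite add_lfunE !opp_lfunE !comp_lfunE linearN opprK /=.
by rewrite addrC.
Qed.

Lemma dual1_B1K M N (z : C1 M N) : dual1 z \in B1 (dual N) (dual M) -> z \in B1 M N.
Proof.
case/B1P=> u zu; apply/B1P.
have dE (a : arrow Q) : z a = ((rmap N a \o (adj (u (src a)) : 'Hom(M (src a), N (src a))))
    - ((adj (u (tgt a)) : 'Hom(M (tgt a), N (tgt a))) \o rmap M a))%VF.
  have zE : dual1 z a = ((u (src a) \o adj (rmap N a)) - (adj (rmap M a) \o u (tgt a)))%VF.
    by apply/lfunP => x; rewrite zu add_lfunE opp_lfunE !comp_lfunE.
  by rewrite -[z a]adjK -[adj (z a)]/(dual1 z a) zE linearB /= !adj_comp !adjK.
exists (fun i => - adj (u i) : 'Hom(M i, N i)) => a x; rewrite dE.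
rewrite add_lfunE !opp_lfunE !comp_lfunE linearN opprK /=.
by rewrite addrC.
Qed.

Lemma dual_tau N M : is_tau N M -> is_tau (dual M) (dual N).
Proof.
case/is_tauP=> Ni Mi [z [zB rz lz]]; apply/is_tauP; split; [exact: dual_indec|exact: dual_indec|].
exists (dual1 z); split=> [|X|Y].
- by apply: contra zB; apply: dual1_B1K.
- have [X' ->] := dual_ex X => h; have [h' ->] := dualh_full h => ns.
  have -> : pre1 (dualh h') (dual1 z) = dual1 (post1 h' z).
    by apply: dprodP => a; rewrite /pre1 /dual1 /post1 adj_comp.
  apply/dual1_B1/lz => /split_monoP [r rE]; apply: ns; apply/split_epiP.
  by exists (dualh r); rewrite -dualh_comp rE dualh1.
- have [Y' ->] := dual_ex Y => h; have [h' ->] := dualh_full h => ns.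
  have -> : post1 (dualh h') (dual1 z) = dual1 (pre1 h' z).
    by apply: dprodP => a; rewrite /pre1 /dual1 /post1 adj_comp.
  apply/dual1_B1/rz => /split_epiP [r rE]; apply: ns; apply/split_monoP.
  by exists (dualh r); rewrite -dualh_comp rE dualh1.
Qed.

Lemma adj_surj (U W : vectType k) (f : 'Hom(U, W)) : injective f -> limg (adj f) = fullv.
Proof.
move=> fi; apply/limg_surj=> y; exists (adj (f^-1)%VF y).
rewrite -comp_lfunE -adj_comp lker0_compVf ?adj1 ?id_lfunE //.
exact/lker0P.
Qed.

Lemma dual_projective M : projective (dual M) -> injective_rep M.
Proof.
move=> Mp N L f h fi.
have [|h' hE] := Mp _ _ (dualh f) (dualh h); first by move=> i; apply: adj_surj (fi i).
have [h'' h'E] := dualh_full h'; exists h'' => i.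
by apply: (can_inj (@adjK _ _ _)); rewrite adj_comp -[RHS]hE h'E.
Qed.

Lemma dual_hd M N : hd (dual N) (dual M) = hd M N.
Proof.
pose F (u : C0 M N) : C0 (dual N) (dual M) := fun i => adj (u i).
pose G (u : C0 (dual N) (dual M)) : C0 M N := fun i => adj (u i).
have Fl : linear F by move=> c u v; apply: dprodP => i; apply: adj_linear.
have Gl : linear G by move=> c u v; apply: dprodP => i; apply: adj_linear.
apply/eqP; rewrite eqn_leq; apply/andP; split.
  apply: (@dim_inj_leq _ _ _ (linfun G)) => u uZ; rewrite (linfunE Gl).
    have [h hE] := Z0_hom uZ; have [h' h'E] := dualh_full h.
    suff -> : G u = hfun h' by apply: hom_Z0.
    by apply: dprodP => i; rewrite /G hE h'E dualhE adjK.
  move=> Gu; apply: dprodP => i; rewrite -[u i]adjK -[adj (u i)]/(G u i) Gu.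
  exact: linear0.
apply: (@dim_inj_leq _ _ _ (linfun F)) => u uZ; rewrite (linfunE Fl).
  by have [h ->] := Z0_hom uZ; apply: (hom_Z0 (dualh h)).
move=> Gu; apply: dprodP => i; rewrite -[u i]adjK -[adj (u i)]/(F u i) Gu.
exact: linear0.
Qed.

Lemma euler_dual (x y : V -> int) : @euler Q' x y = @euler Q y x.
Proof.
rewrite /euler; congr (_ - _); apply: eq_bigr => i _; rewrite mulrC //.
Qed.

Lemma dual_ed M N : ed (dual N) (dual M) = ed M N.
Proof.
have := euler_formula (dual N) (dual M); rewrite euler_dual dual_hd.
have := euler_formula M N; rewrite -[dv (dual M)]/(dv M) -[dv (dual N)]/(dv N).
by move=> <-; lia.
Qed.
End Dual2.
End Duality.

(** * The defect *)

Section EulerForm.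
Variable Q : quiver.
Implicit Types x y z w : vertex Q -> int.

Lemma eulerDl x y z w : (forall i, z i = x i + y i) ->
  euler z w = euler x w + euler y w.
Proof.
move=> zE; rewrite /euler addrACA -opprD -!big_split /=.
by congr (_ - _); apply: eq_bigr => i _; rewrite zE mulrDl.
Qed.
Lemma eulerDr x y z w : (forall i, z i = x i + y i) ->
  euler w z = euler w x + euler w y.
Proof.
move=> zE; rewrite /euler addrACA -opprD -!big_split /=.
by congr (_ - _); apply: eq_bigr => i _; rewrite zE mulrDr.
Qed.
Lemma eulerZl c x z w : (forall i, z i = c * x i) -> euler z w = c * euler x w.
Proof.
move=> zE; rewrite /euler mulrBr !mulr_sumr.
by congr (_ - _); apply: eq_bigr => i _; rewrite zE mulrA.
Qed.
Lemma eulerZr c x z w : (forall i, z i = c * x i) -> euler w z = c * euler w x.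
Proof.
move=> zE; rewrite /euler mulrBr !mulr_sumr.
by congr (_ - _); apply: eq_bigr => i _; rewrite zE mulrCA.
Qed.
Lemma eulerBl x y z w : (forall i, z i = x i - y i) ->
  euler z w = euler x w - euler y w.
Proof. by move=> zE; rewrite (@eulerDl z y x) ?addrK // => i; rewrite zE subrK. Qed.
Lemma eulerBr x y z w : (forall i, z i = x i - y i) ->
  euler w z = euler w x - euler w y.
Proof. by move=> zE; rewrite (@eulerDr z y x) ?addrK // => i; rewrite zE subrK. Qed.
Lemma euler0l z w : (forall i, z i = 0) -> euler z w = 0.
Proof. by move=> z0; rewrite (@eulerZl 0 z) ?mul0r // => i; rewrite z0 mul0r. Qed.
Lemma euler0r z w : (forall i, z i = 0) -> euler w z = 0.
Proof. by move=> z0; rewrite (@eulerZr 0 z) ?mul0r // => i; rewrite z0 mul0r. Qed.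

Definition ev (i : vertex Q) : vertex Q -> int := fun j => (j == i)%:Z.

Lemma euler_evl i y : euler (ev i) y = y i - \sum_(a | src a == i) y (tgt a).
Proof.
rewrite /euler (bigD1 i) //= /ev eqxx mul1r big1 ?addr0; last first.
  by move=> j /negPf ->; rewrite mul0r.
congr (_ - _); rewrite [RHS]big_mkcond; apply: eq_bigr => a _.
by case: eqP; rewrite ?mul1r ?mul0r.
Qed.
Lemma euler_evr i x : euler x (ev i) = x i - \sum_(a | tgt a == i) x (src a).
Proof.
rewrite /euler (bigD1 i) //= /ev eqxx mulr1 big1 ?addr0; last first.
  by move=> j /negPf ->; rewrite mulr0.
congr (_ - _); rewrite [RHS]big_mkcond; apply: eq_bigr => a _.
by case: eqP; rewrite ?mulr1 ?mulr0.
Qed.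

Lemma euler_suml x y : euler x y = \sum_i x i * euler (ev i) y.
Proof.
under eq_bigr do rewrite euler_evl mulrBr mulr_sumr.
rewrite sumrB; congr (_ - _).
rewrite (partition_big (@src Q) predT) //=; apply: eq_bigr => i _.
by apply: eq_bigr => a /eqP ->.
Qed.
Lemma euler_sumr x y : euler x y = \sum_i y i * euler x (ev i).
Proof.
under eq_bigr do rewrite euler_evr mulrBr mulr_sumr.
rewrite sumrB; congr (_ - _); first by apply: eq_bigr => i _; rewrite mulrC.
rewrite (partition_big (@tgt Q) predT) //=; apply: eq_bigr => i _.
by apply: eq_bigr => a /eqP ->; rewrite mulrC.
Qed.

Hypothesis ac : acyclic Q.

(** At a vertex of least height in the support of x, all outgoing arrows lead out of the support. *)
Lemma sink_vertex x : (exists i, x i != 0) ->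
  exists i, x i != 0 /\ euler (ev i) x = x i.
Proof.
case/(minimize_nat (@height Q)) => i [xi im]; exists i; split=> //.
rewrite euler_evl big1 ?subr0 // => a /eqP ai; apply/eqP/contraT => /im.
by have := height_lt a ac; rewrite ai; lia.
Qed.
Lemma source_vertex x : (exists i, x i != 0) ->
  exists i, x i != 0 /\ euler x (ev i) = x i.
Proof.
case/(maximize_nat (m := @height Q) (b := #|vertex Q|)) => [i _|i [xi im]].
  exact: max_card.
exists i; split=> //.
rewrite euler_evr big1 ?subr0 // => a /eqP ai; apply/eqP/contraT => /im.
by have := height_lt a ac; rewrite ai; lia.
Qed.

(** The Euler form of an acyclic quiver is unitriangular; a sink of the support of u detects u. *)
Lemma euler_nondeg_r u : (forall z, euler z u = 0) -> forall i, u i = 0.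
Proof.
move=> u0 i; apply/eqP/contraT => ui.
have [|j [uj]] := @sink_vertex u; first by exists i.
by rewrite u0 => /esym/eqP; rewrite (negPf uj).
Qed.
Lemma euler_nondeg_l u : (forall z, euler u z = 0) -> forall i, u i = 0.
Proof.
move=> u0 i; apply/eqP/contraT => ui.
have [|j [uj]] := @source_vertex u; first by exists i.
by rewrite u0 => /esym/eqP; rewrite (negPf uj).
Qed.
End EulerForm.

(* All that is used of an extended Dynkin diagram: [d] spans the radical of a
   positive semidefinite form, which is definite, hence proper, modulo [d]. *)
Definition tame_form (Q : quiver) (d : vertex Q -> int) : Prop :=
  [/\ forall i, 0 < d i,
      forall y, euler d y = - euler y d,
      forall x : vertex Q -> int, 0 <= euler x x,
      forall x, euler x x = 0 -> forall i j, x i * d j = x j * d i &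
      forall c : int, exists b : int, forall x : vertex Q -> int, euler x x <= c ->
        forall i j, `|x i * d j - x j * d i| <= b].

(** * The defect and the Auslander-Reiten translation *)

Section ARDimension.
Variables (k : finFieldType) (Q : quiver).
Implicit Types M N L X Y : rep k Q.

Lemma dv_ssrep (p : vertex Q -> nat) : dv (ssrep k p) = (fun i => (p i)%:Z).
Proof. by apply/funext => i; rewrite /dv /dim_vector dim_ssrep. Qed.

Definition simp (i : vertex Q) : rep k Q := ssrep k (fun j => (j == i) : nat).
Lemma dv_simp i : dv (simp i) = ev i.
Proof. by rewrite dv_ssrep. Qed.

(** This is the Coxeter transformation from dim M to dim N, written through the Euler form. It
    suffices to take z at simple representations, where both Auslander-Reiten formulas apply. *)
Lemma tau_dim N M z : is_tau N M -> euler (dv M) z = - euler z (dv N).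
Proof.
case/is_tauP=> _ _ [zz zAR]; rewrite euler_sumr [in RHS]euler_suml -sumrN.
apply: eq_bigr => i _; rewrite -mulrN; congr (_ * _).
rewrite -dv_simp -!euler_formula (AR_formula1 zAR) (AR_formula2 zAR).
by rewrite opprB.
Qed.

Lemma tau_ed N M : is_tau N M -> ed M M = ed N N.
Proof. by case/is_tauP=> _ _ [z zAR]; rewrite (AR_formula1 zAR) (AR_formula2 zAR). Qed.

Lemma tau_hd N M X W : is_tau N M -> is_tau W X -> hd X M = hd W N.
Proof.
case/is_tauP=> _ _ [z zAR] /is_tauP [_ _ [w wAR]].
by rewrite -(AR_formula2 wAR) (AR_formula1 zAR).
Qed.

Lemma tau_ed_l N M X : is_tau N M -> ed M X = hd X N.
Proof. by case/is_tauP=> _ _ [z zAR]; rewrite (AR_formula1 zAR). Qed.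
Lemma tau_ed_r N M X : is_tau N M -> ed X N = hd M X.
Proof. by case/is_tauP=> _ _ [z zAR]; rewrite (AR_formula2 zAR). Qed.

Lemma injective_rep_ed I : injective_rep I -> forall Y, ed Y I = 0%N.
Proof.
move=> Ii Y; apply/ed0P => z; apply/ext_split/(ses_split_mono (ext_ses z)).
have [r rE] := Ii _ _ (exti z) (idh I) (ses_inj (ext_ses z)).
by exists r => i; rewrite rE; apply/lfunP => x; rewrite [RHS]id_lfunE idhE.
Qed.

Variable d : vertex Q -> int.
Hypothesis ac : acyclic Q.
Hypothesis tf : tame_form d.

Definition theta M := euler d (dv M).

Lemma theta_ses N L M (f : rep_hom N L) (g : rep_hom L M) :
  short_exact f g -> theta L = theta N + theta M.
Proof. by move=> fg; apply: eulerDr => i; apply: ses_dv fg i. Qed.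
Lemma theta_iso M N : rep_iso M N -> theta M = theta N.
Proof. by move=> e; rewrite /theta (iso_dv e). Qed.
Lemma theta_dsum M N : theta (dsum M N) = theta M + theta N.
Proof. exact: theta_ses (dsum_ses M N). Qed.
Lemma theta_zero M : is_zero M -> theta M = 0.
Proof.
move/is_zeroP => M0; apply: euler0r => i; rewrite /dv /dim_vector.
by have := dim_tdim M i; rewrite M0 leqn0 => /eqP ->.
Qed.

Lemma theta_radical M : theta M = - euler (dv M) d.
Proof. by have [_ r _ _ _] := tf; apply: r. Qed.

Lemma tau_theta N M : is_tau N M -> theta N = theta M.
Proof. by move=> t; rewrite [RHS]theta_radical (tau_dim _ t) opprK. Qed.

Lemma nonzero_dv M : ~ is_zero M -> exists i, dv M i != 0.
Proof.
move/nonzeroP=> M0; apply: contrapT => /forallNP n; move: M0; rewrite /tdim big1 // => i _.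
by have /negP := n i; rewrite negbK => /eqP [].
Qed.

(** The negative of the defect pairs dim X with d. For projective X the pairing with each simple is
    the dimension of a Hom space, and it is positive at a source of the support. *)
Lemma projective_theta X : projective X -> ~ is_zero X -> theta X < 0.
Proof.
move=> /projective_ed Xe /nonzero_dv /(source_vertex ac) [i [xi xE]].
have [d0 _ _ _ _] := tf.
rewrite theta_radical oppr_lt0 euler_sumr (bigD1 i) //=.
apply: ltr_wpDr.
  apply: sumr_ge0 => j _; apply: mulr_ge0; first exact: ltW.
  by rewrite -dv_simp -euler_formula Xe subr0.
by rewrite xE mulr_gt0 // lt0r xi dv_pos.
Qed.

Lemma injective_theta X : injective_rep X -> ~ is_zero X -> 0 < theta X.
Proof.
move=> /injective_rep_ed Xe /nonzero_dv /(sink_vertex ac) [i [xi xE]].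
have [d0 _ _ _ _] := tf.
rewrite /theta euler_suml (bigD1 i) //=; apply: ltr_wpDr.
  apply: sumr_ge0 => j _; apply: mulr_ge0; first exact: ltW.
  by rewrite -dv_simp -euler_formula Xe subr0.
by rewrite xE mulr_gt0 // lt0r xi dv_pos.
Qed.

(** Induction along tau: the formulas transport Hom and Ext^1 to the translates, and the defect is
    invariant under tau. *)
Lemma preproj_props M : indec_preprojective M ->
  [/\ indecomposable M, theta M < 0, ed M M = 0%N &
      forall X, indecomposable X -> 0 <= theta X -> hd X M = 0%N /\ ed M X = 0%N].
Proof.
elim=> {}M => [Mi Mp|N t _ [Ni Nt Ne NX]].
  have [M0 _] := Mi; have Me := (projective_ed M).1 Mp.
  split=> //; first exact: projective_theta.
  move=> X Xi Xt; split; last exact: Me.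
  apply/hd0P => f; have [I [K [p [j [i [ip ji fE]]]]]] := im_exists f.
  (* Ext^1 is right exact, so a subobject of a projective is projective; X -> I then splits, and X
     would be projective. *)
  have Ip : projective I.
    apply/projective_ed => Y; have := ed_inj_l Y ji; rewrite Me.
    by rewrite leqn0 => /eqP.
  have sp : split_epi p.
    have [s sE] := Ip _ _ p (idh I) (ses_surj ip).
    by exists s => v; rewrite sE; apply/lfunP => x; rewrite [RHS]id_lfunE idhE.
  have [K0|I0] := indec_ses Xi ip sp; last first.
    by apply: hom_eq0 => v x; rewrite fE comphE (I0 v (p v x)) linear0.
  exfalso; have eX := theta_ses ip; rewrite (theta_zero K0) add0r in eX.
  have I0 : ~ is_zero I.
    by case: Xi => X0 _ I0; apply: X0; apply/is_zeroP; rewrite (ses_tdim ip);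
       move/is_zeroP: K0 => ->; move/is_zeroP: I0 => ->.
  by have := projective_theta Ip I0; rewrite -eX; lra.
have [_ Mi _] := (is_tauP _ _).1 t.
split=> //; rewrite -?(tau_theta t) // ?(tau_ed t) //.
move=> X Xi Xt; split; last by rewrite (tau_ed_l _ t); have [] := NX X Xi Xt.
have [X0 _] := Xi.
(* Projectives have negative defect, so X has a translate, to which the induction hypothesis
   applies. *)
have Xp : ~ projective X by move=> Xp; have := projective_theta Xp X0; lra.
have [W tW] := AR_exists ac Xi Xp; have [Wi _ _] := (is_tauP _ _).1 tW.
by rewrite (tau_hd t tW); have [|] := NX W Wi; rewrite ?(tau_theta tW).
Qed.

Lemma preinj_theta M : indec_preinjective M -> 0 < theta M.
Proof.
elim=> {}M => [[M0 _] Mi|N t _ Nt]; first exact: injective_theta.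
by rewrite (tau_theta t).
Qed.
End ARDimension.

Lemma pigeonhole_nat (T : finType) (f : nat -> T) :
  exists m n, (m < n)%N /\ f m = f n.
Proof.
have [/injectiveP inj|/injectivePn [m [n mn fE]]] :=
    boolP (injectiveb (fun i : 'I_(#|T|.+1) => f i)).
  by have := leq_card _ inj; rewrite card_ord ltnn.
case: (ltngtP m n) => [lt|lt|/val_inj E].
- by exists m, n.
- by exists n, m.
- by rewrite E eqxx in mn.
Qed.

(** * Indecomposables of negative defect are preprojective *)

Section NegativeDefect.
Variables (Q : quiver) (d : vertex Q -> int).
Hypothesis ac : acyclic Q.
Hypothesis tf : tame_form d.

Lemma tame_rad y : euler d y = - euler y d. Proof. by case: tf. Qed.
Lemma tame_dd : euler d d = 0.
Proof. by have := tame_rad d; lra. Qed.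
Lemma tame_null x : euler x x = 0 -> euler d x = 0.
Proof.
have [d0 _ _ null _] := tf => /null xd.
have [E|[i xi]] : (forall i, x i = 0) \/ exists i, x i != 0.
- have [|n] := pselect (exists i, x i != 0); [by right|left=> i].
  by apply/eqP/contraT => xi; case: n; exists i.
- exact: euler0r.
have : euler d (fun j => x j * d i) = 0.
  rewrite (@eulerZr _ (x i) d) ?tame_dd ?mulr0 // => j; exact: xd.
rewrite (@eulerZr _ (d i) x) => [/eqP|j]; last exact: mulrC.
by rewrite mulf_eq0 (gt_eqF (d0 i)) => /eqP.
Qed.

(** The form bounds the differences x_i d_j - x_j d_i. Once the coordinate at i0 is reduced modulo
    d, this bounds all coordinates, so only finitely many vectors remain. *)
Lemma bounded_mod_d (c : int) : exists B : nat, forall x : vertex Q -> int, euler x x <= c ->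
  forall i0, 0 <= x i0 < d i0 -> forall i, `|x i| <= B%:Z.
Proof.
have [d0 _ _ _ /(_ c) [b bP]] := tf.
exists (`|b|%N + `|(\sum_i \sum_j d i * d j)%R|%N)%N => x xc i0 /andP [x0 xd] i.
have H : `|x i * d i0| <= b + d i0 * d i.
  have -> : x i * d i0 = (x i * d i0 - x i0 * d i) + x i0 * d i by rewrite subrK.
  apply: le_trans (ler_normD _ _) _; apply: lerD; first exact: bP.
  have di : 0 <= d i by apply: ltW.
  by rewrite ger0_norm ?mulr_ge0 //; apply: ler_wpM2r => //; apply: ltW.
have S : d i0 * d i <= \sum_i \sum_j d i * d j.
  rewrite (bigD1 i0) //= (bigD1 i) //= -addrA lerDl addr_ge0 //.
    by apply: sumr_ge0 => j _; apply: mulr_ge0; apply: ltW.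
  by apply: sumr_ge0 => j _; apply: sumr_ge0 => l _; apply: mulr_ge0; apply: ltW.
have X : `|x i| <= `|x i * d i0|.
  by rewrite normrM ler_peMr // gtr0_norm //; have := d0 i0; lia.
by move: H S X; lia.
Qed.

(** Modulo d the orbit is finite, hence some later term differs from an earlier one by t d. Negative
    defect forces t < 0, so that the orbit drifts to negative coordinates. *)
Lemma no_negative_orbit (x : nat -> vertex Q -> int) :
  (forall n i, 0 <= x n i) ->
  (forall n z, euler (x n) z = - euler z (x n.+1)) -> 0 <= euler d (x 0%N).
Proof.
move=> x0 xt; rewrite leNgt; apply/negP => neg.
have [d0 _ psd _ _] := tf.
have thE n : euler d (x n) = euler d (x 0%N).
  by elim: n => // n <-; rewrite [RHS]tame_rad xt opprK.
have qE n : euler (x n) (x n) = euler (x 0%N) (x 0%N).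
  by elim: n => // n <-; have := xt n (x n.+1); have := xt n (x n); lra.
have [i0 _] : exists i0 : vertex Q, True.
  apply: contrapT => /forallNP n; move: neg; rewrite euler0r ?ltxx // => i.
  by case: (n i).
have [B BP] := bounded_mod_d (euler (x 0%N) (x 0%N)).
(* Subtract the multiple of d that brings the coordinate at i0 into [0, d i0); the quadratic form
   does not see it. *)
pose m n := (x n i0 %/ d i0)%Z.
pose r n i := x n i - m n * d i.
have r0 n : 0 <= r n i0 < d i0.
  have -> : r n i0 = (x n i0 %% d i0)%Z by [].
  by rewrite modz_ge0 ?gt_eqF // ltz_pmod.
have rB n i : `|r n i| <= B%:Z.
  apply: (BP _ _ i0) => //.
  rewrite (@eulerBl _ (x n) (fun i => m n * d i) (r n)) //.
  rewrite !(@eulerBr _ (x n) (fun i => m n * d i) (r n)) // qE.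
  rewrite !(@eulerZl _ (m n) d (fun i => m n * d i)) //.
  rewrite !(@eulerZr _ (m n) d (fun i => m n * d i)) // tame_dd.
  by rewrite (tame_rad (x n)) le_eqVlt; apply/orP; left; apply/eqP; ring.
(* Coordinates in [-B, B] are shifted to [0, 2B] for the pigeonhole principle. *)
pose code n : {ffun vertex Q -> 'I_((2 * B).+1)} := [ffun i => inord `|(r n i + B%:Z)%R|%N].
have [m1 [n1 [lt cE]]] := pigeonhole_nat code.
have rE i : r m1 i = r n1 i.
  have := congr1 (fun f : {ffun _ -> _} => val (f i)) cE; rewrite !ffunE /= !inordK.
  - by have := rB m1 i; have := rB n1 i; lia.
  - by have := rB n1 i; lia.
  - by have := rB m1 i; lia.
pose t := m n1 - m m1.
have xE i : x n1 i = x m1 i + t * d i.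
  by have := rE i; rewrite /r /t mulrBl; lra.
(* The Euler form determines each term of the orbit from the previous one, and d is carried to
   itself because it is radical. *)
have xEl l i : x (n1 + l)%N i = x (m1 + l)%N i + t * d i.
  elim: l i => [|l IH] i; first by rewrite !addn0 xE.
  apply/eqP; rewrite -subr_eq0; apply/eqP.
  apply: (euler_nondeg_r ac (u := fun i => x (n1 + l.+1)%N i - (x (m1 + l.+1)%N i + t * d i))) => z.
  rewrite (@eulerBr _ (x (n1 + l.+1)%N) (fun i => x (m1 + l.+1)%N i + t * d i)) //.
  rewrite (@eulerDr _ (x (m1 + l.+1)%N) (fun i => t * d i) (fun i => x (m1 + l.+1)%N i + t * d i)) //.
  rewrite (@eulerZr _ t d (fun i => t * d i)) // !addnS.
  have := xt (n1 + l)%N z; have := xt (m1 + l)%N z.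
  rewrite (@eulerDl _ (x (m1 + l)%N) (fun i => t * d i) (x (n1 + l)%N)) //.
  rewrite (@eulerZl _ t d (fun i => t * d i)) // tame_rad mulrN.
  by move: (euler z (x (m1 + l).+1)) (euler z (x (n1 + l).+1)) (t * euler z d) (euler (x (m1 + l)%N) z) => e1 e2 e3 e4; lia.
pose y i := \sum_(m1 <= j < n1) x j i.
have ySl z n : euler (fun i => \sum_(m1 <= j < m1 + n) x j i) z =
    \sum_(m1 <= j < m1 + n) euler (x j) z.
  elim: n => [|n IH]; first by rewrite addn0 big_geq // euler0l // => i; rewrite big_geq.
  rewrite addnS big_nat_recr ?leq_addr //= -IH; apply: eulerDl => i.
  by rewrite big_nat_recr ?leq_addr.
have ySr z n : euler z (fun i => \sum_(m1 <= j < m1 + n) x j i) =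
    \sum_(m1 <= j < m1 + n) euler z (x j).
  elim: n => [|n IH]; first by rewrite addn0 big_geq // euler0r // => i; rewrite big_geq.
  rewrite addnS big_nat_recr ?leq_addr //= -IH; apply: eulerDr => i.
  by rewrite big_nat_recr ?leq_addr.
have n1E : (m1 + (n1 - m1) = n1)%N by rewrite subnKC // ltnW.
have yl z : euler y z = \sum_(m1 <= j < n1) euler (x j) z.
  by have := ySl z (n1 - m1)%N; rewrite n1E.
have yr z : euler z y = \sum_(m1 <= j < n1) euler z (x j).
  by have := ySr z (n1 - m1)%N; rewrite n1E.
(* The sum y over one period telescopes: its symmetrized form is t times the defect. *)
have sym z : euler y z + euler z y = t * euler d z.
  rewrite yl yr -big_split /= (eq_bigr (fun j => - (euler z (x j.+1) - euler z (x j)))).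
    rewrite sumrN telescope_sumr ?(ltnW lt) //.
    rewrite (@eulerDr _ (x m1) (fun i => t * d i) (x n1)) //.
    by rewrite (@eulerZr _ t d (fun i => t * d i)) // tame_rad; lra.
  by move=> j _; rewrite xt; lra.
have yth : euler d y = (n1 - m1)%N%:Z * euler d (x 0%N).
  rewrite yr (eq_bigr (fun=> euler d (x 0%N))) // sumr_const_nat.
  by rewrite -mulr_natl natz.
have ylt : euler d y < 0.
  by rewrite yth pmulr_rlt0 // ltz_nat subn_gt0.
(* At z = y the symmetrized form is 2 q(y). It is positive, since a null vector has defect 0, while
   the defect of y is negative. *)
have tneg : t < 0.
  have := sym y; have := psd y => q0 E.
  have q1 : euler y y != 0.
    by apply: contraTneq ylt => /tame_null ->; rewrite ltxx.
  have q2 : 0 < euler y y by rewrite lt0r q1.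
  have : 0 < t * euler d y by rewrite -E; lra.
  by rewrite nmulr_lgt0.
(* Each period lowers the coordinate at i0 by at least 1, so it is negative after more periods than
   its initial value. *)
have jump j : x (m1 + j * (n1 - m1))%N i0 = x m1 i0 + j%:Z * (t * d i0).
  elim: j => [|j IH]; first by rewrite mul0n addn0 mul0r addr0.
  by rewrite mulSn addnA n1E xEl IH intS [(1 + _) * _]mulrDl mul1r [t * _ + _]addrC addrA.
have := jump (`|x m1 i0|%N.+1); have := x0 (m1 + `|x m1 i0|.+1 * (n1 - m1))%N i0.
have : t * d i0 <= -1 by have := d0 i0; nia.
by have := x0 m1 i0; move: (t * d i0); nia.
Qed.

Variable k : finFieldType.

(** A counterexample is not projective and its translate is again a counterexample, so the dimension
    vectors of its tau-orbit contradict [no_negative_orbit]. *)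
Lemma preproj_of_neg (M : rep k Q) : indecomposable M -> theta d M < 0 ->
  indec_preprojective M.
Proof.
move=> Mi Mt; apply: contrapT => Mn.
pose bad (M : rep k Q) := [/\ indecomposable M, theta d M < 0 & ~ indec_preprojective M].
have [f fP] : exists f : rep k Q -> rep k Q, forall M, bad M -> is_tau (f M) M /\ bad (f M).
  suff /boolp.choice [f fP] : forall M, exists N, bad M -> is_tau N M /\ bad N by exists f.
  move=> N; have [[Ni Nt Nn]|] := pselect (bad N); last by exists N.
  have Np : ~ projective N by move=> Np; apply: Nn; apply: preprojective_proj.
  have [W tW] := AR_exists ac Ni Np; exists W => _; split=> //.
  have [Wi _ _] := (is_tauP _ _).1 tW; split=> //; first by rewrite (tau_theta tf tW).
  by move=> Wp; apply: Nn; apply: preprojective_tau tW Wp.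
have bn n : bad (iter n f M) by elim: n => [|n /fP []].
have := @no_negative_orbit (fun n => dv (iter n f M)) (fun n i => dv_pos _ _).
rewrite /= leNgt Mt => H; suff : false by [].
by apply: H => n z; have [t _] := fP _ (bn n); apply: tau_dim.
Qed.
End NegativeDefect.

(** * Indecomposables of positive defect *)

Section DualTame.
Variables (k : finFieldType) (V A : finType).

Lemma acyclic_dual (s t : A -> V) : acyclic (Quiver s t) -> acyclic (Quiver t s).
Proof.
move=> ac a; have := ac a.
set e := [rel i j | _]; set e' := [rel i j | _].
have -> : connect e' (@tgt (Quiver t s) a) (@src (Quiver t s) a) = connect e (t a) (s a) => //.
have := connect_rev e => /(_ (s a) (t a)) /= <-; apply: eq_connect => i j /=.
by apply/existsP/existsP => -[b /andP [b1 b2]]; exists b; rewrite b1 b2.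
Qed.

Lemma tame_form_dual (s t : A -> V) (d : V -> int) :
  @tame_form (Quiver s t) d -> @tame_form (Quiver t s) d.
Proof.
case=> d0 r psd n b; split=> //.
- by move=> y; rewrite !(@euler_dual _ _ s t) r opprK.
- by move=> x; rewrite euler_dual.
- by move=> x; rewrite euler_dual => /n.
- by move=> c; have [c' cP] := b c; exists c' => x; rewrite euler_dual => /cP.
Qed.

Lemma preproj_dual (s t : A -> V) (X : rep k (Quiver t s)) :
  indec_preprojective X -> indec_preinjective (dual X).
Proof.
elim=> {}X => [Xi Xp|N tN _ IH]; last exact: preinjective_tau (dual_tau tN) IH.
apply: preinjective_inj; first exact: dual_indec.
by apply: dual_projective; rewrite dualK.
Qed.
End DualTame.

Section Trichotomy.
Variables (k : finFieldType) (Q : quiver) (d : vertex Q -> int).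
Hypothesis ac : acyclic Q.
Hypothesis tf : tame_form d.
Implicit Types M N X Y : rep k Q.
Notation theta := (@theta k Q d).

Lemma neg_props M : indecomposable M -> theta M < 0 -> ed M M = 0%N /\
  forall X, indecomposable X -> 0 <= theta X -> hd X M = 0%N /\ ed M X = 0%N.
Proof. by move=> Mi Mt; have [] := preproj_props ac tf (preproj_of_neg ac tf Mi Mt). Qed.
End Trichotomy.

(** Duality turns M into a representation of negative defect over the opposite quiver. *)
Lemma pos_props (k : finFieldType) (Q : quiver) (d : vertex Q -> int) (M : rep k Q) :
  acyclic Q -> tame_form d ->
  indecomposable M -> 0 < theta d M -> indec_preinjective M /\
  forall X, indecomposable X -> theta d X <= 0 -> hd M X = 0%N /\ ed X M = 0%N.
Proof.
case: Q d M => V A s t d M ac tf Mi Mt.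
have ac' := acyclic_dual ac; have tf' := tame_form_dual tf.
have thD (X : rep k (Quiver s t)) : @theta k (Quiver t s) d (dual X) = - theta d X.
  by rewrite [in RHS](theta_radical tf) opprK /theta euler_dual.
have Mt' : @theta k (Quiver t s) d (dual M) < 0 by rewrite thD oppr_lt0.
have Mi' := dual_indec Mi; split.
  by have := preproj_dual (preproj_of_neg ac' tf' Mi' Mt'); rewrite dualK.
move=> X Xi Xt; have [_ /(_ _ (dual_indec Xi))] := neg_props ac' tf' Mi' Mt'.
by rewrite thD oppr_ge0 dual_hd dual_ed => /(_ Xt).
Qed.

Lemma AR_exists_start (k : finFieldType) (Q : quiver) (N : rep k Q) : acyclic Q ->
  indecomposable N -> ~ injective_rep N -> exists M, is_tau N M.
Proof.
case: Q N => V A s t N ac Ni Nn.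
have Np : ~ projective (dual N) by move/dual_projective.
have [W tW] := AR_exists (acyclic_dual ac) (dual_indec Ni) Np.
by exists (dual W); have := dual_tau tW; rewrite dualK.
Qed.

(** * The category of regular representations *)

Section Regular.
Variables (k : finFieldType) (Q : quiver) (d : vertex Q -> int).
Hypothesis ac : acyclic Q.
Hypothesis tf : tame_form d.
Implicit Types M N X Y A B C E K S : rep k Q.
Notation theta := (@theta k Q d).

Lemma indec_regularP M : indec_regular M <-> indecomposable M /\ theta M = 0.
Proof.
split=> [[Mi np ni]|[Mi Mt]].
  split=> //; case: (ltrgtP (theta M) 0) => // Mt.
    by case: np; apply: (preproj_of_neg ac tf Mi Mt).
  by case: ni; have [] := pos_props ac tf Mi Mt.
split=> // [/(preproj_props ac tf) [_]|/(preinj_theta ac tf)];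
  by rewrite /= Mt ltxx.
Qed.

(* [neg], [reg] and [stab] are the preprojective, regular and quasi-simple
   regular representations, described by the defects of their subobjects. *)
Definition neg M := forall Y (f : rep_hom Y M), injective_hom f -> ~ is_zero Y -> theta Y < 0.

Definition reg M := theta M = 0 /\ forall Y (f : rep_hom Y M), injective_hom f -> theta Y <= 0.

Lemma inj_hd_gt0 A M (f : rep_hom A M) : injective_hom f -> ~ is_zero A -> (0 < hd A M)%N.
Proof.
move=> fi A0; apply: (hd_gt0 (f := f)) => f0; apply: A0 => i x; apply: (fi i).
by rewrite f0 !zerohE.
Qed.

Lemma summand_maps M A B : rep_iso M (dsum A B) ->
  exists (i : rep_hom A M) (j : rep_hom B M), injective_hom i /\ injective_hom j.
Proof.
case/rep_iso_sym/rep_isoP=> f [fi _].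
by exists (comph f (inlh A B)), (comph f (inrh A B)); split; apply: inj_comp fi;
   [apply: inlh_inj|apply: inrh_inj].
Qed.

Lemma indec_induction (P : rep k Q -> Prop) :
  (forall M, is_zero M -> P M) ->
  (forall M A B, rep_iso M (dsum A B) -> indecomposable A -> P B -> P M) ->
  forall M, P M.
Proof.
move=> P0 PS M; have [n] := ubnP (tdim M); elim: n M => // n IH M /ltnSE le.
have [M0|M0] := pselect (is_zero M); first exact: P0.
have [A [B [Ai e]]] := indec_summand M0; apply: (PS M A B) => //; apply: IH.
case: Ai => /nonzeroP A0 _; have := iso_tdim e; rewrite tdim_dsum; lia.
Qed.

(** An indecomposable summand of a subobject maps nontrivially to M, which [neg_props] excludes
    unless its defect is negative. *)
Lemma neg_indec M : indecomposable M -> theta M < 0 -> neg M.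
Proof.
move=> Mi Mt; apply: indec_induction => [Y Y0 f _ /(_ Y0) //|Y A B e Ai IH f fi Y0].
have [i [j [ii ji]]] := summand_maps e; have [A0 _] := Ai.
have fi' := inj_comp ii fi; have fj' := inj_comp ji fi.
have At : theta A < 0.
  rewrite ltNge; apply/negP => At; have := inj_hd_gt0 fi' A0.
  by have [_ /(_ A Ai At) [-> _]] := neg_props ac tf Mi Mt.
rewrite (theta_iso d e) theta_dsum; have [B0|B0] := pselect (is_zero B).
  by rewrite (theta_zero d B0) addr0.
by have := IH _ fj' B0; lra.
Qed.

Lemma reg_indec M : indecomposable M -> theta M = 0 -> reg M.
Proof.
move=> Mi Mt; split=> //; apply: indec_induction => [Y Y0 f _|Y A B e Ai IH f fi].
  by rewrite (theta_zero d Y0).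
have [i [j [ii ji]]] := summand_maps e; have [A0 _] := Ai.
have fi' := inj_comp ii fi; have fj' := inj_comp ji fi.
have At : theta A <= 0.
  rewrite leNgt; apply/negP => At; have := inj_hd_gt0 fi' A0.
  by have [_ /(_ M Mi)] := pos_props ac tf Ai At; rewrite Mt => /(_ (lexx _)) [->].
by rewrite (theta_iso d e) theta_dsum; have := IH _ fj'; lra.
Qed.

Lemma reg_sub M Y (f : rep_hom Y M) : reg M -> injective_hom f -> theta Y = 0 -> reg Y.
Proof. by move=> [_ Ms] fi Yt; split=> // X g gi; apply: Ms (inj_comp gi fi). Qed.

Lemma reg_iso M N : rep_iso M N -> reg M -> reg N.
Proof.
move=> e Mr; have [f [fi _]] := (rep_isoP _ _).1 (rep_iso_sym e).
by apply: (reg_sub Mr fi); case: Mr => <- _; rewrite (theta_iso d e).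
Qed.

Lemma reg_zero M : is_zero M -> reg M.
Proof.
move=> M0; split=> [|Y f fi]; first exact: theta_zero.
by rewrite theta_zero // => i x; apply: (fi i); rewrite (M0 i (f i x)) (M0 i (f i 0)).
Qed.

Lemma reg_dsum M A B : reg M -> rep_iso M (dsum A B) -> reg A /\ reg B.
Proof.
move=> Mr e; have [i [j [ii ji]]] := summand_maps e; have [Mt Ms] := Mr.
have := Ms _ _ ii; have := Ms _ _ ji; have := theta_iso d e; rewrite theta_dsum Mt => *.
by split; [apply: (reg_sub Mr ii)|apply: (reg_sub Mr ji)]; lra.
Qed.

Lemma reg_induction (P : rep k Q -> Prop) :
  (forall M, is_zero M -> P M) ->
  (forall M A B, rep_iso M (dsum A B) -> indecomposable A -> theta A = 0 ->
      reg A -> reg B -> P B -> P M) ->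
  forall M, reg M -> P M.
Proof.
move=> P0 PS; apply: (@indec_induction (fun M => reg M -> P M)) => [M M0 _|M A B e Ai IH Mr]; first exact: P0.
have [Ar Br] := reg_dsum Mr e; apply: (PS M A B) => //; first by case: Ar.
exact: IH.
Qed.

Lemma ed_neg_reg M X : indecomposable M -> theta M < 0 -> reg X -> ed M X = 0%N.
Proof.
move=> Mi Mt; move: X; apply: (@reg_induction (fun X => ed M X = 0%N)) => [X X0|X A B e Ai At _ _ IH].
  apply/ed0P => z; suff -> : z = 0 by rewrite mem0v.
  by apply: C1P => a x; rewrite CE; apply: X0.
rewrite (ed_iso_r _ e); apply/eqP; rewrite -leqn0.
apply: leq_trans (ses_ed_r (dsum_ses A B) M) _; rewrite IH addn0.
by have [_ /(_ A Ai)] := neg_props ac tf Mi Mt; rewrite At => /(_ (lexx _)) [_ ->].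
Qed.

(** The pullback is taken as the kernel of M -> C -> C / Y. *)
Lemma preimage K M C Y (f : rep_hom K M) (g : rep_hom M C) (y : rep_hom Y C) :
  short_exact f g -> injective_hom y ->
  exists Z (z : rep_hom Z M) (f' : rep_hom K Z) (g' : rep_hom Z Y),
    [/\ short_exact f' g', injective_hom z, comph z f' = f & comph y g' = comph g z].
Proof.
move=> fg yi; have [C' [q [qs qk]]] := coker_exists y.
have [Z [z [zi zk]]] := ker_exists (comph q g).
have [|f' f'E] := factor_mono (f := f) zi.
  by move=> i x; rewrite zk memv_ker comphE (ses_comp fg) linear0.
have [|g' g'E] := factor_mono (f := comph g z) yi.
  move=> i x; rewrite -qk memv_ker comphE -(comphE q g) -memv_ker -zk.
  by rewrite memv_img ?memvf.
exists Z, z, f', g'; split=> //; split.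
- move=> i x x' E; apply: (ses_inj fg (i := i)); rewrite -f'E !comphE E //.
- move=> i; apply/limg_surj=> w; have [v vE] := ses_lift fg (y i w).
  have : v \in limg (z i).
    rewrite zk memv_ker comphE vE -memv_ker qk memv_img ?memvf //.
  case/memv_imgP=> u _ uE; exists u; apply: (yi i).
  by rewrite -comphE g'E comphE -uE vE.
move=> i; apply/vspaceP=> x; rewrite memv_ker; apply/memv_imgP/eqP => [[w _ ->]|g0].
  by apply: (yi i); rewrite -comphE g'E linear0 comphE -(comphE z f') f'E (ses_comp fg).
have [|w wE] := ses_ker fg (x := z i x) (i := i).
  by rewrite -comphE -g'E comphE g0 linear0.
by exists w; rewrite ?memvf //; apply: (zi i); rewrite -comphE f'E.
Qed.

Lemma reg_quot K M C (f : rep_hom K M) (g : rep_hom M C) :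
  reg M -> short_exact f g -> theta C = 0 -> reg C.
Proof.
move=> [Mt Ms] fg Ct; split=> // Y y yi.
have [Z [z [f' [g' [ez zi _ _]]]]] := preimage fg yi.
have := theta_ses d fg; have := theta_ses d ez; have := Ms _ _ zi; lra.
Qed.

Lemma reg_ext K M C (f : rep_hom K M) (g : rep_hom M C) :
  short_exact f g -> reg K -> reg C -> reg M.
Proof.
move=> fg [Kt Ks] [Ct Cs]; split; first by rewrite (theta_ses d fg) Kt Ct addr0.
move=> Y y yi; have [I [L [p [j [i [ip ji E]]]]]] := im_exists (comph g y).
have [|v vE] := ses_factor_l fg (u := comph y i).
  by rewrite comphA E; apply: hom_ext => w x; rewrite !comphE (ses_comp ip) linear0 zerohE.
have vi : injective_hom v.
  move=> w; apply: lker_inj => x vx; apply: (inj_eq0 (ses_inj ip (i := w))).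
  by apply: (inj_eq0 (yi w)); rewrite -comphE vE comphE vx linear0.
by rewrite (theta_ses d ip); have := Ks _ _ vi; have := Cs _ _ ji; lra.
Qed.

(** Kernel and image are subobjects of regular representations, so both defects are at most 0; their
    sum is 0. *)
Lemma reg_im M N I K (f : rep_hom M N) (p : rep_hom M I) (j : rep_hom I N) (i : rep_hom K M) :
  reg M -> reg N -> short_exact i p -> injective_hom j -> reg I /\ reg K.
Proof.
move=> Mr Nr ip ji; have [Mt Ms] := Mr; have [Nt Ns] := Nr.
have := theta_ses d ip; have := Ms _ _ (ses_inj ip); have := Ns _ _ ji => *.
by split; [apply: (reg_sub Nr ji)|apply: (reg_sub Mr (ses_inj ip))]; lra.
Qed.

Lemma reg_ker M N K (f : rep_hom M N) (i : rep_hom K M) : reg M -> reg N ->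
  injective_hom i -> (forall v, limg (i v) = lker (f v)) -> reg K.
Proof.
move=> Mr Nr ii iE; have [I [K' [p [j [i' [ip ji E]]]]]] := im_exists f.
have [_ Kr] := reg_im f Mr Nr ip ji; apply: (@reg_iso K') Kr.
have [|g gE] := factor_mono (f := i') ii.
  by move=> v x; rewrite iE memv_ker E comphE (ses_comp ip) linear0.
apply/rep_isoP; exists g; split.
  by move=> v x y E'; apply: (ses_inj ip (i := v)); rewrite -gE !comphE E'.
move=> v; apply/limg_surj => x.
have [|y yE] := ses_ker ip (x := i v x) (i := v).
  have -> : p v (i v x) = 0 by apply: (inj_eq0 (ji v)); rewrite -(comphE j p) -E; apply/eqP; rewrite -memv_ker -iE memv_img ?memvf.
  by [].
by exists y; apply: (ii v); rewrite -comphE gE.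
Qed.

Definition stab E := [/\ reg E, ~ is_zero E &
  forall Y (f : rep_hom Y E), injective_hom f -> theta Y = 0 -> is_zero Y \/ surjective_hom f].

Lemma stab_surj M E (f : rep_hom M E) : reg M -> stab E -> f <> zeroh M E ->
  surjective_hom f.
Proof.
move=> Mr [Er E0 Es] f0; have [I [K [p [j [i [ip ji fE]]]]]] := im_exists f.
have [[It _] _] := reg_im f Mr Er ip ji.
have [I0|js] := Es _ _ ji It; last by rewrite fE; apply: surj_comp js; apply: ses_surj ip.
by case: f0; apply: hom_eq0 => v x; rewrite fE comphE (I0 v (p v x)) linear0.
Qed.

Lemma stab_inj M E (f : rep_hom E M) : reg M -> stab E -> f <> zeroh E M ->
  injective_hom f.
Proof.
move=> Mr [Er E0 Es] f0; have [I [K [p [j [i [ip ji fE]]]]]] := im_exists f.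
have [_ [Kt _]] := reg_im f Er Mr ip ji.
have [K0|isu] := Es _ _ (ses_inj ip) Kt.
  move=> v; apply: lker_inj => x; rewrite fE comphE => /(inj_eq0 (ji v)).
  by case/(ses_ker ip) => y ->; rewrite (K0 v y) linear0.
case: f0; apply: hom_eq0 => v x; have [y <-] := (limg_surj (i v)).1 (isu v) x.
by rewrite fE comphE (ses_comp ip) linear0.
Qed.

Lemma stab_bij E S (f : rep_hom E S) : stab E -> stab S -> f <> zeroh E S ->
  injective_hom f /\ surjective_hom f.
Proof.
move=> Es Ss f0; have [Er _ _] := Es; have [Sr _ _] := Ss.
by split; [apply: stab_inj|apply: stab_surj].
Qed.

Lemma stab_iso E S : rep_iso E S -> stab E -> stab S.
Proof.
move=> e [Er E0 Es]; split; first exact: reg_iso e Er.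
  by move=> S0; apply: E0; apply: iso_zero (rep_iso_sym e) S0.
have [g [gi gs]] := (rep_isoP _ _).1 (rep_iso_sym e).
move=> Y f fi Yt; have [|fs] := Es _ _ (inj_comp fi gi) Yt; [by left|right].
move=> v; apply/limg_surj => y; have [x xE] := (limg_surj _).1 (fs v) (g v y).
by exists x; apply: (gi v); rewrite -xE comphE.
Qed.

Lemma stab_indec E : stab E -> indecomposable E.
Proof.
move=> [Er E0 Es]; split=> // A B e; have [i [j [ii ji]]] := summand_maps e.
have [[At _] _] := reg_dsum Er e; have [|isu] := Es _ _ ii At; [by left|right].
have := surj_tdim isu; have := iso_tdim e; rewrite tdim_dsum => tE le.
by apply/is_zeroP; lia.
Qed.

Lemma stab_sub M : reg M -> ~ is_zero M ->
  exists S (s : rep_hom S M), stab S /\ injective_hom s.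
Proof.
move=> Mr M0.
have [|[S s] /= [[si S0 St] Sm]] := @minimize_nat {S : rep k Q & rep_hom S M}
  (fun z => [/\ injective_hom (tagged z), ~ is_zero (tag z) & theta (tag z) = 0])
  (fun z => tdim (tag z)).
  by exists (existT (fun S => rep_hom S M) M (idh M)); split=> //= [i x y|]; [rewrite !idhE|case: Mr].
exists S, s; split=> //; split=> //; first exact: reg_sub Mr si St.
move=> Y f fi Yt; have [|Y0] := pselect (is_zero Y); [by left|right].
by apply: inj_tdim_surj => //; apply: (Sm (existT (fun S => rep_hom S M) Y (comph s f))); split=> //=; apply: inj_comp.
Qed.

Lemma stab_quot M : reg M -> ~ is_zero M ->
  exists S (s : rep_hom M S), stab S /\ surjective_hom s.
Proof.
move=> Mr M0.
have [|[S s] /= [[ss S0 St] Sm]] := @minimize_nat {S : rep k Q & rep_hom M S}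
  (fun z => [/\ surjective_hom (tagged z), ~ is_zero (tag z) & theta (tag z) = 0])
  (fun z => tdim (tag z)).
  exists (existT (fun S => rep_hom M S) M (idh M)); split=> //= [i|]; last by case: Mr.
  by apply/limg_surj=> x; exists x; rewrite idhE.
have [K [j js]] := epi_ses ss; have Sr := reg_quot Mr js St.
exists S, s; split=> //; split=> // Y f fi Yt.
have [C [g fg]] := mono_ses fi; have [C0|C0] := pselect (is_zero C).
  right; apply: inj_tdim_surj => //; rewrite (ses_tdim fg).
  by move/is_zeroP: C0 => ->; rewrite addn0.
left; apply/is_zeroP; have /= := Sm (existT (fun S => rep_hom M S) C (comph g s)).
rewrite (ses_tdim fg) => H; suff : (tdim Y + tdim C <= tdim C)%N by lia.
apply: H; split=> //; first exact: surj_comp ss (ses_surj fg).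
by have := theta_ses d fg; rewrite St Yt; lra.
Qed.
End Regular.

Section HdStrict.
Variables (k : finFieldType) (Q : quiver).
Implicit Types M N X A B : rep k Q.

(** Composition with g embeds Hom(N, X) in Hom(M, X); comparing dimensions decides whether the
    embedding is onto. *)
Lemma hd_surj_factor X M N (g : rep_hom M N) : surjective_hom g ->
  (hd M X <= hd N X)%N <-> forall f : rep_hom M X, exists f', f = comph f' g.
Proof.
move=> gs; pose p := linfun (@pre0 _ _ X M N g).
have pE u : p u = pre0 g u by rewrite (linfunE (@pre0_linear _ _ _ _ _ g)).
have sub : (p @: Z0 N X <= Z0 M X)%VS.
  by apply/subvP=> _ /memv_imgP [_ /Z0_hom [h ->] ->]; rewrite pE pre0_hom hom_Z0.
have dimE : \dim (p @: Z0 N X)%VS = hd N X.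
  apply: limg_dim_eq; apply/eqP; rewrite -subv0; apply/subvP=> u /memv_capP [uZ].
  rewrite memv_ker pE memv0 => /eqP u0; apply/eqP/C0P => i y; rewrite CE.
  by have [x <-] := (limg_surj (g i)).1 (gs i) y; rewrite -pre0E u0 CE.
split=> [le f|fac].
  have /eqP E : (p @: Z0 N X)%VS == Z0 M X by rewrite eqEdim sub dimE.
  have := hom_Z0 f; rewrite -E => /memv_imgP [_ /Z0_hom [f' ->]].
  rewrite pE pre0_hom => fE; exists f'; apply: hom_ext => i x.
  by rewrite -[LHS]/((hfun f : C0 M X) i x) fE.
rewrite -dimE; apply/dimvS/subvP=> _ /Z0_hom [f ->]; have [f' ->] := fac f.
by rewrite -pre0_hom -pE memv_img ?hom_Z0.
Qed.

Lemma hd_inj_factor X A B (j : rep_hom A B) : injective_hom j ->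
  (hd X B <= hd X A)%N <-> forall f : rep_hom X B, exists f', f = comph j f'.
Proof.
move=> ji; pose p := linfun (@post0 _ _ X A B j).
have pE u : p u = post0 j u by rewrite (linfunE (@post0_linear _ _ _ _ _ j)).
have sub : (p @: Z0 X A <= Z0 X B)%VS.
  by apply/subvP=> _ /memv_imgP [_ /Z0_hom [h ->] ->]; rewrite pE post0_hom hom_Z0.
have dimE : \dim (p @: Z0 X A)%VS = hd X A.
  apply: limg_dim_eq; apply/eqP; rewrite -subv0; apply/subvP=> u /memv_capP [uZ].
  rewrite memv_ker pE memv0 => /eqP u0; apply/eqP/C0P => i y; rewrite CE.
  by apply: (inj_eq0 (ji i)); rewrite -post0E u0 CE.
split=> [le f|fac].
  have /eqP E : (p @: Z0 X A)%VS == Z0 X B by rewrite eqEdim sub dimE.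
  have := hom_Z0 f; rewrite -E => /memv_imgP [_ /Z0_hom [f' ->]].
  rewrite pE post0_hom => fE; exists f'; apply: hom_ext => i x.
  by rewrite -[LHS]/((hfun f : C0 X B) i x) fE.
rewrite -dimE; apply/dimvS/subvP=> _ /Z0_hom [f ->]; have [f' ->] := fac f.
by rewrite -post0_hom -pE memv_img ?hom_Z0.
Qed.

Lemma surj_ker_dim M N (g : rep_hom M N) v : surjective_hom g ->
  (\dim (lker (g v)) + \dim {: N v} = \dim {: M v})%N.
Proof. by move=> gs; rewrite -(limg_ker_dim (g v) fullv) capfv gs. Qed.

Lemma inj_img_dim M N (g : rep_hom M N) v : injective_hom g ->
  \dim (limg (g v)) = \dim {: M v}.
Proof. by move=> gi; rewrite limg_dim_eq // capfv inj_lker0. Qed.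

Lemma ker_comp_inj M N L (h : rep_hom N L) (g : rep_hom M N) v : injective_hom h ->
  lker (comph h g v) = lker (g v).
Proof.
move=> hi; apply/vspaceP=> x; rewrite !memv_ker comphE.
by apply/eqP/eqP => [/(inj_eq0 (hi v))|->]; rewrite ?linear0.
Qed.

Lemma img_comp_surj M N L (h : rep_hom N L) (g : rep_hom M N) v : surjective_hom g ->
  limg (comph h g v) = limg (h v).
Proof.
move=> gs; apply/vspaceP=> x; apply/memv_imgP/memv_imgP => [[y _ ->]|[y _ ->]].
  by exists (g v y); rewrite ?memvf // comphE.
by have [z <-] := (limg_surj (g v)).1 (gs v) y; exists z; rewrite ?memvf ?comphE.
Qed.

Lemma surj_factor_surj M N L (h : rep_hom N L) (g : rep_hom M N) :
  surjective_hom (comph h g) -> surjective_hom h.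
Proof.
move=> hs v; apply/limg_surj=> y; have [x <-] := (limg_surj _).1 (hs v) y.
by exists (g v x); rewrite comphE.
Qed.

Lemma inj_factor_inj M N L (h : rep_hom N L) (g : rep_hom M N) :
  injective_hom (comph h g) -> injective_hom g.
Proof. by move=> hi v x y E; apply: (hi v); rewrite !comphE E. Qed.

Lemma surj_nonzero M N (g : rep_hom M N) : surjective_hom g -> ~ is_zero N -> g <> zeroh M N.
Proof.
move=> gs N0 g0; apply: N0 => v y; have [x <-] := (limg_surj _).1 (gs v) y.
by rewrite g0 zerohE.
Qed.
Lemma inj_nonzero M N (g : rep_hom M N) : injective_hom g -> ~ is_zero M -> g <> zeroh M N.
Proof. by move=> gi M0 g0; apply: M0 => v y; apply: (gi v); rewrite g0 !zerohE. Qed.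

Lemma ker_eq_factor M N L (g : rep_hom M N) (h : rep_hom M L) : surjective_hom g ->
  (forall v, lker (h v) = lker (g v)) -> exists f, h = comph f g.
Proof.
move=> gs E; have [|f <-] := factor_epi (f := h) gs; last by exists f.
by move=> v x /eqP; rewrite -memv_ker -E memv_ker => /eqP.
Qed.
Lemma img_eq_factor M N L (g : rep_hom N M) (h : rep_hom L M) : injective_hom g ->
  (forall v, limg (h v) = limg (g v)) -> exists f, h = comph g f.
Proof.
move=> gs E; have [|f <-] := factor_mono (f := h) gs; last by exists f.
by move=> v x; rewrite -E memv_img ?memvf.
Qed.
End HdStrict.

(** * Regular representations *)

Section Uniserial.
Variables (k : finFieldType) (Q : quiver) (d : vertex Q -> int).
Hypothesis ac : acyclic Q.
Hypothesis tf : tame_form d.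
Implicit Types M N X Y A B C E K S : rep k Q.
Notation theta := (@theta k Q d).
Notation reg := (@reg k Q d).
Notation stab := (@stab k Q d).

Lemma indec0_nonproj A : indecomposable A -> theta A = 0 -> ~ projective A.
Proof. by move=> [A0 _] At /(projective_theta ac tf) /(_ A0); rewrite -/(theta A) At ltxx. Qed.
Lemma indec0_noninj A : indecomposable A -> theta A = 0 -> ~ injective_rep A.
Proof. by move=> [A0 _] At /(injective_theta ac tf) /(_ A0); rewrite -/(theta A) At ltxx. Qed.

Lemma ses_theta0 A B C (f : rep_hom A B) (g : rep_hom B C) : short_exact f g ->
  theta B = 0 -> theta C = 0 -> theta A = 0.
Proof. by move=> fg Bt Ct; have := theta_ses d fg; rewrite Bt Ct addr0. Qed.

(** The dimension vector of tau K, summed over indecomposable summands; only its nonnegativity and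
    its Euler pairings will matter. *)
Lemma reg_tau_vec K : reg K -> exists x : vertex Q -> int,
  (forall i, 0 <= x i) /\ forall z, euler (dv K) z = - euler z x.
Proof.
move: K; apply: (@reg_induction _ _ d) => [K K0|K A B e Ai At _ _ [x [x0 xE]]].
  exists (fun=> 0); split=> // z; rewrite (euler0r (z := fun=> 0)) // oppr0.
  apply: euler0l => i; rewrite /dv /dim_vector.
  by move/is_zeroP: K0 (dim_tdim K i) => ->; rewrite leqn0 => /eqP ->.
have [W tW] := AR_exists ac Ai (indec0_nonproj Ai At).
exists (fun i => dv W i + x i); split=> [i|z]; first by rewrite addr_ge0 ?dv_pos.
rewrite (iso_dv e) (eulerDl _ (dv_dsum A B)) xE (tau_dim _ tW).
by rewrite (@eulerDr _ (dv W) x (fun i => dv W i + x i)) //; lra.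
Qed.

(** The translate W of E contains a quasi-simple S, and the inverse translate S' of S maps onto E
    with kernel K. Then dim(W / S) is the negative of the translated dim K; both are nonnegative, so
    W = S. *)
Lemma stab_tau E : stab E -> exists N, stab N /\ is_tau N E.
Proof.
move=> Es; have [Er E0 _] := Es; have Ei := stab_indec Es; have [Et _] := Er.
have [W tW] := AR_exists ac Ei (indec0_nonproj Ei Et); exists W; split=> //.
have [Wi _ _] := (is_tauP _ _).1 tW.
have Wt : theta W = 0 by rewrite [LHS](tau_theta tf tW).
have Wr := reg_indec ac tf Wi Wt; have [W0 _] := Wi.
have [S [s [Ss si]]] := stab_sub Wr W0; have [Sr S0 _] := Ss; have [St _] := Sr.
have Si := stab_indec Ss.
have [S' tS] := AR_exists_start ac Si (indec0_noninj Si St).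
have [_ S'i _] := (is_tauP _ _).1 tS.
have S't : theta S' = 0 by rewrite -[LHS](tau_theta tf tS).
have S'r := reg_indec ac tf S'i S't.
(* Both formulas identify Hom(S', E) with Hom(S, W) in dimension, through Ext^1(E, S). *)
have [g g0] : exists g : rep_hom S' E, g <> zeroh S' E.
  by apply: hd_nonzero; rewrite -(tau_ed_r _ tS) (tau_ed_l _ tW) (inj_hd_gt0 si S0).
have gs := stab_surj S'r Es g0; have [K [j jg]] := epi_ses gs.
have Kr : reg K.
  exact: reg_sub S'r (ses_inj jg) (ses_theta0 jg S't Et).
have [x [x0 xE]] := reg_tau_vec Kr; have [C [c sc]] := mono_ses si.
have CE0 i : dv C i + x i = 0.
  apply: (euler_nondeg_r ac (u := fun i => dv C i + x i)) => z.
  rewrite (@eulerDr _ (dv C) x (fun i => dv C i + x i)) // -[euler z x]opprK -xE.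
  have := tau_dim z tS; have := tau_dim z tW.
  rewrite (eulerDl z (ses_dv jg)) (eulerDr z (ses_dv sc)); lra.
apply: (@stab_iso _ _ _ S) => //; apply/rep_isoP; exists s; split=> //.
apply: inj_tdim_surj => //; rewrite (ses_tdim sc).
suff /is_zeroP -> : is_zero C by rewrite addn0.
apply: contrapT => /nonzero_dv [i /negP]; apply; apply/eqP.
by have := CE0 i; have := x0 i; have := dv_pos C i; lra.
Qed.

(** For a quasi-simple quotient T of the inverse translate M, a nonzero map from S to the translate
    of T is an isomorphism; so M and T have the same dimension vector. *)
Lemma stab_tau_inv S : stab S -> exists M, stab M /\ is_tau S M.
Proof.
move=> Ss; have [Sr S0 _] := Ss; have Si := stab_indec Ss; have [St _] := Sr.
have [M tM] := AR_exists_start ac Si (indec0_noninj Si St); exists M; split=> //.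
have [_ Mi _] := (is_tauP _ _).1 tM.
have Mt : theta M = 0 by rewrite -[LHS](tau_theta tf tM).
have Mr := reg_indec ac tf Mi Mt; have [M0 _] := Mi.
have [T [t [Ts tsu]]] := stab_quot Mr M0; have [N [Ns tN]] := stab_tau Ts.
have [_ T0 _] := Ts.
have [g g0] : exists g : rep_hom S N, g <> zeroh S N.
  apply: hd_nonzero; rewrite -(tau_ed_l _ tN) (tau_ed_r _ tM).
  by apply: (hd_gt0 (f := t)); apply: surj_nonzero.
have [gi gs] := stab_bij Ss Ns g0.
have eSN : rep_iso S N by apply/rep_isoP; exists g.
have [K [j jt]] := epi_ses tsu.
have KE i : dv K i = 0.
  apply: (euler_nondeg_l ac) => z; have := tau_dim z tM; have := tau_dim z tN.
  by rewrite (eulerDl z (ses_dv jt)) (iso_dv eSN); lra.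
apply: (@stab_iso _ _ _ T) => //; apply/rep_iso_sym/rep_isoP; exists t; split=> //.
apply: surj_tdim_inj => //; rewrite (ses_tdim jt).
suff /is_zeroP -> : is_zero K by rewrite add0n.
by apply: contrapT => /nonzero_dv [i /negP]; apply; apply/eqP.
Qed.

(** Uniqueness of the maximal regular subobject, expressed by kernels of maps onto quasi-simples;
    [colocal] is the dual condition on the regular socle. *)
Definition local A := [/\ reg A, ~ is_zero A &
  forall S1 S2 (g1 : rep_hom A S1) (g2 : rep_hom A S2), stab S1 -> stab S2 ->
    surjective_hom g1 -> surjective_hom g2 -> forall v, lker (g1 v) = lker (g2 v)].

Definition colocal A := [/\ reg A, ~ is_zero A &
  forall S1 S2 (s1 : rep_hom S1 A) (s2 : rep_hom S2 A), stab S1 -> stab S2 ->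
    injective_hom s1 -> injective_hom s2 -> forall v, limg (s1 v) = limg (s2 v)].

(** Any quasi-simple quotient of M has a nonzero map to N, hence is isomorphic to it; and Hom(M, N)
    is no larger than End(N), so all maps to N factor through one surjection. *)
Lemma one_quot M N : reg M -> stab N -> (forall S, stab S -> (hd M S <= hd S N)%N) ->
  forall S1 S2 (g1 : rep_hom M S1) (g2 : rep_hom M S2), stab S1 -> stab S2 ->
    surjective_hom g1 -> surjective_hom g2 -> forall v, lker (g1 v) = lker (g2 v).
Proof.
move=> Mr Ns hle.
have toN S (g : rep_hom M S) : stab S -> surjective_hom g ->
    exists g' : rep_hom M N, surjective_hom g' /\ forall v, lker (g' v) = lker (g v).
  move=> Ss gs; have [_ S0 _] := Ss.
  have [h h0] : exists h : rep_hom S N, h <> zeroh S N.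
    apply: hd_nonzero; apply: leq_trans (hle S Ss).
    by apply: (hd_gt0 (f := g)); apply: surj_nonzero.
  have [hi hs] := stab_bij Ss Ns h0; exists (comph h g).
  by split; [apply: surj_comp|move=> v; apply: ker_comp_inj].
move=> S1 S2 g1 g2 Ss1 Ss2 g1s g2s v; have [h1 [h1s h1E]] := toN _ _ Ss1 g1s.
have [h2 [h2s h2E]] := toN _ _ Ss2 g2s; rewrite -h1E -h2E.
have [f fE] := (hd_surj_factor N h1s).1 (hle N Ns) h2.
apply/eqP; rewrite eqEdim; apply/andP; split.
  by apply/subvP=> x; rewrite !memv_ker fE comphE => /eqP ->; rewrite linear0.
by have := surj_ker_dim v h1s; have := surj_ker_dim v h2s; lia.
Qed.

Lemma one_sub M N : reg M -> stab N -> (forall S, stab S -> (hd S M <= hd N S)%N) ->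
  forall S1 S2 (s1 : rep_hom S1 M) (s2 : rep_hom S2 M), stab S1 -> stab S2 ->
    injective_hom s1 -> injective_hom s2 -> forall v, limg (s1 v) = limg (s2 v).
Proof.
move=> Mr Ns hle.
have toN S (g : rep_hom S M) : stab S -> injective_hom g ->
    exists g' : rep_hom N M, injective_hom g' /\ forall v, limg (g' v) = limg (g v).
  move=> Ss gs; have [_ S0 _] := Ss.
  have [h h0] : exists h : rep_hom N S, h <> zeroh N S.
    apply: hd_nonzero; apply: leq_trans (hle S Ss).
    by apply: (hd_gt0 (f := g)); apply: inj_nonzero.
  have [hi hs] := stab_bij Ns Ss h0; exists (comph g h).
  by split; [apply: inj_comp|move=> v; apply: img_comp_surj].
move=> S1 S2 g1 g2 Ss1 Ss2 g1s g2s v; have [h1 [h1s h1E]] := toN _ _ Ss1 g1s.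
have [h2 [h2s h2E]] := toN _ _ Ss2 g2s; rewrite -h1E -h2E.
have [f fE] := (hd_inj_factor N h1s).1 (hle N Ns) h2.
apply/esym/eqP; rewrite eqEdim; apply/andP; split.
  by apply/subvP=> _ /memv_imgP [x _ ->]; rewrite fE comphE memv_img ?memvf.
by rewrite (inj_img_dim v h1s) (inj_img_dim v h2s).
Qed.

(** Every map from A to a quasi-simple S factors through E, so Hom(M, S) embeds in Ext^1(E, S),
    which is dual to Hom(S, tau E). Hence [one_quot] applies with N = tau E. *)
Lemma local_rad A E M (g : rep_hom A E) (i : rep_hom M A) : local A -> stab E ->
  short_exact i g -> reg M /\ (is_zero M \/ local M).
Proof.
move=> [Ar A0 Al] Es ig; have [Er _ _] := Es; have [Et _] := Er; have [At _] := Ar.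
have Mr : reg M.
  exact: reg_sub Ar (ses_inj ig) (ses_theta0 ig At Et).
split=> //; have [|M0] := pselect (is_zero M); [by left|right; split=> //].
have [N [Ns tN]] := stab_tau Es; apply: (one_quot Mr Ns) => S Ss.
have : (hd A S <= hd E S)%N.
  apply/(hd_surj_factor S (ses_surj ig)) => f.
  have [->|f0] := pselect (f = zeroh A S).
    by exists (zeroh E S); apply: hom_ext => v x; rewrite comphE !zerohE.
  apply: (ker_eq_factor (ses_surj ig)); apply: Al => //; [|exact: ses_surj ig].
  exact: (stab_surj Ar Ss f0).
by have := ses_hd_le_l ig S; rewrite (tau_ed_l _ tN); lia.
Qed.

Lemma colocal_quot A S B (s : rep_hom S A) (p : rep_hom A B) : colocal A -> stab S ->
  short_exact s p -> reg B /\ (is_zero B \/ colocal B).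
Proof.
move=> [Ar A0 Al] Ss sp; have [Sr _ _] := Ss; have [St _] := Sr; have [At _] := Ar.
have Br : reg B.
  by apply: (reg_quot Ar sp); have := theta_ses d sp; rewrite St At; lra.
split=> //; have [|B0] := pselect (is_zero B); [by left|right; split=> //].
have [N [Ns tN]] := stab_tau_inv Ss; apply: (one_sub Br Ns) => T Ts.
have : (hd T A <= hd T S)%N.
  apply/(hd_inj_factor T (ses_inj sp)) => f.
  have [->|f0] := pselect (f = zeroh T A).
    by exists (zeroh T S); apply: hom_ext => v x; rewrite comphE !zerohE linear0.
  apply: (img_eq_factor (ses_inj sp)); apply: Al => //; [|exact: ses_inj sp].
  exact: (stab_inj Ar Ts f0).
by have := ses_hd_le_r sp T; rewrite (tau_ed_r _ tN); lia.
Qed.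

Lemma stab_local S : stab S -> local S.
Proof.
move=> Ss; have [Sr S0 _] := Ss; split=> // S1 S2 g1 g2 Ss1 Ss2 g1s g2s v.
have [_ S10 _] := Ss1; have [_ S20 _] := Ss2.
have [g1i _] := stab_bij Ss Ss1 (surj_nonzero g1s S10).
have [g2i _] := stab_bij Ss Ss2 (surj_nonzero g2s S20).
by rewrite !inj_lker0.
Qed.

Lemma stab_colocal S : stab S -> colocal S.
Proof.
move=> Ss; have [Sr S0 _] := Ss; split=> // S1 S2 g1 g2 Ss1 Ss2 g1s g2s v.
have [_ S10 _] := Ss1; have [_ S20 _] := Ss2.
have [_ g1i] := stab_bij Ss1 Ss (inj_nonzero g1s S10).
have [_ g2i] := stab_bij Ss2 Ss (inj_nonzero g2s S20).
by rewrite g1i g2i.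
Qed.

(** By induction the radical M is colocal, so it remains to see that every quasi-simple subobject of
    A lies in M. *)
Lemma local_colocal A : local A -> colocal A.
Proof.
have [n] := ubnP (tdim A); elim: n A => // n IH A /ltnSE le Al.
have [Ar A0 Au] := Al; have [E [g [Es gs]]] := stab_quot Ar A0.
have [_ E0 _] := Es.
have [M [i ig]] := epi_ses gs; have [Mr [M0|Ml]] := local_rad Al Es ig.
  apply: stab_colocal; apply: (@stab_iso _ _ _ E) => //; apply/rep_iso_sym/rep_isoP.
  exists g; split=> //; apply: surj_tdim_inj => //; rewrite (ses_tdim ig).
  by move/is_zeroP: M0 => ->.
have [_ M0 _] := Ml; have Mc : colocal M.
  apply: IH => //; apply: leq_trans le; rewrite (ses_tdim ig).
  by move/nonzeroP: E0; lia.
have [_ _ Mu] := Mc; split=> //.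
have key S (s : rep_hom S A) : stab S -> injective_hom s -> exists t, s = comph i t.
  move=> Ss si; have [_ S0 _] := Ss; apply: (ses_factor_l ig).
  apply: contrapT => gs0; have [ui us] := stab_bij Ss Es gs0.
  have [w [_ wE]] := bij_inverse ui us.
  (* If g s were invertible with inverse w, then 1 - s w g would retract A onto M. A quasi-simple
     quotient of M would give a second one of A, whose kernel contains S, against locality. *)
  have [|r rE] := ses_factor_l ig (u := addh (idh A) (scaleh (-1) (comph s (comph w g)))).
    apply: hom_ext => v x; rewrite !homE linearD linearZ /= scaleN1r.
    have := congr1 (fun h : rep_hom E E => h v (g v x)) wE.
    by rewrite !homE => ->; rewrite subrr.
  have [S' [m [S's ms]]] := stab_quot Mr M0.
  have rsE v y : r v (s v y) = 0.
    apply: (inj_eq0 (ses_inj ig (i := v))); rewrite -(comphE i r) -rE !homE.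
    have -> : w v (g v (s v y)) = y.
      by apply: (ui v); have := congr1 (fun h : rep_hom E E => h v (g v (s v y))) wE; rewrite !homE.
    by rewrite scaleN1r subrr.
  have ris v y : r v (i v y) = y.
    apply: (ses_inj ig (i := v)); rewrite -(comphE i r) -rE !homE (ses_comp ig) !linear0.
    by rewrite ?scaler0 addr0.
  have hs : surjective_hom (comph m r).
    move=> v; apply/limg_surj=> y; have [x <-] := (limg_surj _).1 (ms v) y.
    by exists (i v x); rewrite comphE ris.
  apply: S0 => v y; apply: (inj_eq0 (ui v)); apply/eqP; rewrite comphE -memv_ker.
  by rewrite -(Au _ _ _ _ S's Es hs gs v) memv_ker comphE rsE linear0.
move=> S1 S2 s1 s2 Ss1 Ss2 s1i s2i v.
have [t1 t1E] := key _ _ Ss1 s1i; have [t2 t2E] := key _ _ Ss2 s2i.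
rewrite t1E t2E in s1i s2i *.
have := Mu _ _ t1 t2 Ss1 Ss2 (inj_factor_inj s1i) (inj_factor_inj s2i) v => tE.
apply/vspaceP=> x; apply/memv_imgP/memv_imgP => -[y _ ->]; rewrite comphE.
  have : t1 v y \in limg (t2 v) by rewrite -tE memv_img ?memvf.
  by case/memv_imgP=> z _ ->; exists z; rewrite ?memvf ?comphE.
have : t2 v y \in limg (t1 v) by rewrite tE memv_img ?memvf.
by case/memv_imgP=> z _ ->; exists z; rewrite ?memvf ?comphE.
Qed.

(** A surjection onto a quasi-simple kills the socle S: otherwise its kernel, which is nonzero,
    contains a quasi-simple subobject, and by colocality that is S. *)
Lemma colocal_local A : colocal A -> local A.
Proof.
have [n] := ubnP (tdim A); elim: n A => // n IH A /ltnSE le Al.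
have [Ar A0 Au] := Al; have [S [s [Ss si]]] := stab_sub Ar A0.
have [_ S0 _] := Ss.
have [B [p sp]] := mono_ses si; have [Br [B0|Bl]] := colocal_quot Al Ss sp.
  apply: stab_local; apply: (@stab_iso _ _ _ S) => //; apply/rep_isoP.
  exists s; split=> //; apply: inj_tdim_surj => //; rewrite (ses_tdim sp).
  by move/is_zeroP: B0 => ->; rewrite addn0.
have [_ B0 _] := Bl; have [_ _ Bu] : local B.
  apply: IH => //; apply: leq_trans le; rewrite (ses_tdim sp).
  by move/nonzeroP: S0; lia.
split=> //.
have key S1 (g : rep_hom A S1) : stab S1 -> surjective_hom g -> exists h, g = comph h p.
  move=> S1s gs; have [S1r S10 _] := S1s; apply: (ses_factor_r sp).
  apply: contrapT => gs0; have [ui us] := stab_bij Ss S1s gs0.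
  have [K [j jg]] := epi_ses gs; have [K0|K0] := pselect (is_zero K).
    apply: B0; apply/is_zeroP; have := ses_tdim jg; have := ses_tdim sp.
    move/is_zeroP: K0 => ->; have := surj_tdim us; have := inj_tdim ui; lia.
  have Kr : reg K.
    exact: reg_sub Ar (ses_inj jg) (ses_theta0 jg (proj1 Ar) (proj1 S1r)).
  have [S' [s' [S's s'i]]] := stab_sub Kr K0; have [_ S'0 _] := S's.
  apply: S0 => v y; apply: (inj_eq0 (ui v)); rewrite comphE.
  have : s v y \in limg (comph j s' v).
    rewrite (Au _ _ _ _ S's Ss (inj_comp s'i (ses_inj jg)) si v).
    by rewrite memv_img ?memvf.
  by case/memv_imgP=> z _ ->; rewrite comphE (ses_comp jg).
move=> S1 S2 g1 g2 Ss1 Ss2 g1s g2s v.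
have [h1 h1E] := key _ _ Ss1 g1s; have [h2 h2E] := key _ _ Ss2 g2s.
rewrite h1E h2E in g1s g2s *.
have := Bu _ _ h1 h2 Ss1 Ss2 (surj_factor_surj g1s) (surj_factor_surj g2s) v => tE.
by apply/vspaceP=> x; rewrite !memv_ker !comphE -!memv_ker tE.
Qed.

Lemma local_iso A B : rep_iso A B -> local A -> local B.
Proof.
move=> e [Ar A0 Au]; split; first exact: reg_iso e Ar.
  by move=> B0; apply: A0; apply: iso_zero (rep_iso_sym e) B0.
have [f [fi fs]] := (rep_isoP _ _).1 e.
move=> S1 S2 g1 g2 Ss1 Ss2 g1s g2s v.
have E := Au _ _ _ _ Ss1 Ss2 (surj_comp fs g1s) (surj_comp fs g2s) v.
apply/vspaceP=> y; have [x <-] := (limg_surj _).1 (fs v) y.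
by rewrite !memv_ker -!comphE -!memv_ker E.
Qed.

(** Let A be a largest local subobject and B a largest regular subobject meeting A in 0. The
    quotient C = R / B is local, and a smallest regular subobject A' mapping onto C is local too.
    Hence dim C <= dim A' <= dim A, so R = A + B and B = 0. *)
Lemma indec_local_top R : indecomposable R -> reg R -> local R.
Proof.
move=> Ri Rr; have [R0 _] := Ri; have [Rt _] := Rr.
have [||[A i] /= [[Al ii] Am]] := @maximize_nat {A : rep k Q & rep_hom A R}
  (fun z => local (tag z) /\ injective_hom (tagged z)) (fun z => tdim (tag z)) (tdim R).
- have [S [s [Ss si]]] := stab_sub Rr R0.
  by exists (existT (fun A => rep_hom A R) S s); split=> //=; apply: stab_local.
- by move=> [A i] /= [_ ii]; apply: inj_tdim ii.
have [Ar A0 _] := Al; have [_ _ Ac] := local_colocal Al.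
have [||[B j] /= [[Bt ji ij] Bm]] := @maximize_nat {B : rep k Q & rep_hom B R}
  (fun z => [/\ theta (tag z) = 0, injective_hom (tagged z) &
     forall v x y, i v x = tagged z v y -> x = 0 /\ y = 0])
  (fun z => tdim (tag z)) (tdim R).
- have z0 v (x : rep0 k Q v) : x = 0 by apply/rowP => -[].
  exists (existT (fun A => rep_hom A R) (rep0 k Q) (zeroh _ R)); split=> /=.
  + exact: theta_zero.
  + by move=> v x y _; rewrite (z0 v x) (z0 v y).
  + move=> v x y E; split; last exact: z0.
    by apply: (inj_eq0 (ii v)); rewrite E; exact: (@zerohE _ _ (rep0 k Q) R v y).
- by move=> [B j] /= [_ ji _]; apply: inj_tdim ji.
have Br := reg_sub Rr ji Bt; have [C [q jq]] := mono_ses ji.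
have Cr : reg C by apply: (reg_quot Rr jq); have := theta_ses d jq; rewrite Rt Bt; lra.
pose qi := comph q i.
have qii : injective_hom qi.
  by move=> v; apply: lker_inj => x; rewrite comphE => /(ses_ker jq) [y /ij []].
have C0 : ~ is_zero C by move=> C0; apply: A0 => v x; apply: (qii v); rewrite (C0 v (qi v x)) (C0 v (qi v 0)).
(* The image of A is essential in C, so the regular socle of C is that of A. *)
have key T (t : rep_hom T C) : stab T -> injective_hom t -> exists s, t = comph qi s.
  move=> Ts ti; have [Tr T0 Tst] := Ts; have [Tt _] := Tr.
  pose c := copairh t (scaleh (-1) qi).
  have cE v x y : c v (x, y) = t v x - qi v y by rewrite copair2E scalehE scaleN1r.
  have [K [kk [ki kE]]] := ker_exists c.
  have cK v w : t v (kk v w).1 = qi v (kk v w).2.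
    apply/eqP; rewrite -subr_eq0 -cE -surjective_pairing -memv_ker -kE.
    by rewrite memv_img ?memvf.
  have Kr : reg K by apply: (reg_ker (f := c)) kE => //; apply: reg_ext (dsum_ses T A) Tr Ar.
  have [K0|K0] := pselect (is_zero K).
    (* If T meets A in 0, the preimage of T in R still meets A in 0 and is larger than B. *)
    exfalso; have [X [x [f' [g' [ex xi xf xg]]]]] := preimage jq ti.
    have Xt : theta X = 0 by rewrite [LHS](theta_ses d ex) -/(theta B) -/(theta T) Bt Tt addr0.
    have := Bm (existT (fun A => rep_hom A R) X x); rewrite /= (ses_tdim ex) => H.
    suff /H : [/\ theta X = 0, injective_hom x & forall v a w, i v a = x v w -> a = 0 /\ w = 0].
      by move/nonzeroP: T0; lia.
    split=> // v a w aw.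
    have : (g' v w, a) \in limg (kk v).
      rewrite kE memv_ker cE subr_eq0 comphE aw -(comphE q x) -xg comphE //.
    case/memv_imgP=> w' _; rewrite (K0 v w') linear0 => -[_ a0]; split=> //.
    by apply: (inj_eq0 (xi v)); rewrite -aw a0 linear0.
  pose u := comph (fsth T A) kk.
  have uE v w : u v w = (kk v w).1 by rewrite comphE fsthE.
  have ui : injective_hom u.
    move=> v; apply: lker_inj => w; rewrite uE => w1; apply: (inj_eq0 (ki v)).
    have : (kk v w).2 = 0 by apply: (inj_eq0 (qii v)); rewrite -cK w1 linear0.
    by case: (kk v w) w1 => a b /= -> ->.
  have [//|us] := Tst _ _ ui (proj1 Kr).
  have [u' [_ uu']] := bij_inverse ui us.
  exists (comph (sndh T A) (comph kk u')); apply: hom_ext => v x.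
  rewrite [RHS]comphE comphE sndhE comphE -cK -uE.
  by have := congr1 (fun h : rep_hom T T => h v x) uu'; rewrite !homE => ->.
have Cl : local C.
  apply: colocal_local; split=> // S1 S2 s1 s2 Ss1 Ss2 s1i s2i v.
  have [t1 t1E] := key _ _ Ss1 s1i; have [t2 t2E] := key _ _ Ss2 s2i.
  rewrite t1E t2E in s1i s2i *.
  have tE := Ac _ _ t1 t2 Ss1 Ss2 (inj_factor_inj s1i) (inj_factor_inj s2i) v.
  apply/vspaceP=> x; apply/memv_imgP/memv_imgP => -[y _ ->]; rewrite comphE.
    have : t1 v y \in limg (t2 v) by rewrite -tE memv_img ?memvf.
    by case/memv_imgP=> z _ ->; exists z; rewrite ?memvf ?comphE.
  have : t2 v y \in limg (t1 v) by rewrite tE memv_img ?memvf.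
  by case/memv_imgP=> z _ ->; exists z; rewrite ?memvf ?comphE.
have [_ _ Cu] := Cl.
have [|[A' a] /= [[A't ai qas] A'm]] := @minimize_nat {B : rep k Q & rep_hom B R}
  (fun z => [/\ theta (tag z) = 0, injective_hom (tagged z) &
     surjective_hom (comph q (tagged z))]) (fun z => tdim (tag z)).
  exists (existT (fun A => rep_hom A R) R (idh R)); split=> //=.
    by move=> v x y; rewrite !idhE.
  by rewrite comph1; apply: ses_surj jq.
have A'r := reg_sub Rr ai A't; pose qa := comph q a.
have A'l : local A'.
  split=> //.
    by move=> A'0; apply: C0 => v y; have [x <-] := (limg_surj _).1 (qas v) y; rewrite (A'0 v x) linear0.
  (* If g did not kill the kernel N of A' -> C, then N would map onto S1, and the kernel of g would
     be a smaller subobject mapping onto C. *)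
  have fac S1 (g : rep_hom A' S1) : stab S1 -> surjective_hom g -> exists h, g = comph h qa.
    move=> S1s gs; have [S1r S10 _] := S1s; have [K [ka kg]] := epi_ses gs.
    have [N [nu nq]] := epi_ses (qas : surjective_hom qa).
    apply: (ses_factor_r nq); apply: contrapT => gn0.
    have Nr : reg N.
      exact: reg_sub A'r (ses_inj nq) (ses_theta0 nq A't (proj1 Cr)).
    have gns := stab_surj Nr S1s gn0.
    have := A'm (existT (fun A => rep_hom A R) K (comph a ka)).
    rewrite /= (ses_tdim kg) => H.
    suff /H : [/\ theta K = 0, injective_hom (comph a ka) & surjective_hom (comph q (comph a ka))].
      by move/nonzeroP: S10; lia.
    split.
    - exact: ses_theta0 kg A't (proj1 S1r).
    - exact: inj_comp (ses_inj kg) ai.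
    move=> v; apply/limg_surj=> y; have [x <-] := (limg_surj _).1 (qas v) y.
    have [n nE] := (limg_surj _).1 (gns v) (g v x).
    have [|w wE] := ses_ker kg (x := x - nu v n) (i := v).
      by rewrite linearB /= -nE comphE subrr.
    exists w; rewrite comphA comphE -wE linearB /= -[X in _ - X]comphE.
    by have := ses_comp nq n => E; rewrite [comph _ _ _ _]comphE E subr0.
  move=> S1 S2 g1 g2 Ss1 Ss2 g1s g2s v.
  have [h1 h1E] := fac _ _ Ss1 g1s; have [h2 h2E] := fac _ _ Ss2 g2s.
  rewrite h1E h2E in g1s g2s *.
  have tE := Cu _ _ h1 h2 Ss1 Ss2 (surj_factor_surj g1s) (surj_factor_surj g2s) v.
  by apply/vspaceP=> x; rewrite !memv_ker !comphE -!memv_ker tE.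
have leA := Am (existT (fun A => rep_hom A R) A' a) (conj A'l ai); rewrite /= in leA.
have leC := surj_tdim qas; have tR := ses_tdim jq.
have eR : rep_iso R (dsum A B) by apply: (dsum_internal ij); lia.
case: Ri => _ /(_ A B eR) [/A0 //|/is_zeroP B0].
apply: (@local_iso A) => //; apply/rep_isoP; exists i; split=> //.
by apply: inj_tdim_surj => //; lia.
Qed.
End Uniserial.

(** * Preprojectives of defect -1 *)

Section DirectSumDim.
Variables (k : finFieldType) (Q : quiver).
Implicit Types M N X A B : rep k Q.

Lemma hd_dsum_r X A B : (hd X A + hd X B <= hd X (dsum A B))%N.
Proof.
pose p := linfun (@post0 _ _ X (dsum A B) B (sndh A B)).
have pE u : p u = post0 (sndh A B) u by rewrite (linfunE (@post0_linear _ _ _ _ _ _)).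
rewrite [X in (_ <= X)%N]/hd -(limg_ker_dim p (Z0 X (dsum A B))); apply: leq_add.
  apply: (@dim_inj_leq _ _ _ (linfun (@post0 _ _ X A (dsum A B) (inlh A B)))) => _ /Z0_hom [f ->];
    rewrite (linfunE (@post0_linear _ _ _ _ _ _)).
    rewrite post0_hom memv_cap hom_Z0 memv_ker pE post0_hom; apply/eqP/C0P => i x.
    by rewrite [RHS]CE !comphE inlhE sndhE.
  move=> f0; apply: C0P => i x; rewrite [RHS]CE; apply: (inj_eq0 (@inlh_inj _ _ A B i)).
  by rewrite -[LHS]post0E f0 CE.
apply/dimvS/subvP=> _ /Z0_hom [f ->]; apply/memv_imgP.
exists (hfun (comph (inrh A B) f)); first exact: hom_Z0.
rewrite pE post0_hom; apply: C0P => i x.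
by rewrite [RHS]comphE comphE inrhE sndhE.
Qed.

Lemma hd_dsum_l X A B : (hd A X + hd B X <= hd (dsum A B) X)%N.
Proof.
pose p := linfun (@pre0 _ _ X A (dsum A B) (inlh A B)).
have pE u : p u = pre0 (inlh A B) u by rewrite (linfunE (@pre0_linear _ _ _ _ _ _)).
rewrite [X in (_ <= X)%N]/hd -(limg_ker_dim p (Z0 (dsum A B) X)) addnC; apply: leq_add.
  apply: (@dim_inj_leq _ _ _ (linfun (@pre0 _ _ X (dsum A B) B (sndh A B)))) => _ /Z0_hom [f ->];
    rewrite (linfunE (@pre0_linear _ _ _ _ _ _)).
    rewrite pre0_hom memv_cap hom_Z0 memv_ker pE pre0_hom; apply/eqP/C0P => i x.
    by rewrite [RHS]CE !comphE inlhE sndhE linear0.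
  move=> f0; apply: C0P => i x; rewrite [RHS]CE.
  by rewrite -[x](sndhE (A := A) (B := B) (i := i) (0, x)) -[LHS]pre0E f0 CE.
apply/dimvS/subvP=> _ /Z0_hom [f ->]; apply/memv_imgP.
exists (hfun (comph f (fsth A B))); first exact: hom_Z0.
rewrite pE pre0_hom; apply: C0P => i x.
by rewrite [RHS]comphE comphE inlhE fsthE.
Qed.

(** End(M) is a division algebra of dimension e, and M v is a vector space over it: a stable
    subspace of dimension divisible by e can be enlarged by the orbit of any vector outside it. *)
Lemma division_dim M v : (forall f : rep_hom M M, f <> zeroh M M -> injective_hom f) ->
  (hd M M %| \dim {: M v})%N.
Proof.
move=> div; pose e := hd M M.
have [||W [[We Ws] Wm]] := @maximize_nat {vspace M v} (fun W => (e %| \dim W)%N /\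
    forall f : rep_hom M M, forall x, x \in W -> f v x \in W) (fun W => \dim W) (\dim {: M v}).
- exists 0%VS; rewrite dimv0 dvdn0; split=> // f x; rewrite !memv0 => /eqP ->.
  by rewrite linear0.
- by move=> W _; apply/dimvS/subvf.
have [->//|Wf] := eqVneq {: M v}%VS W.
have [x xW] : exists x, x \notin W.
  apply: contrapT => /forallNP n; move/eqP: Wf; apply; apply/vspaceP => x.
  by rewrite memvf; apply/esym; have /negP := n x; rewrite negbK.
pose ap (u : C0 M M) : M v := u v x.
have apl : linear ap by move=> c u w; rewrite /ap !CE.
pose D := (linfun ap @: Z0 M M)%VS.
have DP y : y \in D -> exists f : rep_hom M M, y = f v x.
  by case/memv_imgP=> _ /Z0_hom [f ->] ->; exists f; rewrite (linfunE apl).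
have PD (f : rep_hom M M) : f v x \in D.
  by apply/memv_imgP; exists (hfun f); rewrite ?hom_Z0 ?(linfunE apl).
have x0 : x != 0 by apply: contraNneq xW => ->; rewrite mem0v.
have dimD : \dim D = e.
  apply: limg_dim_eq; apply/eqP; rewrite -subv0; apply/subvP => _ /memv_capP [/Z0_hom [f ->]].
  rewrite memv_ker (linfunE apl) memv0 => /eqP fx.
  have [->|/div fi] := pselect (f = zeroh M M).
    by apply/eqP/C0P => i y; rewrite [RHS]CE zerohE.
  by move/eqP: x0; case; apply: (inj_eq0 (fi v)).
have WD : (W :&: D = 0)%VS.
  apply/eqP; rewrite -subv0; apply/subvP => y /memv_capP [yW /DP [f yE]].
  rewrite memv0 yE; have [->|/div fi] := pselect (f = zeroh M M); first by rewrite zerohE.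
  have fW : (f v @: W)%VS = W.
    apply/eqP; rewrite eqEdim limg_dim_eq; last by rewrite inj_lker0 ?capv0.
    by rewrite leqnn andbT; apply/subvP=> _ /memv_imgP [w wW ->]; apply: Ws.
  move: yW; rewrite -fW yE => /memv_imgP [w wW /fi xw].
  by rewrite xw wW in xW.
have := Wm (W + D)%VS; rewrite dimv_disjoint_sum // dimD => H.
have e0 : (0 < e)%N.
  rewrite -dimD lt0n dimv_eq0; apply: contraNneq x0 => D0.
  by have := PD (idh M); rewrite D0 memv0 idhE.
suff /H : (e %| \dim W + e)%N /\ forall f : rep_hom M M, forall y, y \in (W + D)%VS -> f v y \in (W + D)%VS.
  by move: e0; lia.
split; first by rewrite dvdn_addr.
move=> f y /memv_addP [w wW [z /DP [g ->] ->]]; rewrite linearD /= memv_add ?Ws //.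
by rewrite -(comphE f g) PD.
Qed.
End DirectSumDim.

Section DefectOne.
Variables (k : finFieldType) (Q : quiver) (d : vertex Q -> int).
Hypothesis ac : acyclic Q.
Hypothesis tf : tame_form d.
Implicit Types M N X Y A B C E K S P L : rep k Q.
Notation theta := (@theta k Q d).
Notation reg := (@reg k Q d).
Notation stab := (@stab k Q d).
Notation neg := (@neg k Q d).

(** A nonzero kernel and a nonzero image would both have negative defect, with sum -1. *)
Lemma neg1_inj X Y (f : rep_hom X Y) : theta X = -1 -> neg X -> neg Y ->
  f <> zeroh X Y -> injective_hom f.
Proof.
move=> Xt Xn Yn f0; have [I [K [p [j [i [ip ji fE]]]]]] := im_exists f.
have [K0|K0] := pselect (is_zero K).
  rewrite fE; apply: inj_comp ji; apply: surj_tdim_inj; first exact: ses_surj ip.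
  by rewrite (ses_tdim ip); move/is_zeroP: K0 => ->.
have I0 : ~ is_zero I.
  by move=> I0; apply: f0; apply: hom_eq0 => v x; rewrite fE comphE (I0 v (p v x)) linear0.
have := Xn _ _ (ses_inj ip) K0; have := Yn _ _ ji I0; have := theta_ses d ip.
by rewrite -/(theta X) Xt; lia.
Qed.

(** The dimension of End(P) divides every coordinate of dim P, hence the defect -1. *)
Lemma neg1_end P : indecomposable P -> theta P = -1 -> hd P P = 1%N.
Proof.
move=> Pi Pt; have Pn : neg P by apply: neg_indec => //; rewrite Pt.
have dvd v : (hd P P %| \dim {: P v})%N.
  by apply: division_dim => f; apply: neg1_inj.
have E : theta P = (hd P P)%:Z * euler d (fun i => (\dim {: P i} %/ hd P P)%N%:Z).
  by apply: eulerZr => i; rewrite /dv /dim_vector mulrC -PoszM divnK.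
move: E; rewrite Pt; move: (hd P P) (euler _ _) => n z E.
have : `|(n%:Z * z)%R|%N = 1%N by rewrite -E.
by rewrite abszM => /eqP; rewrite muln_eq1 => /andP [/eqP].
Qed.

Lemma neg1_q P : indecomposable P -> theta P = -1 -> euler (dv P) (dv P) = 1.
Proof.
move=> Pi Pt; rewrite -euler_formula (neg1_end Pi Pt).
by have [|-> _] := neg_props ac tf Pi; rewrite ?subr0 // -/(theta P) Pt.
Qed.

(** A nonsplit extension of A by B has the same dimension vector as M and, by [ses_hd_strict], a
    strictly smaller endomorphism algebra. *)
Lemma min_end_ed M A B :
  (forall N, dv N = dv M -> (hd M M <= hd N N)%N) -> rep_iso M (dsum A B) -> ed A B = 0%N.
Proof.
move=> Mm e; apply/ed0P => z; apply: contrapT => zB.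
have ns : ~ split_mono (exti z) by move/(ses_split_mono (ext_ses z))/ext_split.
have := Mm (extrep z); rewrite (iso_dv e) => H.
have {}H : (hd M M <= hd (extrep z) (extrep z))%N.
  apply: H; apply/funext => i; rewrite dv_dsum (ses_dv (ext_ses z)) addrC //.
have := ses_hd_r (ext_ses z) (extrep z); have := ses_hd_strict (ext_ses z) ns.
have := ses_hd_l (ext_ses z) A; move: H.
rewrite (hd_iso_l _ e) (hd_iso_r _ e).
have := hd_dsum_r A A B; have := hd_dsum_r B A B; have := hd_dsum_l (dsum A B) A B.
by lia.
Qed.

(** Take L of this dimension vector with the smallest endomorphism algebra. If L = A + B, there are
    no extensions either way, so q(L) = 1 forces q(A) = 0 or q(B) = 0. That summand is proportional
    to d, the mixed Euler terms have opposite signs and vanish, and L would have defect 0. *)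
Lemma shift_exists P : indecomposable P -> theta P = -1 ->
  exists L, [/\ indecomposable L, theta L = -1 & forall i, dv L i = dv P i + d i].
Proof.
move=> Pi Pt; have [d0 rad psd null _] := tf.
pose x i := (\dim {: P i} + `|d i|)%N.
have xE i : (x i)%:Z = dv P i + d i.
  by rewrite /x PoszD gez0_abs //; apply: ltW.
have [|L [LE Lm]] := @minimize_nat (rep k Q) (fun N => dv N = (fun i => dv P i + d i)) (fun N => hd N N).
  by exists (ssrep k x); rewrite dv_ssrep; apply/funext => i; rewrite xE.
have {}Lm N : dv N = dv L -> (hd L L <= hd N N)%N by move=> E; apply: Lm; rewrite E LE.
have {}LE i : dv L i = dv P i + d i by rewrite LE.
have Lt : theta L = -1.
  by rewrite [LHS](eulerDr d LE) -/(theta P) Pt (tame_dd tf) addr0.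
have Lq : euler (dv L) (dv L) = 1.
  rewrite (eulerDr _ LE) !(eulerDl _ LE) (neg1_q Pi Pt) (tame_dd tf).
  by have := theta_radical tf P; rewrite -/(theta P) /theta => ->; lra.
exists L; split=> //; split.
  by move=> L0; move: Lt; rewrite [LHS](theta_zero d L0).
move=> A B e; apply: contrapT => /not_orP [A0 B0].
have eAB := min_end_ed Lm e.
have eBA : ed B A = 0%N.
  apply: (min_end_ed Lm); apply: rep_iso_trans e _.
  apply/rep_isoP; exists (pairh (sndh A B) (fsth A B)).
  have i' : injective_hom (pairh (sndh A B) (fsth A B)).
    by move=> i [a b] [a' b']; rewrite !pairhE !sndhE !fsthE => -[-> ->].
  by split=> //; apply: inj_tdim_surj => //; rewrite !tdim_dsum addnC.
have q0 A' B' : ~ is_zero A' -> ed A' B' = 0%N -> ed B' A' = 0%N ->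
    euler (dv A') (dv A') = 0 -> theta A' = 0 /\ theta B' = 0.
  move=> /nonzero_dv [j Aj] e1 e2 q; split; first exact: (tame_null tf q).
  have E1 : d j * euler (dv A') (dv B') = dv A' j * theta B'.
    rewrite -(@eulerZl _ (d j) (dv A') (fun i => dv A' i * d j)); last by move=> i; apply: mulrC.
    by apply: eulerZl => i; apply: null.
  have E2 : d j * euler (dv B') (dv A') = - (dv A' j * theta B').
    rewrite -(@eulerZr _ (d j) (dv A') (fun i => dv A' i * d j)); last by move=> i; apply: mulrC.
    rewrite (theta_radical tf) mulrN opprK.
    by apply: eulerZr => i; apply: null.
  move: E1 E2; rewrite -!euler_formula e1 e2 !subr0 => E1 E2.
  have := mulr_ge0 (ltW (d0 j)) (ler0n int (hd A' B')).
  have := mulr_ge0 (ltW (d0 j)) (ler0n int (hd B' A')).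
  rewrite !natz E1 E2 => h1 h2; have /eqP : dv A' j * theta B' = 0 by lra.
  by rewrite mulf_eq0 (negPf Aj) => /eqP.
have LAB i : dv L i = dv A i + dv B i by rewrite (iso_dv e) dv_dsum.
have Lt' : theta L = theta A + theta B by apply: eulerDr.
move: Lq; rewrite (eulerDr _ LAB) !(eulerDl _ LAB).
rewrite -[euler (dv A) (dv B)]euler_formula -[euler (dv B) (dv A)]euler_formula eAB eBA !subr0.
have qA := psd (dv A); have qB := psd (dv B) => Lq.
have [A1|A1] := eqVneq (euler (dv A) (dv A)) 0.
  by have [a b] := q0 A B A0 eAB eBA A1; move: Lt; rewrite Lt' a b.
have [B1|B1] := eqVneq (euler (dv B) (dv B)) 0.
  by have [a b] := q0 B A B0 eBA eAB B1; move: Lt; rewrite Lt' a b.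
by move: qA qB Lq A1 B1; lia.
Qed.
End DefectOne.

(** * Powers of a representation, and matrices without invariant subspaces *)

Section Powers.
Variables (k : finFieldType) (Q : quiver) (s : nat).
Implicit Types M N : rep k Q.

Lemma dim_ffun_ord (V : vectType k) : \dim {: {ffun 'I_s -> V}} = (s * \dim {: V})%N.
Proof. by rewrite !dimvf -[LHS]/(#|'I_s| * dim V)%N card_ord. Qed.

Lemma map_linear (U V : vectType k) (f : 'Hom(U, V)) :
  linear (fun x : {ffun 'I_s -> U} => [ffun j => f (x j)] : {ffun 'I_s -> V}).
Proof. by move=> c x y; apply/ffunP => j; rewrite !ffunE linearP. Qed.

Definition powrep M : rep k Q :=
  @Rep k Q (fun i => {ffun 'I_s -> M i} : vectType k)
    (fun a => linfun (fun x : {ffun 'I_s -> M (src a)} =>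
       [ffun j => rmap M a (x j)] : {ffun 'I_s -> M (tgt a)})).

Definition co M i (x : powrep M i) (j : 'I_s) : M i := (x : {ffun 'I_s -> M i}) j.

Lemma coP M i (x y : powrep M i) : (forall j, co x j = co y j) -> x = y.
Proof. by move=> xy; apply/ffunP. Qed.

Lemma rmap_powE M a x j : co (rmap (powrep M) a x) j = rmap M a (co x j).
Proof. by rewrite (linfunE (@map_linear _ _ _)) /co ffunE. Qed.

Lemma co_linear M i j : linear (fun x : powrep M i => co x j).
Proof. by move=> c x y; rewrite /co !ffunE. Qed.

Lemma dv_pow M i : dv (powrep M) i = s%:Z * dv M i.
Proof. by rewrite /dv /dim_vector dim_ffun_ord PoszM. Qed.

(* The matrix [t] acts on M^s by row vectors: (x t)_l = sum_j t_jl x_j. *)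
Definition lincomb (t : 'M[k]_s) (V : vectType k) (x : {ffun 'I_s -> V}) : {ffun 'I_s -> V} :=
  [ffun l => \sum_j t j l *: x j].
Lemma lincomb_linear t V : linear (@lincomb t V).
Proof.
move=> c x y; apply/ffunP => l; rewrite !ffunE scaler_sumr -big_split /=.
by apply: eq_bigr => j _; rewrite !ffunE scalerDr !scalerA mulrC.
Qed.

Definition powact (t : 'M[k]_s) M : rep_hom (powrep M) (powrep M).
Proof.
refine (@mkhom _ _ (powrep M) (powrep M) (fun i => linfun (@lincomb t (M i))) _) => a x.
rewrite !(linfunE (@lincomb_linear _ _)); apply: coP => l.
rewrite rmap_powE /co !ffunE linear_sum; apply: eq_bigr => j _.
rewrite linearZ /=; congr (_ *: _); exact: rmap_powE.
Defined.
Lemma powactE t M i x : powact t M i x = lincomb t x.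
Proof. by rewrite mkhomE (linfunE (@lincomb_linear _ _)). Qed.
Lemma powact_co t M i x l : co (powact t M i x) l = \sum_j t j l *: co x j.
Proof. by rewrite powactE /co ffunE. Qed.

Definition powh M N (f : rep_hom M N) : rep_hom (powrep M) (powrep N).
Proof.
refine (@mkhom _ _ (powrep M) (powrep N)
  (fun i => linfun (fun x : {ffun 'I_s -> M i} => [ffun j => f i (x j)] : {ffun 'I_s -> N i})) _) => a x.
apply: coP => l; rewrite rmap_powE !(linfunE (@map_linear _ _ _)) /co !ffunE.
by rewrite -hcommE; congr (f _ _); apply: rmap_powE.
Defined.
Lemma powhE M N (f : rep_hom M N) i x l : co (powh f i x) l = f i (co x l).
Proof. by rewrite mkhomE (linfunE (@map_linear _ _ _)) /co ffunE. Qed.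

Definition powp M (j : 'I_s) : rep_hom (powrep M) M.
Proof.
refine (@mkhom _ _ (powrep M) M (fun i => linfun (fun x : powrep M i => co x j)) _) => a x.
by rewrite !(linfunE (@co_linear _ _ _)) rmap_powE.
Defined.
Lemma powpE M j i x : powp M j i x = co x j.
Proof. by rewrite mkhomE (linfunE (@co_linear _ _ _)). Qed.

Definition sumh M N n (f : 'I_n -> rep_hom M N) : rep_hom M N :=
  foldr (@addh _ _ M N) (zeroh M N) [seq f j | j <- enum 'I_n].
Lemma sumhE M N n (f : 'I_n -> rep_hom M N) i x : sumh f i x = \sum_j f j i x.
Proof.
rewrite /sumh -big_enum /=; elim: (enum _) => [|j e IH] /=.
  by rewrite big_nil zerohE.
by rewrite big_cons addhE IH.
Qed.

Definition powev M N (f : 'I_s -> rep_hom M N) : rep_hom (powrep M) N :=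
  sumh (fun j => comph (f j) (powp M j)).
Lemma powevE M N (f : 'I_s -> rep_hom M N) i x : powev f i x = \sum_j f j i (co x j).
Proof. by rewrite sumhE; apply: eq_bigr => j _; rewrite comphE powpE. Qed.

(** For s > 0 this says that k^s is a simple module over k[t], acting on row vectors. *)
Definition simple_mx (t : 'M[k]_s) := forall X : {vspace 'rV[k]_s},
  (forall x, x \in X -> x *m t \in X) -> X = 0%VS \/ X = fullv.

(** Induction on a space U that contains all coordinates of W. A functional on U applied
    coordinatewise has a t-stable image in k^s, of dimension 0 or s, and its kernel has coordinates
    in a smaller space. *)
Lemma simple_dvd t (V : vectType k) (W : {vspace {ffun 'I_s -> V}}) : simple_mx t ->
  (forall x, x \in W -> lincomb t x \in W) -> (s %| \dim W)%N.
Proof.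
move=> ts.
suff H n : forall (U : {vspace V}) (W : {vspace {ffun 'I_s -> V}}), (\dim U <= n)%N ->
    (forall x, x \in W -> forall j, x j \in U) ->
    (forall x, x \in W -> lincomb t x \in W) -> (s %| \dim W)%N.
  by apply: (H (\dim {: V}) fullv) => // x _ j; rewrite memvf.
elim: n => [|n IH] U {}W dU WU Wt.
  move: dU; rewrite leqn0 dimv_eq0 => /eqP U0; suff -> : W = 0%VS by rewrite dimv0 dvdn0.
  apply/eqP; rewrite -subv0; apply/subvP=> x /WU xU; rewrite memv0.
  by apply/eqP/ffunP => j; have := xU j; rewrite U0 memv0 ffunE => /eqP.
have [U0|U0] := eqVneq U 0%VS; first by apply: (IH U W) => //; rewrite U0 dimv0.
have u0 : vpick U \notin 0%VS by rewrite memv0 vpick0.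
have [l [_ lu]] := exists_functional u0.
pose lr (x : {ffun 'I_s -> V}) : 'rV[k]_s := \row_j (l (x j) : k).
have lrl : linear lr.
  by move=> c x y; apply/rowP => j; rewrite !mxE !ffunE linearP.
pose lf := linfun lr; have lfE x : lf x = lr x by rewrite (linfunE lrl).
have lrt x : lr (lincomb t x) = lr x *m t.
  apply/rowP => j; rewrite !mxE ffunE linear_sum; apply: eq_bigr => i _.
  by rewrite linearZ /= !mxE mulrC.
rewrite -(limg_ker_dim lf W); apply: dvdn_add; last first.
  have [|->|->] := ts (lf @: W)%VS; rewrite ?dimv0 ?dvdn0 //.
    move=> _ /memv_imgP [x xW ->]; rewrite lfE -lrt -lfE memv_img //; exact: Wt.
  by rewrite dimvf -[dim _]/(1 * s)%N mul1n.
apply: (IH (U :&: lker l)%VS).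
- have := limg_ker_dim l U.
  have : (0 < \dim (l @: U))%N.
    rewrite lt0n dimv_eq0; apply/eqP => lU.
    have : l (vpick U) \in (l @: U)%VS by rewrite memv_img ?memv_pick.
    by rewrite lU memv0 lu oner_eq0.
  by lia.
- move=> x /memv_capP [xW]; rewrite memv_ker lfE => /eqP x0 j.
  rewrite memv_cap WU // memv_ker; apply/eqP.
  by have := congr1 (fun r : 'rV_s => r 0 j) x0; rewrite !mxE.
move=> x /memv_capP [xW xl]; rewrite memv_cap Wt //= memv_ker lfE lrt.
by move: xl; rewrite memv_ker lfE => /eqP ->; rewrite mul0mx.
Qed.

Lemma simple_unit t : simple_mx t -> t = 0 \/ t \in unitmx.
Proof.
move=> ts; pose f (x : 'rV[k]_s) := x *m t.
have fl : linear f by move=> c x y; rewrite /f mulmxDl -scalemxAl.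
have [||E] := ts (lker (linfun f)).
- move=> x; rewrite !memv_ker !(linfunE fl) /f => /eqP ->.
  by rewrite mul0mx.
- move=> K0; right; rewrite -row_free_unit -kermx_eq0.
  apply/eqP/row_matrixP => i; rewrite row0.
  have : row i (kermx t) \in lker (linfun f).
    by rewrite memv_ker (linfunE fl) /f; apply/eqP/sub_kermxP/row_sub.
  by rewrite K0 memv0 => /eqP.
left; apply/row_matrixP => i; rewrite row0 rowE.
have : delta_mx 0 i \in lker (linfun f) by rewrite E memvf.
by rewrite memv_ker (linfunE fl) => /eqP.
Qed.
End Powers.

(** * The matrix pencil of two maps *)

Section Pencil.
Variables (k : finFieldType) (Q : quiver) (d : vertex Q -> int).
Hypothesis ac : acyclic Q.
Hypothesis tf : tame_form d.
Implicit Types M N X Y A B C E K S P L : rep k Q.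
Notation theta := (@theta k Q d).
Notation reg := (@reg k Q d).
Notation stab := (@stab k Q d).
Notation neg := (@neg k Q d).

(** The family embeds Y in a power of M. The image of the first map is a subobject of M, and the
    remaining maps embed its kernel in a smaller power. *)
Lemma neg_family M n : neg M -> forall Y (g : 'I_n -> rep_hom Y M),
  (forall v y, (forall j, g j v y = 0) -> y = 0) -> ~ is_zero Y -> theta Y < 0.
Proof.
move=> Mn; elim: n => [|n IH] Y g gi Y0.
  by case: Y0 => v y; apply: gi => -[].
have [I [K [p [j [i [ip ji gE]]]]]] := im_exists (g ord0).
have Kn : ~ is_zero K -> theta K < 0.
  apply: (IH K (fun l => comph (g (lift ord0 l)) i)) => v y gy.
  apply: (inj_eq0 (ses_inj ip (i := v))); apply: gi => l.
  case: (unliftP ord0 l) => [l'|] ->; first by rewrite -comphE gy.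
  by rewrite gE comphE (ses_comp ip) linear0.
have In := Mn _ _ ji; have E : theta Y = theta K + theta I := theta_ses d ip.
rewrite E; have [K0|/Kn K1] := pselect (is_zero K); have [I0|/In I1] := pselect (is_zero I).
- case: Y0; apply/is_zeroP; rewrite (ses_tdim ip).
  by move/is_zeroP: K0 => ->; move/is_zeroP: I0 => ->.
- have -> : theta K = 0 by apply: theta_zero.
  by rewrite add0r; apply: I1.
- have -> : theta I = 0 by apply: theta_zero.
  by rewrite addr0.
- exact: ltr_wnDl (ltW K1) I1.
Qed.

Variables (s : nat) (t : 'M[k]_s).
Hypotheses (s0 : (0 < s)%N) (ts : simple_mx t).
Notation pow := (@powrep k Q s).

Lemma neg_pow M : neg M -> neg (pow M).
Proof.
move=> Mn Y f fi; apply: (neg_family Mn (g := fun j => comph (powp M j) f)) => v y fy.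
by apply: (inj_eq0 (fi v)); apply: coP => j; rewrite -powpE -comphE fy /co ffunE.
Qed.

Lemma theta_pow M : theta (pow M) = s%:Z * theta M.
Proof. by apply: eulerZr => i; apply: dv_pow. Qed.

(** All dimensions of a t-stable subobject are divisible by s, hence so is its defect. *)
Lemma stable_theta M Y (y : rep_hom Y (pow M)) : injective_hom y ->
  (forall v x, powact t M v (y v x) \in limg (y v)) -> theta Y < 0 -> theta Y <= - s%:Z.
Proof.
move=> yi yt; have dvd v : (s %| \dim {: Y v})%N.
  rewrite -(inj_img_dim v yi); apply: (simple_dvd ts) => _ /memv_imgP [x _ ->].
  by rewrite -powactE yt.
have -> : theta Y = s%:Z * euler d (fun i => (\dim {: Y i} %/ s)%N%:Z).
  by apply: eulerZr => i; rewrite /dv /dim_vector mulrC -PoszM divnK.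
move: (euler _ _) => z; rewrite pmulr_rlt0 ?ltz_nat // => z0.
by rewrite -[- _]mulrN1; apply: ler_wpM2l => //; lia.
Qed.

Variables (P L E : rep k Q).
Hypotheses (Pi : indecomposable P) (Pt : theta P = -1).
Hypotheses (Li : indecomposable L) (Lt : theta L = -1).
Hypothesis LP : forall i, dv L i = dv P i + d i.
Hypothesis Es : stab E.
Variables (al be : rep_hom P L).
Hypotheses (al0 : al <> zeroh P L) (ind : forall c, be <> scaleh c al).

Let Pn : neg P. Proof. by apply: neg_indec => //; rewrite Pt. Qed.
Let Ln : neg L. Proof. by apply: neg_indec => //; rewrite Lt. Qed.

(* al t - be on P^s *)
Definition pencil : rep_hom (pow P) (pow L) :=
  addh (comph (powh s al) (powact t P)) (scaleh (-1) (powh s be)).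

Lemma coB M v (x y : pow M v) l : co (x - y) l = co x l - co y l.
Proof. by rewrite /co !ffunE. Qed.

Lemma pencilE v x l : co (pencil v x) l = \sum_j t j l *: al v (co x j) - be v (co x l).
Proof.
rewrite addhE scalehE scaleN1r coB powhE comphE powhE powact_co linear_sum.
by congr (_ - _); apply: eq_bigr => j _; rewrite linearZ.
Qed.

Lemma pencil_act : comph (powact t L) pencil = comph pencil (powact t P).
Proof.
apply: hom_ext => v x; apply: coP => l; rewrite !comphE powact_co pencilE.
under eq_bigr do rewrite pencilE scalerBr scaler_sumr.
rewrite sumrB powact_co (linear_sum (be v)) /=; congr (_ - _).
  apply: eq_bigr => j _; rewrite powact_co (linear_sum (al v)) scaler_sumr.
  by apply: eq_bigr => i _; congr (_ *: _); rewrite linearZ.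
by apply: eq_bigr => j _; rewrite linearZ.
Qed.

Definition unitvec M v (j : 'I_s) (x : M v) : pow M v :=
  [ffun l => if l == j then x else 0] : {ffun 'I_s -> M v}.
Lemma co_unitvec M v j (x : M v) l : co (unitvec j x) l = if l == j then x else 0.
Proof. by rewrite /co ffunE. Qed.
Lemma sum_unitvec M v j (x : M v) (V : vectType k) (F : 'I_s -> 'Hom(M v, V)) :
  \sum_l F l (co (unitvec j x) l) = F j x.
Proof.
rewrite (bigD1 j) //= co_unitvec eqxx big1 ?addr0 // => l /negPf lj.
by rewrite co_unitvec lj linear0.
Qed.

Lemma pencil_neq0 : pencil <> zeroh _ _.
Proof.
(* On the j-th copy of P the j-th component of the pencil is t_jj al - be. *)
move=> p0; pose j : 'I_s := Ordinal s0; apply: (ind (c := t j j)).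
apply: hom_ext => v x; rewrite scalehE.
have := congr1 (fun h : rep_hom (pow P) (pow L) => co (h v (unitvec j x)) j) p0.
rewrite pencilE co_unitvec eqxx zerohE {2}/co ffunE.
have := sum_unitvec j x (fun l => t l j *: al v); under eq_bigr do rewrite scale_lfunE.
by rewrite scale_lfunE => -> /eqP; rewrite subr_eq0 eq_sym => /eqP.
Qed.

(** Kernel and image are t-stable. If both were nonzero, each would have defect at most -s, while
    the defects add up to -s. *)
Lemma pencil_inj : injective_hom pencil.
Proof.
have [I [K [p [j [i [ip ji pE]]]]]] := im_exists pencil.
have [K0|K0] := pselect (is_zero K).
  rewrite pE; apply: inj_comp ji; apply: surj_tdim_inj; first exact: ses_surj ip.
  by rewrite (ses_tdim ip); move/is_zeroP: K0 => ->.
exfalso; have I0 : ~ is_zero I.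
  move=> I0; apply: pencil_neq0; apply: hom_eq0 => v x.
  by rewrite pE comphE (I0 v (p v x)) linear0.
have Kt : theta K <= - s%:Z.
  apply: (stable_theta (ses_inj ip)); last exact: (neg_pow Pn) (ses_inj ip) K0.
  move=> v x; have [_ _ ->] := ip; rewrite memv_ker.
  apply/eqP/(inj_eq0 (ji v)); rewrite -(comphE j p) -pE -(comphE pencil) -pencil_act comphE.
  by rewrite pE comphE (ses_comp ip) !linear0.
have It : theta I <= - s%:Z.
  apply: (stable_theta ji); last exact: (neg_pow Ln) ji I0.
  move=> v y; have [x <-] := ses_lift ip y.
  rewrite -(comphE j p) -pE -(comphE (powact t L)) pencil_act comphE pE comphE.
  by rewrite memv_img ?memvf.
have Et : theta (pow P) = theta K + theta I := theta_ses d ip.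
by move: Kt It Et s0; rewrite theta_pow Pt; lia.
Qed.

Section Candidates.
(** Subobjects of L^s containing the image of the pencil, that is, preimages of the subobjects of
    its cokernel. *)
Definition cand Y (y : rep_hom Y (pow L)) :=
  injective_hom y /\ forall v x, pencil v x \in limg (y v).

Lemma cand_neg Y (y : rep_hom Y (pow L)) : cand y -> theta Y < 0.
Proof.
move=> [yi yp]; apply: (neg_pow Ln yi) => Y0; apply: pencil_neq0; apply: hom_eq0 => v x.
by have /memv_imgP [w _ ->] := yp v x; rewrite (Y0 v w) linear0.
Qed.

(* The candidate of largest defect and then of largest dimension is unique,
   hence stable under the action of [t]; as [t] is simple, its dimensions are
   then multiples of [s]. *)
Lemma cand_theta Y (y : rep_hom Y (pow L)) : cand y -> theta Y <= - s%:Z.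
Proof.
move=> cy.
have [|[Y1 y1] /= [c1 m1]] := @minimize_nat {Y : rep k Q & rep_hom Y (pow L)}
  (fun z => cand (tagged z)) (fun z => `|theta (tag z)|%N).
  by exists (existT (fun Y => rep_hom Y (pow L)) Y y).
have tmax Z (z : rep_hom Z (pow L)) : cand z -> theta Z <= theta Y1.
  move=> cz; have /= := m1 (existT (fun Y => rep_hom Y (pow L)) Z z) cz.
  by have := cand_neg cz; have := cand_neg c1; lia.
have [||[Y2 y2] /= [[c2 t2] m2]] := @maximize_nat {Y : rep k Q & rep_hom Y (pow L)}
  (fun z => cand (tagged z) /\ theta (tag z) = theta Y1) (fun z => tdim (tag z)) (tdim (pow L)).
- by exists (existT (fun Y => rep_hom Y (pow L)) Y1 y1).
- by move=> [Z z] /= [[zi _] _]; apply: inj_tdim zi.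
apply: le_trans (tmax _ _ cy) _; rewrite -t2; have [y2i y2p] := c2.
apply: (stable_theta y2i); last exact: cand_neg c2.
(* The zero matrix preserves every subobject; otherwise t is invertible and moves a candidate to a
   candidate. *)
have [t0|tu] := simple_unit ts.
  move=> v x; suff -> : powact t L v (y2 v x) = 0 by rewrite mem0v.
  apply: coP => l; rewrite powact_co /co ffunE big1 // => j _.
  by rewrite t0 mxE scale0r.
have actK M v x : powact t M v (powact (invmx t) M v x) = x.
  apply: coP => l; rewrite powact_co; under eq_bigr do rewrite powact_co scaler_sumr.
  rewrite exchange_big /=; under eq_bigr do under eq_bigr do rewrite scalerA mulrC.
  under eq_bigr do rewrite -scaler_suml.
  have mE j : \sum_i invmx t j i * t i l = (j == l)%:R.
    by have := congr1 (fun m : 'M_s => m j l) (mulVmx tu); rewrite !mxE.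
  under eq_bigr do rewrite mE.
  rewrite (bigD1 l) //= eqxx scale1r big1 ?addr0 // => j /negPf ->.
  by rewrite scale0r.
have acti M : injective_hom (powact t M).
  apply: surj_tdim_inj => // v; apply/limg_surj => x.
  by exists (powact (invmx t) M v x); apply: actK.
pose y3 := comph (powact t L) y2.
have c3 : cand y3.
  split; first exact: inj_comp y2i (acti L).
  move=> v x; rewrite -[x]actK -(comphE pencil) -pencil_act comphE.
  have /memv_imgP [w _ ->] := y2p v (powact (invmx t) P v x).
  by apply/memv_imgP; exists w; rewrite ?memvf // comphE.
have [I [K [p [j [i [ip ji pE]]]]]] := im_exists (copairh y2 y3).
have y2I v x : y2 v x \in limg (j v).
  have -> : y2 v x = copairh y2 y3 v (x, 0) by rewrite copair2E linear0 addr0.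
  by rewrite pE comphE memv_img ?memvf.
have y3I v x : y3 v x \in limg (j v).
  have -> : y3 v x = copairh y2 y3 v (0, x) by rewrite copair2E linear0 add0r.
  by rewrite pE comphE memv_img ?memvf.
have cI : cand j.
  by split=> // v x; have /memv_imgP [w _ ->] := y2p v x.
(* I is the sum of Y2 and its translate by t, and K is their intersection, embedded through the
   first component. *)
have cK : cand (comph y2 (comph (fsth Y2 Y2) i)).
  split.
    move=> v; apply: lker_inj => x; rewrite !comphE fsthE => /(inj_eq0 (y2i v)) x1.
    have : copairh y2 y3 v (i v x) = 0 by rewrite pE comphE (ses_comp ip) linear0.
    rewrite copairhE x1 linear0 add0r => /(inj_eq0 (c3.1 v)) x2.
    apply: (inj_eq0 (ses_inj ip (i := v))); move: x1 x2; case: (i v x) => a b /= -> ->.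
    by [].
  move=> v x; have /memv_imgP [a _ aE] := c2.2 v x.
  have /memv_imgP [b _ bE] := c3.2 v x.
  have [|w wE] := ses_ker ip (x := (a, - b) : dsum Y2 Y2 v) (i := v).
    by apply: (inj_eq0 (ji v)); rewrite -(comphE j p) -pE copair2E linearN /= -aE -bE subrr.
  by apply/memv_imgP; exists w; rewrite ?memvf // !comphE fsthE -wE.
have Et : theta (dsum Y2 Y2) = theta K + theta I := theta_ses d ip.
(* The defects of sum and intersection add up to twice the maximum, so both are maximal; by maximal
   dimension the sum is Y2. *)
have It : theta I = theta Y1.
  have := tmax _ _ cI; have := tmax _ _ cK; move: Et.
  by rewrite theta_dsum -/(theta Y2) t2; lia.
have /= := m2 (existT (fun Y => rep_hom Y (pow L)) I j) (conj cI It) => le.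
have [u uE] := factor_mono ji y2I.
have us : surjective_hom u.
  by apply: inj_tdim_surj le; apply: (inj_factor_inj (h := j)); rewrite uE.
move=> v x; have := y3I v x; rewrite comphE => /memv_imgP [w _ ->].
have [w' <-] := (limg_surj _).1 (us v) w.
by rewrite -(comphE j u) uE memv_img ?memvf.
Qed.
End Candidates.

Lemma hd_neg_reg X M : indecomposable X -> theta X = -1 -> reg M ->
  (hd X M)%:Z = euler (dv X) (dv M).
Proof.
move=> Xi Xt Mr; rewrite -euler_formula (ed_neg_reg ac tf Xi _ Mr) ?subr0 //.
by rewrite -/(theta X) Xt.
Qed.

(** The relation says that the combined map L^s -> E kills the pencil, so it factors through the
    cokernel C. C is regular of dimension vector s d, whence dim Hom(P, C) = s, and the surjection C
    -> E with kernel G leaves nothing for Hom(P, G). The t-twisted map also kills G, and the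
    endomorphism it induces on E is phi. *)
Lemma pencil_core (f : 'I_s -> rep_hom L E) :
  (forall j v x, f j v (be v x) = \sum_l t j l *: f l v (al v x)) ->
  (exists j, f j <> zeroh L E) -> (s <= hd P E)%N ->
  hd P E = s /\ exists phi : rep_hom E E, forall j v x,
     phi v (f j v x) = \sum_l t j l *: f l v x.
Proof.
move=> rel [j0 fj0] sle; have [Er E0 _] := Es.
have [C [c pc]] := mono_ses pencil_inj.
have Ct : theta C = 0.
  have : theta (pow L) = theta (pow P) + theta C := theta_ses d pc.
  by rewrite !theta_pow Pt Lt; lia.
have Cr : reg C.
  (* A subobject of C pulls back to a candidate, whose defect is at most -s, the defect of P^s. *)
  split=> // X x xi; have [Y [y [p' [q' [ey yi yp yq]]]]] := preimage pc xi.
  have Yt : theta Y = theta (pow P) + theta X := theta_ses d ey.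
  have : theta Y <= - s%:Z.
    apply: (cand_theta (y := y)); split=> // v w.
    by rewrite -yp comphE memv_img ?memvf.
  by rewrite Yt theta_pow Pt; lia.
have hC : hd P C = s.
  have dC i : dv C i = s%:Z * d i.
    by have := ses_dv pc i; rewrite !dv_pow LP mulrDr => /addrI ->.
  have := hd_neg_reg Pi Pt Cr; rewrite (eulerZr _ dC).
  have -> : euler (dv P) d = 1.
    by have : theta P = - euler (dv P) d := theta_radical tf P; rewrite Pt => /oppr_inj.
  by rewrite mulr1 => -[].
pose evE := powevE f.
have evp : comph (powev f) pencil = zeroh _ _.
  apply: hom_ext => v x; rewrite comphE zerohE evE.
  rewrite (eq_bigr (fun l => \sum_j t j l *: f l v (al v (co x j)) -
      \sum_i t l i *: f i v (al v (co x l)))); last first.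
    move=> l _; rewrite pencilE linearB /= (linear_sum (f l v)) rel; congr (_ - _).
    by apply: eq_bigr => j _; rewrite linearZ.
  by rewrite sumrB exchange_big subrr.
have [e evc] := ses_factor_r pc evp.
have e0 : e <> zeroh C E.
  move=> e0; apply: fj0; apply: hom_eq0 => v x.
  have := sum_unitvec j0 x (fun l => f l v); rewrite -evE evc comphE e0 zerohE => <- //.
have es := stab_surj Cr Es e0; have [G [g ge]] := epi_ses es.
have Gr : reg G := reg_sub Cr (ses_inj ge) (ses_theta0 ge Ct (proj1 Er)).
have edG M : reg M -> ed P M = 0%N.
  by move=> Mr; apply: (ed_neg_reg ac tf Pi) Mr; rewrite -/(theta P) Pt.
have := ses_hd_le_r ge P; rewrite hC (edG G Gr) addn0 => leG.
have hE : hd P E = s by lia.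
have hG : hd P G = 0%N by lia.
split=> //.
have evp' : comph (comph (powev f) (powact t L)) pencil = zeroh _ _.
  rewrite -comphA pencil_act comphA evp.
  by apply: hom_ext => v x; rewrite comphE !zerohE.
have [e' ev'] := ses_factor_r pc evp'.
have e'g : comph e' g = zeroh G E.
  (* A nonzero map G -> E would be onto and would give Hom(P, G) dimension at least s. *)
  apply: contrapT => n0; have us := stab_surj Gr Es n0; have [H [h hg]] := epi_ses us.
  have Hr : reg H := reg_sub Gr (ses_inj hg) (ses_theta0 hg (proj1 Gr) (proj1 Er)).
  by have := ses_hd_le_r hg P; rewrite hG (edG H Hr) hE; lia.
have [phi phiE] := ses_factor_r ge e'g.
exists phi => j v x.
have fE : f j v x = powev f v (unitvec j x).
  by rewrite evE (sum_unitvec j x (fun l => f l v)).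
rewrite fE evc comphE -(comphE phi e) -phiE -(comphE e' c) -ev' comphE evE.
apply: eq_bigr => l _; rewrite powact_co linear_sum /=.
have := sum_unitvec j x (fun i => t i l *: f l v).
by rewrite scale_lfunE => <-; apply: eq_bigr => i _; rewrite scale_lfunE linearZ.
Qed.
End Pencil.

(** * Maps from a preprojective of defect -1 to a quasi-simple *)

Section OneDimensional.
Variables (k : finFieldType) (Q : quiver) (d : vertex Q -> int).
Hypothesis ac : acyclic Q.
Hypothesis tf : tame_form d.
Implicit Types M N X Y A B C E K S P L : rep k Q.
Notation theta := (@theta k Q d).
Notation reg := (@reg k Q d).
Notation stab := (@stab k Q d).
Notation neg := (@neg k Q d).

Lemma independent_homs P L : (2 <= hd P L)%N -> exists al be : rep_hom P L,
  [/\ al <> zeroh P L, be <> zeroh P L, (forall c, be <> scaleh c al) &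
      (forall c, al <> scaleh c be)].
Proof.
move=> h2; have [al al0] : exists al : rep_hom P L, al <> zeroh P L.
  by apply: hd_nonzero; apply: leq_trans h2.
have [be beP] : exists be : rep_hom P L, forall c, be <> scaleh c al.
  apply: contrapT => /forallNP n.
  have : (Z0 P L <= <[(hfun al : C0 P L)]>)%VS.
    apply/subvP => _ /Z0_hom [b ->]; apply/vlineP.
    have /existsNP [c /contrapT ->] := n b; exists c; apply: C0P => i x.
    by rewrite [RHS]CE scalehE.
  by move/dimvS; rewrite dim_vline; case: (_ != _) => /=; move: h2; rewrite /hd; lia.
exists al, be; split=> //.
  by move=> b0; apply: (beP 0); apply: hom_ext => i x; rewrite b0 zerohE scalehE scale0r.
move=> c cE; have [c0|c0] := eqVneq c 0.
  by apply: al0; apply: hom_ext => i x; rewrite cE scalehE c0 scale0r zerohE.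
apply: (beP c^-1); apply: hom_ext => i x; rewrite cE !scalehE scalerA mulVf //.
by rewrite scale1r.
Qed.

Lemma simple_mx0 : simple_mx (0 : 'M[k]_1).
Proof.
move=> X _; have := dimvS (subvf X); rewrite dimvf -[dim _]/(1 * 1)%N.
case: (posnP (\dim X)) => [/eqP|X0 le]; first by rewrite dimv_eq0 => /eqP; left.
by right; apply/eqP; rewrite eqEdim subvf dimvf -[dim _]/(1 * 1)%N.
Qed.

Lemma hd1_proportional M N (f1 f2 : rep_hom M N) : hd M N = 1%N ->
  f1 <> zeroh M N -> f2 <> zeroh M N -> forall v, lker (f1 v) = lker (f2 v).
Proof.
move=> h1 f10 f20.
have f1v : (hfun f1 : C0 M N) != 0.
  apply/eqP => E; apply: f10; apply: hom_eq0 => v x.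
  by rewrite -[LHS]/((hfun f1 : C0 M N) v x) E CE.
have ZE : (<[(hfun f1 : C0 M N)]> = Z0 M N)%VS.
  apply/eqP; rewrite eqEdim -memvE hom_Z0 /= dim_vline f1v.
  by rewrite -/(hd M N) h1.
have := hom_Z0 f2; rewrite -ZE => /vlineP [c cE].
have f2E v x : f2 v x = c *: f1 v x.
  by rewrite -[LHS]/((hfun f2 : C0 M N) v x) cE CE.
have c0 : c != 0.
  by apply/eqP => c0; apply: f20; apply: hom_eq0 => v x; rewrite f2E c0 scale0r.
by move=> v; apply/vspaceP=> x; rewrite !memv_ker f2E scaler_eq0 (negPf c0).
Qed.

(* Hom(P, E) is at most one-dimensional over the field End(E). *)
Lemma hom_ker_unique P E (f1 f2 : rep_hom P E) :
  indecomposable P -> theta P = -1 -> stab E ->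
  f1 <> zeroh P E -> f2 <> zeroh P E -> forall v, lker (f1 v) = lker (f2 v).
Proof.
move=> Pi Pt Es f10 f20; have [Er E0 _] := Es.
have [L [Li Lt LP]] := shift_exists ac tf Pi Pt.
have Pd : euler (dv P) d = 1.
  by have : theta P = - euler (dv P) d := theta_radical tf P; rewrite Pt => /oppr_inj.
(* The pairing of dim P with dim L is q(P) + 1 = 2. *)
have hPL : (2 <= hd P L)%N.
  have := euler_formula P L; rewrite (eulerDr _ LP) (neg1_q ac tf Pi Pt) Pd; lia.
have [al [be [al0 be0 ind ind']]] := independent_homs hPL.
have hLE : hd L E = hd P E.
  apply/eqP; rewrite -eqz_nat (hd_neg_reg ac tf Li Lt Er) (hd_neg_reg ac tf Pi Pt Er).
  have -> : euler (dv L) (dv E) = euler (dv P) (dv E) + theta E by apply: eulerDl.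
  by have [-> _] := Er; rewrite addr0.
have hP0 : (0 < hd P E)%N by apply: hd_gt0 f10.
pose A := linfun (@pre0 _ _ E P L al).
have AE u : A u = pre0 al u by rewrite (linfunE (@pre0_linear _ _ _ _ _ _)).
(* If some nonzero f kills al, the core lemma applies with al and be exchanged, s = 1 and t = 0, and
   Hom(P, E) is a line. Otherwise composition with al identifies Hom(L, E) with Hom(P, E). *)
have [[f [fn fa]]|inj] := pselect (exists f : rep_hom L E, f <> zeroh L E /\ comph f al = zeroh P E).
  have := @pencil_core _ _ _ ac tf 1 0 isT simple_mx0 P L E Pi Pt Li Lt LP Es be al ind'
    (fun=> f).
  case=> [j v x||//|h1 _]; last exact: hd1_proportional.
    rewrite big_ord1 mxE scale0r -comphE fa zerohE //.
  by exists ord0.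
have Ainj u : u \in Z0 L E -> A u = 0 -> u = 0.
  case/Z0_hom=> f -> Af; apply: contrapT => f0; apply: inj; exists f; split.
    by move=> fz; apply: f0; rewrite fz; apply: C0P => i x; rewrite [RHS]CE zerohE.
  apply: hom_eq0 => v x; rewrite -[LHS]/((hfun (comph f al) : C0 P E) v x) -pre0_hom -AE Af.
  by rewrite CE.
have AZ : (A @: Z0 L E = Z0 P E)%VS.
  apply/eqP; rewrite eqEdim limg_dim_eq.
    rewrite -!/(hd _ _) hLE leqnn andbT; apply/subvP=> _ /memv_imgP [_ /Z0_hom [f ->] ->].
    by rewrite AE pre0_hom hom_Z0.
  apply/eqP; rewrite -subv0; apply/subvP=> u /memv_capP [uZ]; rewrite memv_ker memv0.
  by move/eqP/(Ainj _ uZ) => ->.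
have Asurj (f : rep_hom P E) : exists g : rep_hom L E, f = comph g al.
  have := hom_Z0 f; rewrite -AZ => /memv_imgP [_ /Z0_hom [g ->] fE]; exists g.
  apply: hom_ext => v x; rewrite -[LHS]/((hfun f : C0 P E) v x) fE AE pre0_hom //.
pose B := linfun (@pre0 _ _ E P L be).
have BE u : B u = pre0 be u by rewrite (linfunE (@pre0_linear _ _ _ _ _ _)).
(* The nonzero subspaces stable under the inverse of A followed after B; on a smallest one this
   operator acts irreducibly, and its matrix is t. *)
pose inv (U : {vspace C0 L E}) :=
  [/\ (U <= Z0 L E)%VS, U != 0%VS & forall u, u \in U -> exists2 u', u' \in U & A u' = B u].
have [|U [[UZ U0 Ut] Um]] := @minimize_nat {vspace C0 L E} inv (fun U => \dim U).
  exists (Z0 L E); split=> //; first by rewrite -dimv_eq0 -lt0n -/(hd L E) hLE.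
  move=> _ /Z0_hom [g ->]; have [g' gE] := Asurj (comph g be).
  by exists (hfun g'); rewrite ?hom_Z0 // AE BE !pre0_hom gE.
pose s := \dim U; have s0 : (0 < s)%N by rewrite lt0n dimv_eq0.
have bZ j : (vbasis U)`_j \in Z0 L E.
  have [lt|ge] := ltnP j s; first by apply/(subvP UZ)/vbasis_mem/mem_nth; rewrite size_tuple.
  by rewrite nth_default ?mem0v // size_tuple.
have [f fE] := @boolp.choice 'I_s (rep_hom L E)
  (fun (j : 'I_s) g => (vbasis U)`_j = (hfun g : C0 L E)) (fun j => Z0_hom (bZ j)).
have fU j : (hfun (f j) : C0 L E) \in U.
  by rewrite -fE; apply/vbasis_mem/mem_nth; rewrite size_tuple.
have Tex j : exists x : 'rV[k]_s, forall v y,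
    f j v (be v y) = \sum_l x 0 l *: f l v (al v y).
  have [u uU uE] := Ut _ (fU j).
  exists (\row_l coord (vbasis U) l u) => v y.
  have := congr1 (fun w : C0 P E => w v y) uE; rewrite AE BE !pre0E => <-.
  rewrite {1}(coord_vbasis uU).
  have -> : \sum_i coord (vbasis U) i u *: (vbasis U)`_i =
      hfun (sumh (fun i => scaleh (coord (vbasis U) i u) (f i))) :> C0 L E.
    apply: C0P => w z; rewrite [RHS]sumhE.
    elim/big_rec2: _ => [|i p q _ IH]; first by rewrite CE.
    by rewrite 2!CE IH scalehE fE.
  by rewrite sumhE; apply: eq_bigr => l _; rewrite scalehE mxE.
have [x xE] := boolp.choice Tex.
pose t : 'M[k]_s := \matrix_(j, l) x j 0 l.
have rel j v y : f j v (be v y) = \sum_l t j l *: f l v (al v y).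
  by rewrite xE; apply: eq_bigr => l _; rewrite mxE.
pose cmb (r : 'rV[k]_s) : C0 L E := \sum_j r 0 j *: (hfun (f j) : C0 L E).
have cmbl : linear cmb.
  move=> c r1 r2; rewrite /cmb scaler_sumr -big_split; apply: eq_bigr => j _.
  by rewrite !mxE scalerDl scalerA.
have cmbE r v y : cmb r v y = \sum_j r 0 j *: f j v y.
  rewrite /cmb; elim/big_rec2: _ => [|i p q _ IH]; first by rewrite CE.
  by rewrite 2!CE IH.
have cmb0 r : cmb r = 0 -> r = 0.
  move=> c0; apply/rowP => j; rewrite mxE.
  have /freeP := basis_free (vbasisP U) => /(_ (fun j => r 0 j)) H.
  by apply: H; rewrite -[RHS]c0; apply: eq_bigr => i _; rewrite fE.
have ts : simple_mx t.
  move=> X Xt; have [->|X0] := eqVneq X 0%VS; [by left|right].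
  pose U' := (linfun cmb @: X)%VS.
  have dimU' : \dim U' = \dim X.
    apply: limg_dim_eq; apply/eqP; rewrite -subv0; apply/subvP => r /memv_capP [_].
    by rewrite memv_ker (linfunE cmbl) memv0 => /eqP/cmb0 ->.
  apply/eqP; rewrite eqEdim subvf dimvf -[dim _]/(1 * s)%N mul1n -dimU' /=.
  apply: Um; split.
  - apply: subv_trans UZ; apply/subvP=> _ /memv_imgP [r _ ->]; rewrite (linfunE cmbl).
    by apply: memv_suml => j _; apply: memvZ.
  - by rewrite -dimv_eq0 dimU' dimv_eq0.
  move=> _ /memv_imgP [r rX ->]; rewrite (linfunE cmbl); exists (cmb (r *m t)).
    by rewrite -(linfunE cmbl) memv_img ?Xt.
  rewrite AE BE; apply: C0P => v y; rewrite !pre0E !cmbE.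
  under [RHS]eq_bigr do rewrite rel scaler_sumr.
  rewrite exchange_big /=; apply: eq_bigr => l _; rewrite mxE scaler_suml.
  by apply: eq_bigr => j _; rewrite scalerA.
have [||hPs [phi phiE]] := pencil_core ac tf s0 ts Pi Pt Li Lt LP Es ind rel.
- exists (Ordinal s0) => fz.
  have : (vbasis U)`_(Ordinal s0) != 0.
    by apply: (free_not0 (basis_free (vbasisP U))); rewrite mem_nth ?size_tuple.
  by rewrite fE fz => /eqP; apply; apply: C0P => v y; rewrite [RHS]CE zerohE.
- by rewrite -hLE; apply: dimvS.
(* The core lemma gives dim Hom(P, E) = s = dim U, so U is all of Hom(L, E), and the operator is
   composition with phi. *)
have UE : U = Z0 L E by apply/eqP; rewrite eqEdim UZ -/(hd L E) hLE hPs /=.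
have phiT (g : rep_hom L E) : comph g be = comph (comph phi g) al.
  have := hom_Z0 g; rewrite -UE => gU; have gE := coord_vbasis gU.
  have gE' v y : g v y = \sum_j coord (vbasis U) j (hfun g : C0 L E) *: f j v y.
    rewrite -[LHS]/((hfun g : C0 L E) v y) {1}gE.
    elim/big_rec2: _ => [|i p q _ IH]; first by rewrite CE.
    by rewrite 2!CE IH fE.
  apply: hom_ext => v y; rewrite !comphE !gE' linear_sum; apply: eq_bigr => j _.
  by rewrite linearZ /= phiE rel.
have [g1 g1E] := Asurj f1; have [g2 g2E] := Asurj f2.
(* The multiples of g1 by End(E) form a stable subspace, so by minimality they contain g2. *)
pose U1 := (linfun (@pre0 _ _ E L E g1) @: Z0 E E)%VS.
have preE u : linfun (@pre0 _ _ E L E g1) u = pre0 g1 u.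
  by rewrite (linfunE (@pre0_linear _ _ _ _ _ _)).
have U1E : U1 = Z0 L E.
  have U1Z : (U1 <= Z0 L E)%VS.
    by apply/subvP=> _ /memv_imgP [_ /Z0_hom [h ->] ->]; rewrite preE pre0_hom hom_Z0.
  apply/eqP; rewrite eqEdim U1Z -UE /=; apply: Um; split=> //.
    apply/eqP => U10; have : (hfun g1 : C0 L E) \in U1.
      apply/memv_imgP; exists (hfun (idh E)); rewrite ?hom_Z0 // preE pre0_hom.
      by rewrite comp1h.
    rewrite U10 memv0 => /eqP gz; apply: f10; apply: hom_eq0 => v y.
    by rewrite g1E comphE -[LHS]/((hfun g1 : C0 L E) v (al v y)) gz CE.
  move=> _ /memv_imgP [_ /Z0_hom [h ->] ->]; rewrite preE pre0_hom.
  exists (hfun (comph phi (comph h g1))).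
    apply/memv_imgP; exists (hfun (comph phi h)); rewrite ?hom_Z0 // preE pre0_hom.
    by rewrite comphA.
  by rewrite AE BE !pre0_hom phiT.
have := hom_Z0 g2; rewrite -U1E => /memv_imgP [_ /Z0_hom [h ->]]; rewrite preE pre0_hom => g2h.
have f2E : f2 = comph h f1.
  apply: hom_ext => v y; rewrite g2E g1E !comphE -[LHS]/((hfun g2 : C0 L E) v (al v y)) g2h.
  by rewrite [LHS]comphE.
have h0 : h <> zeroh E E.
  by move=> hz; apply: f20; apply: hom_eq0 => v y; rewrite f2E hz comphE zerohE.
have [hi _] := stab_bij Es Es h0.
by move=> v; rewrite f2E ker_comp_inj.
Qed.
End OneDimensional.

(** * Extended Dynkin diagrams *)

Section SumOfSquares.
Variables (Q : quiver) (w : vertex Q -> int).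
Hypothesis w0 : forall i, 0 < w i.
Hypothesis harm : forall i, \sum_(a : arrow Q | src a == i) w (tgt a) +
   \sum_(a : arrow Q | tgt a == i) w (src a) = 2 * w i.
Hypothesis conn : forall (T : Type) (f : vertex Q -> T),
  (forall a : arrow Q, f (src a) = f (tgt a)) -> forall i j, f i = f j.
Implicit Types x y : vertex Q -> int.

Let r (z : int) : rat := z%:~R.
Let y_ x (i : vertex Q) : rat := r (x i) / r (w i).

Let rw i : r (w i) != 0. Proof. by rewrite /r intr_eq0 gt_eqF. Qed.

(** With y = x / w, a harmonic weight w makes the diagonal terms of the squares over the arrows add
    up to twice the sum of the x_i squared. *)
Lemma sum_of_squares x : 2 * r (euler x x) =
  \sum_(a : arrow Q) r (w (src a)) * r (w (tgt a)) * (y_ x (src a) - y_ x (tgt a)) ^+ 2.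
Proof.
pose G i a : rat := (src a == i)%:R * r (w (tgt a)) + (tgt a == i)%:R * r (w (src a)).
have harmr i : \sum_(a : arrow Q) G i a = 2 * r (w i).
  have -> : 2 * r (w i) = r (2 * w i) by rewrite /r intrM.
  rewrite -harm /r intrD !(big_morph _ (intrD _) (erefl _)) big_split /=.
  by congr (_ + _); rewrite [RHS]big_mkcond; apply: eq_bigr => a _; case: eqP;
     rewrite ?mul1r ?mul0r.
have E1 : \sum_(a : arrow Q) r (w (src a)) * r (w (tgt a)) * (y_ x (src a) ^+ 2 + y_ x (tgt a) ^+ 2)
    = 2 * \sum_i r (x i) ^+ 2.
  have -> : \sum_(a : arrow Q) r (w (src a)) * r (w (tgt a)) * (y_ x (src a) ^+ 2 + y_ x (tgt a) ^+ 2)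
      = \sum_(a : arrow Q) \sum_i r (w i) * y_ x i ^+ 2 * G i a.
    apply: eq_bigr => a _; rewrite /G.
    under [RHS]eq_bigr do rewrite mulrDr; rewrite big_split /=.
    have S (j : vertex Q) (c : rat) : \sum_i r (w i) * y_ x i ^+ 2 * ((j == i)%:R * c) =
        r (w j) * y_ x j ^+ 2 * c.
      rewrite (bigD1 j) //= eqxx mul1r big1 ?addr0 // => i /negPf ij.
      by rewrite eq_sym ij mul0r mulr0.
    by rewrite !S; ring.
  rewrite exchange_big mulr_sumr; apply: eq_bigr => i _.
  rewrite -mulr_sumr harmr /y_; field; exact: rw.
have -> : r (euler x x) = \sum_i r (x i) ^+ 2 - \sum_(a : arrow Q) r (x (src a)) * r (x (tgt a)).
  rewrite /r /euler intrB !(big_morph _ (intrD _) (erefl _)).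
  by congr (_ - _); apply: eq_bigr => i _; rewrite intrM ?expr2.
rewrite mulrBr -E1 mulr_sumr -sumrB; apply: eq_bigr => a _.
rewrite /y_; field; by rewrite !rw.
Qed.

Lemma euler_ge0 x : 0 <= euler x x.
Proof.
have : 0 <= 2 * r (euler x x).
  rewrite sum_of_squares; apply: sumr_ge0 => a _; apply: mulr_ge0; last exact: sqr_ge0.
  by rewrite mulr_ge0 // ler0z ltW.
by rewrite pmulr_rge0 // ler0z.
Qed.

(** A single term of the sum of squares, cleared of denominators. *)
Lemma square_le x (a : arrow Q) :
  (x (src a) * w (tgt a) - x (tgt a) * w (src a)) ^+ 2 <=
  2 * euler x x * (w (src a) * w (tgt a)).
Proof.
rewrite -(ler_int rat).
have -> : ((2 * euler x x * (w (src a) * w (tgt a)))%:~R : rat) =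
    2 * r (euler x x) * (r (w (src a)) * r (w (tgt a))) by rewrite !intrM.
have -> : (((x (src a) * w (tgt a) - x (tgt a) * w (src a)) ^+ 2)%:~R : rat) =
    r (w (src a)) * r (w (tgt a)) * (y_ x (src a) - y_ x (tgt a)) ^+ 2 *
    (r (w (src a)) * r (w (tgt a))).
  rewrite rmorphXn /= intrB !intrM -!/(r _) /y_; field; by rewrite !rw.
apply: ler_wpM2r; first by rewrite mulr_ge0 // ler0z ltW.
rewrite sum_of_squares (bigD1 a) //= lerDl; apply: sumr_ge0 => b _.
by rewrite mulr_ge0 ?sqr_ge0 // mulr_ge0 // ler0z ltW.
Qed.

Lemma euler_null x : euler x x = 0 -> forall i j, x i * w j = x j * w i.
Proof.
move=> x0 i j.
have yc (a : arrow Q) : y_ x (src a) = y_ x (tgt a).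
  have := square_le x a; rewrite x0 mulr0 mul0r => le.
  have /eqP : (x (src a) * w (tgt a) - x (tgt a) * w (src a)) ^+ 2 = 0.
    by apply/eqP; rewrite eq_le le sqr_ge0.
  rewrite sqrf_eq0 subr_eq0 => /eqP E; rewrite /y_; apply/eqP.
  by rewrite eqr_div ?rw // /r -!intrM E.
have /eqP := conn yc i j; rewrite /y_ eqr_div ?rw // /r -!intrM => /eqP/intr_inj //.
Qed.

Lemma euler_bounded (c : int) : exists b : int, forall x, euler x x <= c ->
  forall i j, `|x i * w j - x j * w i| <= b.
Proof.
(* Having a uniform bound is symmetric and transitive in the pair of vertices and holds along
   arrows, so connectedness gives it for all pairs. *)
pose R i j := exists b : int, forall x, euler x x <= c -> `|x i * w j - x j * w i| <= b.
have Rs i j : R i j -> R j i by case=> b bP; exists b => x /bP; rewrite distrC.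
have Rt i j l : R i j -> R j l -> R i l.
  case=> b bP [b' b'P]; exists (w l * b + w i * b') => x xc.
  have := bP x xc; have := b'P x xc => h1 h2.
  have E : w j * (x i * w l - x l * w i) =
      w l * (x i * w j - x j * w i) + w i * (x j * w l - x l * w j) by ring.
  have := ler_normD (w l * (x i * w j - x j * w i)) (w i * (x j * w l - x l * w j)).
  rewrite -E !normrM !(gtr0_norm (w0 _)) => h3.
  have h4 : w l * `|x i * w j - x j * w i| <= w l * b by rewrite ler_pM2l.
  have h5 : w i * `|x j * w l - x l * w j| <= w i * b' by rewrite ler_pM2l.
  have h6 : `|x i * w l - x l * w i| <= w j * `|x i * w l - x l * w i|.
    by rewrite ler_peMl //; have := w0 j; lia.
  by apply: le_trans h6 _; apply: le_trans h3 _; apply: lerD.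
have Ra (a : arrow Q) : R (src a) (tgt a).
  exists (2 * c * (w (src a) * w (tgt a))) => x xc.
  have ww : 0 < w (src a) * w (tgt a) by rewrite mulr_gt0.
  apply: (@le_trans _ _ ((x (src a) * w (tgt a) - x (tgt a) * w (src a)) ^+ 2)).
    by move: (_ - _) => z; rewrite expr2; nia.
  apply: le_trans (square_le x a) _; rewrite ler_pM2r // ler_pM2l //.
have all_R i j : R i j.
  have H := conn (f := fun l => `[< R i l >]).
  have := H _ i j; rewrite (_ : `[< R i i >] = true).
    move=> E; apply/asboolP; rewrite -E // => a; apply/asboolP/asboolP => h.
      exact: Rt h (Ra a).
    exact: Rt h (Rs _ _ (Ra a)).
  by apply/asboolP; exists 0 => x _; rewrite subrr normr0.
have [b bP] := boolp.choice (fun p : vertex Q * vertex Q => all_R p.1 p.2).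
exists (\sum_p `|b p|) => x xc i j.
apply: le_trans (bP (i, j) x xc) _; rewrite (bigD1 (i, j)) //=.
apply: le_trans (ler_norm _) _; rewrite lerDl; apply: sumr_ge0 => p _; exact: normr_ge0.
Qed.

Lemma harmonic_tame : tame_form w.
Proof.
split=> //; [|exact: euler_ge0|exact: euler_null|exact: euler_bounded].
move=> y; rewrite euler_sumr [euler y w]euler_suml -sumrN; apply: eq_bigr => i _.
rewrite -mulrN; congr (_ * _); rewrite euler_evl euler_evr.
by have := harm i; lra.
Qed.

(** A null vector is proportional to w, so all properties of w pass to [dl] by cross multiplication
    at a vertex of its support. *)
Lemma tame_form_root (dl : vertex Q -> int) : positive_imaginary_root dl -> tame_form dl.
Proof.
case=> [[i0 di0] dge dq]; have prop := euler_null dq.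
have d0 i : 0 < dl i.
  rewrite lt0r dge andbT; apply: contraNneq di0 => di.
  have := prop i0 i; rewrite di mul0r => /eqP; rewrite mulf_eq0 (gt_eqF (w0 i)) orbF //.
have [_ rad psd null bd] := harmonic_tame.
have sc y : w i0 * euler dl y = dl i0 * euler w y.
  rewrite -(@eulerZl _ (w i0) dl (fun i => dl i * w i0)); last by move=> i; apply: mulrC.
  by apply: eulerZl => i; apply: prop.
have sc' y : w i0 * euler y dl = dl i0 * euler y w.
  rewrite -(@eulerZr _ (w i0) dl (fun i => dl i * w i0)); last by move=> i; apply: mulrC.
  by apply: eulerZr => i; apply: prop.
have wn : w i0 != 0 by rewrite gt_eqF.
split=> //.
- by move=> y; apply: (mulfI wn); rewrite mulrN sc sc' rad mulrN.
- move=> x /null xn i j; apply: (mulfI wn).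
  have -> : w i0 * (x i * dl j) = x i * (dl j * w i0) by ring.
  have -> : w i0 * (x j * dl i) = x j * (dl i * w i0) by ring.
  rewrite !(prop _ i0); have := xn i j; move=> E.
  have -> : x i * (dl i0 * w j) = dl i0 * (x i * w j) by ring.
  by rewrite E; ring.
move=> c; have [b bP] := bd c; exists (dl i0 * b) => x xc i j.
have E : w i0 * (x i * dl j - x j * dl i) = dl i0 * (x i * w j - x j * w i).
  have := prop j i0; have := prop i i0 => E1 E2.
  rewrite mulrBr; have -> : w i0 * (x i * dl j) = x i * (dl j * w i0) by ring.
  have -> : w i0 * (x j * dl i) = x j * (dl i * w i0) by ring.
  by rewrite E1 E2; ring.
have h1 : `|x i * dl j - x j * dl i| <= `|w i0 * (x i * dl j - x j * dl i)|.
  by rewrite normrM ler_peMl // gtr0_norm //; have := w0 i0; lia.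
apply: le_trans h1 _; rewrite E normrM (gtr0_norm (d0 i0)).
by rewrite ler_pM2l //; apply: bP.
Qed.
End SumOfSquares.

(** The sum of W over the neighbours of v, with multiplicity, on plain natural numbers so that it
    can be computed from an edge list. *)
Definition gdeg (E : seq (nat * nat)) (W : nat -> nat) (v : nat) : nat :=
  (\sum_(e <- E) ((e.1 == v) * W e.2 + (e.2 == v) * W e.1))%N.

Lemma graph_tame (Q : quiver) (n : nat) (E : seq (nat * nat)) (W : nat -> nat)
    (dl : vertex Q -> int) :
  underlying_graph_is Q n.+1 E ->
  (forall v, (v < n.+1)%N -> (0 < W v)%N) ->
  (forall v, (v < n.+1)%N -> gdeg E W v = (2 * W v)%N) ->
  (forall (T : Type) (F : nat -> T), (forall e, e \in E -> F e.1 = F e.2) ->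
     forall m, (m < n.+1)%N -> F m = F 0%N) ->
  positive_imaginary_root dl -> tame_form dl.
Proof.
move=> [phi [psi [[phi' phiK phi'K] [psi' psiK psi'K] edge]]] W0 WH conn.
pose w (i : vertex Q) : int := (W (phi i))%:Z.
pose ed (a : arrow Q) := nth (0%N, 0%N) E (psi a).
apply: (@tame_form_root Q w) => [i|i|T f fE i j].
- by rewrite ltz_nat W0.
- pose G (e : nat * nat) := ((e.1 == phi i) * W e.2 + (e.2 == phi i) * W e.1)%N.
  have GE (a : arrow Q) : ((src a == i)%:R * w (tgt a) + (tgt a == i)%:R * w (src a) = (G (ed a))%:Z).
    have ph (j : vertex Q) : (j == i) = (phi j == phi i :> nat).
      by apply/eqP/eqP => [->//|/val_inj/(can_inj phiK)].
    rewrite !ph /w /G PoszD !PoszM /ed; have := edge a; set e := nth _ _ _.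
    case: e => e1 e2 /= [[-> ->]|[-> ->]].
      by case: (_ == _); case: (_ == _).
    by rewrite addrC; case: (_ == _); case: (_ == _).
  have S (p : arrow Q -> bool) (h : arrow Q -> int) : \sum_(a | p a) h a = \sum_a (p a)%:R * h a.
    by rewrite big_mkcond; apply: eq_bigr => a _; case: (p a); rewrite ?mul1r ?mul0r.
  rewrite (S (fun a => src a == i)) (S (fun a => tgt a == i)) -big_split /= (eq_bigr (fun a => (G (ed a))%:Z)) // -(big_morph Posz PoszD (erefl _)).
  have -> : (\sum_a G (ed a) = gdeg E W (phi i))%N.
    rewrite /gdeg (big_nth (0%N, 0%N)) big_mkord (reindex psi) //.
    by exists psi' => x _; [apply: psiK|apply: psi'K].
  by rewrite WH // PoszM.
pose F m := f (phi' (inord m)).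
have FE e : e \in E -> F e.1 = F e.2.
  move=> /(nthP (0%N, 0%N)) [l lt <-]; pose a := psi' (Ordinal lt).
  have := edge a; rewrite /a psi'K /=; case: (nth _ E l) => e1 e2.
  have fa := fE a; rewrite -/a; case=> -[<- <-]; rewrite /F /= !inord_val !phiK //.
have FF (l : vertex Q) : f l = F 0%N.
  by rewrite -(conn T F FE (phi l)) // /F inord_val phiK.
by rewrite !FF.
Qed.

Lemma sum_eq_iota m l v : (\sum_(i <- iota m l) (i == v) = (m <= v < m + l))%N.
Proof.
elim: l m => [|l IH] m; first by rewrite big_nil addn0; case: leqP => // /leq_gtF ->.
by rewrite /= big_cons IH addSnnS; lia.
Qed.

Lemma sum_eqS_iota m l v : (\sum_(i <- iota m l) (i.+1 == v) = (m < v <= m + l))%N.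
Proof.
elim: l m => [|l IH] m; first by rewrite big_nil; lia.
by rewrite /= big_cons IH addSnnS; lia.
Qed.

Lemma tame_A (Q : quiver) n (dl : vertex Q -> int) : (1 <= n)%N ->
  underlying_graph_is Q n.+1 (edges_A n) -> positive_imaginary_root dl -> tame_form dl.
Proof.
move=> n1 gr; apply: (graph_tame (W := fun=> 1%N) gr) => // [v vn|T F FE].
  have -> : gdeg (edges_A n) (fun=> 1%N) v =
      (\sum_(i <- iota 0 n.+1) (i == v) + \sum_(i <- iota 0 n.+1) (i.+1 %% n.+1 == v))%N.
    by rewrite /gdeg big_map -big_split; apply: eq_bigr => i _; rewrite !muln1.
  rewrite sum_eq_iota -[in iota _ n.+1]addn1 iotaD big_cat add0n big_seq1.
  (* The last edge has been split off, since only there does the remainder wrap round to 0. *)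
  rewrite (eq_big_seq (fun i => (i.+1 == v) : nat)); last first.
    by move=> i; rewrite mem_iota add0n => /andP [_ lt]; rewrite modn_small // addn1 ltnS.
  rewrite sum_eqS_iota modnn /= !add0n vn; case: v vn => [|v] vn /=; lia.
elim=> [//|m IH] lt; rewrite -IH ?(ltnW lt) //; apply/esym.
apply: (FE (m, m.+1)); apply/mapP; exists m; last by rewrite modn_small.
by rewrite mem_iota add0n (ltnW lt).
Qed.

Lemma tame_D (Q : quiver) n (dl : vertex Q -> int) : (4 <= n)%N ->
  underlying_graph_is Q n.+1 (edges_D n) -> positive_imaginary_root dl -> tame_form dl.
Proof.
move=> n4 gr.
(* The coefficients of the minimal imaginary root: 1 at the four leaves and 2 elsewhere. *)
pose W v := if (2 <= v)%N && (v <= n - 2)%N then 2%N else 1%N.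
apply: (graph_tame (W := W) gr) => [v _|v vn|T F FE].
- by rewrite /W; case: ifP.
- rewrite /gdeg /edges_D big_cat big_cat /= big_map !big_cons !big_nil /=.
  rewrite (eq_big_seq (fun i => ((i == v) * 2 + (i.+1 == v) * 2)%N)); last first.
    move=> i; rewrite mem_iota => /andP [l1 l2]; rewrite /W.
    have -> : ((1 < i.+1)%N && (i.+1 <= n - 2)%N) by lia.
    by have -> : ((1 < i)%N && (i <= n - 2)%N) by lia.
  rewrite big_split /= -!big_distrl /= sum_eq_iota sum_eqS_iota.
  have -> : W 0%N = 1%N by []. have -> : W 1%N = 1%N by [].
  have -> : W 2%N = 2%N by rewrite /W; case: ifP => //; lia.
  have -> : W (n - 2)%N = 2%N by rewrite /W; case: ifP => //; lia.
  have -> : W (n - 1)%N = 1%N by rewrite /W; case: ifP => //; lia.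
  have -> : W n = 1%N by rewrite /W; case: ifP => //; lia.
  rewrite /W; case: ifP => h.
    lia.
  lia.
have E02 : F 0%N = F 2%N by apply: (FE (0, 2)%N); rewrite !inE.
have E12 : F 1%N = F 2%N by apply: (FE (1, 2)%N); rewrite !inE eqxx ?orbT.
have chain m : (2 <= m <= n - 2)%N -> F m = F 2%N.
  elim: m => // m IH lm; have [->//|m2] := eqVneq m 1%N.
  rewrite -IH; last by lia.
  apply/esym/(FE (m, m.+1)); rewrite !mem_cat; apply/orP; right; apply/orP; left.
  by apply/mapP; exists m => //; rewrite mem_iota; lia.
have l1 : F (n - 2)%N = F (n - 1)%N.
  by apply: (FE (n - 2, n - 1)%N); rewrite !mem_cat !inE !eqxx ?orbT.
have l2 : F (n - 2)%N = F n.
  by apply: (FE (n - 2, n)%N); rewrite !mem_cat !inE !eqxx ?orbT.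
have c2 : F (n - 2)%N = F 2%N by apply: chain; lia.
move=> m lt; rewrite E02.
have [->//|m0] := eqVneq m 0%N; have [->//|m1] := eqVneq m 1%N.
have [->|mn] := eqVneq m n; first by rewrite -l2.
have [->|mn1] := eqVneq m (n - 1)%N; first by rewrite -l1.
by apply: chain; lia.
Qed.

(** As for the other two exceptional diagrams, the weights are the coefficients of the minimal
    imaginary root, and the conditions are checked vertex by vertex. *)
Lemma tame_E6 (Q : quiver) (dl : vertex Q -> int) :
  underlying_graph_is Q 7 edges_E6 -> positive_imaginary_root dl -> tame_form dl.
Proof.
move=> gr; apply: (graph_tame (W := nth 0%N [:: 3; 2; 1; 2; 1; 2; 1]%N) gr).
- by do 7!case=> //.
- by do 7!(case; first by rewrite /gdeg unlock).
move=> T F FE; have H e1 e2 : (e1, e2) \in edges_E6 -> F e1 = F e2 by move/FE.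
have E1 := H 0%N 1%N isT; have E2 := H 1%N 2%N isT; have E3 := H 0%N 3%N isT.
have E4 := H 3%N 4%N isT; have E5 := H 0%N 5%N isT; have E6 := H 5%N 6%N isT.
by do 7!(case; first by congruence).
Qed.

Lemma tame_E7 (Q : quiver) (dl : vertex Q -> int) :
  underlying_graph_is Q 8 edges_E7 -> positive_imaginary_root dl -> tame_form dl.
Proof.
move=> gr; apply: (graph_tame (W := nth 0%N [:: 4; 2; 3; 2; 1; 3; 2; 1]%N) gr).
- by do 8!case=> //.
- by do 8!(case; first by rewrite /gdeg unlock).
move=> T F FE; have H e1 e2 : (e1, e2) \in edges_E7 -> F e1 = F e2 by move/FE.
have E1 := H 0%N 1%N isT; have E2 := H 0%N 2%N isT; have E3 := H 2%N 3%N isT.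
have E4 := H 3%N 4%N isT; have E5 := H 0%N 5%N isT; have E6 := H 5%N 6%N isT.
have E7 := H 6%N 7%N isT.
by do 8!(case; first by congruence).
Qed.

Lemma tame_E8 (Q : quiver) (dl : vertex Q -> int) :
  underlying_graph_is Q 9 edges_E8 -> positive_imaginary_root dl -> tame_form dl.
Proof.
move=> gr; apply: (graph_tame (W := nth 0%N [:: 6; 3; 4; 2; 5; 4; 3; 2; 1]%N) gr).
- by do 9!case=> //.
- by do 9!(case; first by rewrite /gdeg unlock).
move=> T F FE; have H e1 e2 : (e1, e2) \in edges_E8 -> F e1 = F e2 by move/FE.
have E1 := H 0%N 1%N isT; have E2 := H 0%N 2%N isT; have E3 := H 2%N 3%N isT.
have E4 := H 0%N 4%N isT; have E5 := H 4%N 5%N isT; have E6 := H 5%N 6%N isT.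
have E7 := H 6%N 7%N isT; have E8 := H 7%N 8%N isT.
by do 9!(case; first by congruence).
Qed.

Lemma tame_tame_form (Q : quiver) (dl : vertex Q -> int) : tame Q ->
  positive_imaginary_root dl -> tame_form dl.
Proof.
case=> [[n n1]|[n n4]|[]]; [exact: tame_A|exact: tame_D|exact: tame_E6|exact: tame_E7|exact: tame_E8].
Qed.

(** * Maps from a preprojective of defect -1 onto regular representations *)

Section Grothendieck.
Variables (k : finFieldType) (Q : quiver).

Fixpoint K0_dv (x : K0 k Q) (i : vertex Q) : int :=
  match x with
  | K0_class M => dv M i
  | K0_zero => 0
  | K0_opp y => - K0_dv y i
  | K0_add y z => K0_dv y i + K0_dv z i
  end.

Lemma K0_eq_dv (x y : K0 k Q) : K0_eq x y -> K0_dv x =1 K0_dv y.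
Proof.
elim=> {x y} //=.
- by move=> x y _ IH i; rewrite IH.
- by move=> x y z _ IH1 _ IH2 i; rewrite IH1 IH2.
- by move=> x y _ IH i; rewrite IH.
- by move=> x x' y y' _ IH1 _ IH2 i; rewrite IH1 IH2.
- by move=> x y z i; rewrite addrA.
- by move=> x y i; rewrite addrC.
- by move=> x i; rewrite add0r.
- by move=> x i; rewrite addNr.
by move=> N L M f g fg i; rewrite (ses_dv fg).
Qed.
End Grothendieck.

(** Dependent families over ordinals from head and tail; the transports are harmless because
    equality proofs between ordinals are unique. *)
Lemma ord_family (n : nat) (T : 'I_n.+1 -> Type) (a : T ord0)
    (b : forall j, T (lift ord0 j)) :
  exists f : forall j, T j, f ord0 = a /\ forall j, f (lift ord0 j) = b j.
Proof.
have H j : {x : T j | (forall e : ord0 = j, ecast j (T j) e a = x) /\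
    (forall l (e : lift ord0 l = j), ecast j (T j) e (b l) = x)}.
  case: (unliftP ord0 j) => [l|] ->.
    exists (b l); split=> [e|l' e]; first by have := congr1 val e.
    by have le := lift_inj e; subst l'; rewrite eq_axiomK.
  exists a; split=> [e|l' e]; first by rewrite eq_axiomK.
  by have := congr1 val e.
exists (fun j => sval (H j)); split=> [|j].
  by have [/(_ (erefl _))] := svalP (H ord0).
by have [_ /(_ _ (erefl _))] := svalP (H (lift ord0 j)).
Qed.

(** * Finite direct sums *)

Section BigSums.
Variables (k : finFieldType) (Q : quiver).
Implicit Types A B C M N R X : rep k Q.

(** A finite biproduct given by its universal properties, which avoids sums of homomorphisms over
    the index. *)
Definition decomposition R n (S : 'I_n -> rep k Q)
    (p : forall j, rep_hom R (S j)) (q : forall j, rep_hom (S j) R) : Prop :=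
  [/\ forall j, comph (p j) (q j) = idh (S j),
      forall X (h : forall j, rep_hom X (S j)), exists g, forall j, comph (p j) g = h j,
      forall j l, j <> l -> comph (p l) (q j) = zeroh (S j) (S l),
      forall i (x : R i), (forall j, p j i x = 0) -> x = 0 &
      forall X (u v : rep_hom R X), (forall j, comph u (q j) = comph v (q j)) -> u = v].

Lemma rep0_zero : is_zero (rep0 k Q).
Proof. by move=> i v; apply/rowP => -[]. Qed.

Lemma bigdsum_recl n (S : 'I_n.+1 -> rep k Q) :
  bigdsum S = dsum (S ord0) (bigdsum (fun j => S (lift ord0 j))).
Proof. by rewrite /bigdsum big_ord_recl. Qed.

Lemma bigdsum_decomposition n (S : 'I_n -> rep k Q) R : rep_iso R (bigdsum S) ->
  exists p q, @decomposition R n S p q.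
Proof.
move=> iso; have [f [fi fs]] := (rep_isoP _ _).1 iso.
have [f' [f'f ff']] := bij_inverse fi fs.
suff [p [q [pq univ pq0 jinj ext]]] : exists p q, @decomposition (bigdsum S) n S p q.
  exists (fun j => comph (p j) f), (fun j => comph f' (q j)); split.
  - by move=> j; rewrite -comphA (comphA f) ff' comp1h pq.
  - move=> X h; have [g gE] := univ X h; exists (comph f' g) => j.
    by rewrite -comphA (comphA f) ff' comp1h gE.
  - by move=> j l jl; rewrite -comphA (comphA f) ff' comp1h pq0.
  - move=> i x px; apply: (fi i); rewrite linear0; apply: jinj => j.
    by rewrite -(comphE (p j) f) px.
  - move=> X u v uv; have e : comph u f' = comph v f'.
      by apply: ext => j; rewrite -!comphA.
    by rewrite -(comph1 u) -(comph1 v) -f'f !comphA e.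
elim: n S {R iso f f' fi fs f'f ff'} => [|n IH] S.
  have z : is_zero (bigdsum S) by rewrite /bigdsum big_ord0; apply: rep0_zero.
  exists (fun j : 'I_0 => False_rect _ (notF (ltn_ord j))),
    (fun j : 'I_0 => False_rect _ (notF (ltn_ord j))); split=> [[]//|X h|[]//|i x _|X u v _].
  - by exists (zeroh _ _) => -[].
  - exact: z.
  - by apply: hom_ext => i x; rewrite (z i x) !linear0.
rewrite bigdsum_recl; set B := bigdsum _.
have [p [q [pq univ pq0 jinj ext]]] := IH (fun j => S (lift ord0 j)).
have [p' [p'0 p'S]] := @ord_family n (fun j => rep_hom (dsum (S ord0) B) (S j))
  (fsth _ _) (fun j => comph (p j) (sndh _ _)).
have [q' [q'0 q'S]] := @ord_family n (fun j => rep_hom (S j) (dsum (S ord0) B))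
  (inlh _ _) (fun j => comph (inrh _ _) (q j)).
exists p', q'; split.
- move=> j; case: (unliftP ord0 j) => [l|] ->.
    rewrite p'S q'S; apply: hom_ext => i x.
    by rewrite !comphE sndhE inrhE -(comphE (p l)) pq.
  by rewrite p'0 q'0; apply: hom_ext => i x; rewrite comphE fsthE inlhE idhE.
- move=> X h; have [g gE] := univ X (fun j => h (lift ord0 j)).
  exists (pairh (h ord0) g) => j; case: (unliftP ord0 j) => [l|] ->.
    rewrite p'S -gE; apply: hom_ext => i x.
    by rewrite !comphE sndhE pairhE.
  by rewrite p'0; apply: hom_ext => i x; rewrite comphE fsthE pairhE.
- move=> j l; case: (unliftP ord0 j) => [j'|] ->; case: (unliftP ord0 l) => [l'|] -> jl.
  + rewrite p'S q'S; apply: hom_ext => i x.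
    rewrite !comphE sndhE inrhE -(comphE (p l')) pq0 // => jl'.
    by apply: jl; rewrite jl'.
  + by rewrite p'0 q'S; apply: hom_ext => i x; rewrite !comphE fsthE inrhE zerohE.
  + by rewrite p'S q'0; apply: hom_ext => i x; rewrite !comphE sndhE inlhE zerohE linear0.
  + by [].
- move=> i [x y] pxy; have := pxy ord0; rewrite p'0 fsthE /= => ->.
  congr pair; apply: jinj => j; have := pxy (lift ord0 j).
  by rewrite p'S comphE sndhE.
move=> X u v uv.
have e1 : comph u (inlh _ _) = comph v (inlh _ _) by rewrite -q'0 uv.
have e2 : comph u (inrh _ _) = comph v (inrh _ _).
  by apply: ext => j; have := uv (lift ord0 j); rewrite q'S !comphA.
apply: hom_ext => i [x y].
have wE (w : rep_hom (dsum (S ord0) B) X) :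
    w i (x, y) = comph w (inlh _ _) i x + comph w (inrh _ _) i y.
  rewrite !comphE -linearD; congr (w i _).
  by rewrite inlhE inrhE; congr pair; rewrite /= ?addr0 ?add0r.
by rewrite !wE e1 e2.
Qed.

Lemma dsum_iso A B C : rep_iso B C -> rep_iso (dsum A B) (dsum A C).
Proof.
move=> /rep_isoP [f [fi fs]]; apply/rep_isoP.
exists (pairh (fsth A B) (comph f (sndh A B))); split=> i.
  move=> [x1 y1] [x2 y2]; rewrite !pairhE !fsthE !comphE !sndhE /=.
  by case=> -> /(fi i) ->.
apply/limg_surj => -[x y]; have [z <-] := (limg_surj _).1 (fs i) y.
by exists (x, z); rewrite pairhE fsthE comphE sndhE.
Qed.

Lemma quorep_iso M N (g : rep_hom M N) (X : subspaces M) : stable X ->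
  surjective_hom g -> (forall i, X i = lker (g i)) -> rep_iso (quorep X) N.
Proof.
move=> Xs gs XE; apply/rep_isoP.
have [f gE] : exists f, g = comph f (quop Xs).
  by apply: ker_eq_factor => [|i]; rewrite ?quop_ker ?XE //; apply: quop_surj.
exists f; split; last by apply: (@surj_factor_surj _ _ _ _ _ f (quop Xs)); rewrite -gE.
move=> i; apply: lker_inj => y.
have [x <-] := (limg_surj _).1 (quop_surj Xs i) y.
rewrite -comphE -gE => gx; apply/eqP; rewrite -memv_ker quop_ker XE memv_ker.
exact/eqP.
Qed.

Lemma sub_ses M (X : subspaces M) (Xs : stable X) : short_exact (subi Xs) (quop Xs).
Proof. by split=> [||i]; [apply: subi_inj|apply: quop_surj|rewrite subi_img quop_ker]. Qed.

Lemma ker_stable M N (g : rep_hom M N) : @stable k Q M [ffun i => lker (g i)].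
Proof.
move=> a; apply/subvP => _ /memv_imgP [x xk ->]; move: xk.
by rewrite !ffunE !memv_ker hcommE => /eqP ->; rewrite linear0.
Qed.
End BigSums.

(** * Relative tops, and kernels of surjections *)

Section RelativeTop.
Variables (k : finFieldType) (Q : quiver) (d : vertex Q -> int).
Hypothesis ac : acyclic Q.
Hypothesis tf : tame_form d.
Implicit Types A B C E K M N P R S : rep k Q.
Notation theta := (@theta k Q d).
Notation reg := (@reg k Q d).
Notation neg := (@neg k Q d).
Notation stab := (@stab k Q d).
Notation local := (@local k Q d).

Lemma reg_bigdsum M : reg M -> exists n (S : 'I_n -> rep k Q),
  rep_iso M (bigdsum S) /\ forall j, indec_regular (S j).
Proof.
move: M; apply: reg_induction => [M M0|M A B iso Ai At _ _ [n [S [isoB Sr]]]].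
  exists 0%N, (fun=> rep0 k Q); split; last by case.
  apply/rep_isoP; exists (zeroh _ _); rewrite /bigdsum big_ord0; split=> i.
    by move=> x y _; rewrite (M0 i x) (M0 i y).
  apply/limg_surj => y; exists 0; rewrite zerohE; symmetry; exact: rep0_zero.
exists n.+1, (fun j => if unlift ord0 j is Some l then S l else A); split.
  rewrite bigdsum_recl unlift_none.
  have -> : (fun j : 'I_n => if unlift ord0 (lift ord0 j) is Some l then S l else A) = S.
    by apply/funext => j; rewrite liftK.
  exact: rep_iso_trans iso (dsum_iso _ isoB).
by move=> j; case: unliftP => [l _|_]; [apply: Sr|apply/(indec_regularP ac tf)].
Qed.

Lemma theta_bigdsum n (S : 'I_n -> rep k Q) :
  (forall j, theta (S j) = 0) -> theta (bigdsum S) = 0.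
Proof.
move=> S0; rewrite /bigdsum; apply: (big_ind (fun M => theta M = 0)) => //.
  exact/theta_zero/rep0_zero.
by move=> A B At Bt; rewrite theta_dsum At Bt.
Qed.

Lemma reg_of_bigdsum n (S : 'I_n -> rep k Q) :
  (forall j, reg (S j)) -> reg (bigdsum S).
Proof.
move=> Sr; rewrite /bigdsum; apply: (big_ind (fun M => reg M)) => //.
  exact/reg_zero/rep0_zero.
by move=> A B Ar Br; apply: (reg_ext (dsum_ses A B)).
Qed.

(** Each indecomposable summand of a regular subobject embeds in A, so it is linked to A and lies in
    its tube. *)
Lemma tube_subP A (X : subspaces A) : indecomposable A -> reg A ->
  tube_sub X <-> stable X /\ theta (subrep X) = 0.
Proof.
move=> Ai Ar; split=> -[Xs H]; split=> //.
  case: H => n [S [iso Sr]]; rewrite (theta_iso d iso); apply: theta_bigdsum => j.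
  by have [/(indec_regularP ac tf) []] := Sr j.
have Xr : reg (subrep X) by apply: (reg_sub Ar _ H); apply: (@subi_inj _ _ _ _ Xs).
have [n [S [iso Sr]]] := reg_bigdsum Xr.
have [p [q [pq _ _ _ _]]] := bigdsum_decomposition iso.
exists n, S; split=> // j; split=> //; apply: rst_sym; apply: rst_step; split=> //.
  by apply/(indec_regularP ac tf); split=> //; case: Ar.
have [[Si _] _ _] := Sr j.
apply/hom_nonzeroP; exists (comph (subi Xs) (q j)); apply: inj_nonzero Si => i.
apply: lker_inj => x; rewrite comphE => h.
have {}h : q j i x = 0 by apply: (@subi_inj _ _ _ _ Xs); rewrite h linear0.
by rewrite -[x](idhE (M := S j)) -pq comphE h linear0.
Qed.

Section Local.
Variables (A E : rep k Q) (g : rep_hom A E).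
Hypotheses (Ai : indecomposable A) (Ar : reg A) (Es : stab E) (gs : surjective_hom g).
Let K : subspaces A := [ffun i => lker (g i)].

Let K_tube : tube_sub K.
Proof.
apply/(tube_subP _ Ai Ar); split; first exact: ker_stable.
have [[Et _] _ _] := Es; have [At _] := Ar.
apply: (ses_theta0 (f := subi (ker_stable g)) (g := g)) => //.
by split=> [||i] //; [apply: subi_inj|rewrite subi_img ffunE].
Qed.

Let K_proper : ~ forall i, K i = fullv.
Proof.
move=> Kf; have [_ E0 _] := Es; apply: E0 => i y.
have [x <-] := (limg_surj _).1 (gs i) y; apply/eqP.
by rewrite -memv_ker; have := Kf i; rewrite ffunE => ->; apply: memvf.
Qed.

Let sub_K X : tube_sub X -> ~ (forall i, X i = fullv) -> forall i, (X i <= K i)%VS.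
Proof.
move=> /(tube_subP _ Ai Ar) [Xs Xt] Xp i.
have [At _] := Ar; have ses := sub_ses Xs.
have Ct : theta (quorep X) = 0 by have := theta_ses d ses; rewrite At Xt add0r.
have Cr : reg (quorep X) by apply: (reg_quot Ar ses).
have Cn : ~ is_zero (quorep X).
  move=> z; apply: Xp => j; rewrite -(quop_ker Xs); apply/vspaceP => x.
  by rewrite memv_ker memvf; apply/eqP/z.
(* A quasi-simple quotient of A / X is one of A, so by locality its kernel is K, and X lies in
   it. *)
have [S [s [Ss ssurj]]] := stab_quot Cr Cn.
have [_ _ loc] := indec_local_top ac tf Ai Ar.
have := loc _ _ g (comph s (quop Xs)) Es Ss gs (surj_comp (quop_surj Xs) ssurj) i.
rewrite ffunE => ->; rewrite -(quop_ker Xs); apply/subvP => x.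
by rewrite !memv_ker comphE => /eqP ->; rewrite linear0.
Qed.

Lemma tube_radicalE : tube_radical A = K.
Proof.
have maxK : tube_maximal_sub K.
  split=> //.
    by apply: contrapT => /forallNP h; apply: K_proper => i; apply/eqP/negPn/negP/h.
  move=> Y Yt KY; have [?|Yp] := pselect (forall i, Y i = fullv); [by right|left].
  by apply/ffunP => i; apply/eqP; rewrite eqEsubv KY sub_K.
have maxE X : tube_maximal_sub X -> X = K.
  move=> [Xt [i Xi] max].
  have Xp : ~ (forall i, X i = fullv) by move=> h; rewrite h eqxx in Xi.
  by have [->//|/K_proper] := max K K_tube (sub_K Xt Xp).
apply/ffunP => i; rewrite ffunE; apply/eqP; rewrite eqEsubv; apply/andP; split.
  by apply: (bigcapv_inf K) => //; apply/asboolP.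
by apply/subv_bigcapP => X /asboolP/maxE ->.
Qed.
End Local.

Lemma relative_top_stab A : indecomposable A -> reg A ->
  stab (relative_top A) /\ exists t : rep_hom A (relative_top A), surjective_hom t.
Proof.
move=> Ai Ar; have [An _] := Ai; have [E [g [Es gs]]] := stab_quot Ar An.
rewrite /relative_top (tube_radicalE Ai Ar Es gs).
have Ks := ker_stable g; split; last by exists (quop Ks); apply: quop_surj.
apply: stab_iso Es; apply: rep_iso_sym.
by apply: (quorep_iso Ks gs) => i; rewrite ffunE.
Qed.

Lemma neg1_indec M : neg M -> theta M = -1 -> indecomposable M.
Proof.
move=> Mn Mt; split=> [M0|A B iso].
  by have := theta_zero d M0; rewrite Mt.
apply: contrapT => /not_orP [A0 B0].
have [f [fi fs]] := (rep_isoP _ _).1 (rep_iso_sym iso).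
have At : theta A < 0 by apply: (Mn A (comph f (inlh A B))) => //; apply: inj_comp (@inlh_inj _ _ A B) fi.
have Bt : theta B < 0 by apply: (Mn B (comph f (inrh A B))) => //; apply: inj_comp (@inrh_inj _ _ A B) fi.
have := theta_iso d iso; rewrite theta_dsum Mt; move: At Bt.
by move: (theta A) (theta B) => a b; lia.
Qed.

Lemma neg_sub M N (f : rep_hom N M) : injective_hom f -> neg M -> neg N.
Proof. by move=> fi Mn Y y yi; apply: (Mn Y (comph f y)); apply: inj_comp yi fi. Qed.

(** Both composites onto a quasi-simple quotient E of A have the same kernel Y. It is again
    indecomposable of defect -1 and both maps send it onto the radical of A, so the induction runs
    with Y in place of P. *)
Lemma local_ker_le A P (g1 g2 : rep_hom P A) : local A ->
  indecomposable P -> theta P = -1 -> surjective_hom g1 -> surjective_hom g2 ->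
  forall v x, g1 v x = 0 -> g2 v x = 0.
Proof.
have [m] := ubnP (tdim A); elim: m A P g1 g2 => // m IH A P g1 g2 lt Al Pi Pt g1s g2s.
have [Ar An _] := Al; have [E [e [Es es]]] := stab_quot Ar An.
have [[Et _] En _] := Es.
have s1 := surj_comp g1s es; have s2 := surj_comp g2s es.
have kE := hom_ker_unique ac tf Pi Pt Es (surj_nonzero s1 En) (surj_nonzero s2 En).
have [Y [y ses1]] := epi_ses s1.
have ses2 : short_exact y (comph e g2) by case: ses1 => ? ? h; split=> // v; rewrite h kE.
have [M [i sesM]] := epi_ses es.
have Yt : theta Y = -1 by have := theta_ses d ses1; rewrite Pt Et addr0.
have Yi : indecomposable Y.
  apply: neg1_indec Yt; apply: (neg_sub (ses_inj ses1)).
  by apply: (neg_indec ac tf Pi); rewrite Pt.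
have restr (g : rep_hom P A) : surjective_hom g -> short_exact y (comph e g) ->
    exists2 g' : rep_hom Y M, comph g y = comph i g' & surjective_hom g'.
  move=> gs ses; have [g' gE] : exists g', comph g y = comph i g'.
    apply: (ses_factor_l sesM); apply: hom_eq0 => v z.
    by rewrite !comphE -(comphE e g) (ses_comp ses).
  exists g' => // v; apply/limg_surj => w.
  have [x xE] := (limg_surj _).1 (gs v) (i v w).
  have [z zE] : exists z, x = y v z.
    by apply: (ses_ker ses); rewrite comphE xE (ses_comp sesM).
  exists z; apply: (ses_inj sesM); rewrite -(comphE i g') -gE comphE -zE xE //.
have [h1 h1E h1s] := restr g1 g1s ses1; have [h2 h2E h2s] := restr g2 g2s ses2.
move=> v x gx; have [z xz] : exists z, x = y v z.
  by apply: (ses_ker ses1); rewrite comphE gx linear0.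
have hz : h1 v z = 0.
  by apply: (ses_inj sesM); rewrite -(comphE i h1) -h1E comphE -xz gx linear0.
rewrite xz -(comphE g2) h2E comphE.
have [_ [M0|Ml]] := local_rad ac tf Al Es sesM; first by rewrite (M0 v (h2 v z)) linear0.
rewrite (IH M Y h1 h2 _ Ml Yi Yt h1s h2s v z hz) ?linear0 //.
have := (nonzeroP _).1 En; have := ses_tdim sesM; move: lt; lia.
Qed.
End RelativeTop.

(** * Proof of the theorem for a fixed radical vector *)

Section Proposition.
Variables (k : finFieldType) (Q : quiver) (d : vertex Q -> int).
Hypothesis ac : acyclic Q.
Hypothesis tf : tame_form d.
Variables (P P' R : rep k Q) (n : nat) (R_ : 'I_n -> rep k Q).
Hypotheses (Pi' : indecomposable P') (Pt' : theta d P' = -1).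
Hypothesis isoR : rep_iso R (bigdsum R_).
Hypothesis R_r : forall j, indec_regular (R_ j).
Notation theta := (@theta k Q d).
Notation reg := (@reg k Q d).
Notation neg := (@neg k Q d).
Notation stab := (@stab k Q d).
Notation local := (@local k Q d).

Let R_i j : indecomposable (R_ j). Proof. by have [] := R_r j. Qed.
Let R_reg j : reg (R_ j).
Proof. by have [Ri Rt] := (indec_regularP ac tf _).1 (R_r j); apply: reg_indec. Qed.
Let R_local j : local (R_ j). Proof. exact: indec_local_top. Qed.
Let Rreg : reg R. Proof. exact: reg_iso (rep_iso_sym isoR) (reg_of_bigdsum R_reg). Qed.
Let Pn' : neg P'. Proof. by apply: neg_indec => //; rewrite Pt'. Qed.

Lemma ses_top_nonzero (f : rep_hom P P') (g : rep_hom P' R) j : short_exact f g ->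
  hom_nonzero P' (relative_top (R_ j)).
Proof.
move=> fg; have [p [q [pq _ _ _ _]]] := bigdsum_decomposition isoR.
have [[_ Tn _] [t ts]] := relative_top_stab ac tf (R_i j) (R_reg j).
have ps : surjective_hom (p j).
  by move=> i; apply/limg_surj => y; exists (q j i y); rewrite -comphE pq idhE.
apply/hom_nonzeroP; exists (comph t (comph (p j) g)); apply: surj_nonzero Tn.
exact: surj_comp (surj_comp (ses_surj fg) ps) ts.
Qed.

(** Lift a nonzero map to the top. A nonzero map from [R_ j] to a quasi-simple has the same kernel
    as the projection to the top, so it cannot kill the lift. *)
Lemma lift_top j : hom_nonzero P' (relative_top (R_ j)) ->
  exists h : rep_hom P' (R_ j), forall S (u : rep_hom (R_ j) S), stab S ->
    comph u h = zeroh _ _ -> u = zeroh _ _.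
Proof.
move=> /hom_nonzeroP [h0 h0n].
have [Ts [t ts]] := relative_top_stab ac tf (R_i j) (R_reg j).
have [N [i ses]] := epi_ses ts; have [[Tt _] _ _] := Ts; have [Rt _] := R_reg j.
have Nr : reg N by apply: (reg_sub (R_reg j) (ses_inj ses)); apply: (ses_theta0 ses).
have Pt0 : theta P' < 0 by rewrite Pt'.
have [h hE] := lift_ed0 ses h0 (ed_neg_reg ac tf Pi' Pt0 Nr).
exists h => S u Ss uh.
apply: contrapT => un; apply: h0n; rewrite -hE; apply: hom_eq0 => v x.
have [_ _ loc] := R_local j.
have kE := loc _ _ t u Ts Ss ts (stab_surj (R_reg j) Ss un) v.
apply/eqP; rewrite comphE -memv_ker kE memv_ker -comphE uh; exact/eqP/zerohE.
Qed.

Lemma top_surjection : (forall j l, j <> l -> ~ same_tube (R_ j) (R_ l)) ->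
  (tdim R < tdim P')%N ->
  (forall j, hom_nonzero P' (relative_top (R_ j))) ->
  exists g : rep_hom P' R, surjective_hom g.
Proof.
move=> tubes ltR top; have [p [q [pq univ pq0 _ ext]]] := bigdsum_decomposition isoR.
have lifts j := cid (lift_top (top j)).
have [g gE] := univ P' (fun j => sval (lifts j)).
have [I [K [r [j [i [ses ji gI]]]]]] := im_exists g; exists g.
have [Rt Rsub] := Rreg.
(* P' is too large to embed in R, so K is nonzero with defect at most -1; then I has defect at least
   0, and at most 0 inside R. *)
have It : theta I = 0.
  have Kn : ~ is_zero K.
    move=> /is_zeroP K0; have := ses_tdim ses; have := inj_tdim ji; lia.
  have Kt := Pn' (ses_inj ses) Kn; have := Rsub _ _ ji.
  have := theta_ses d ses; rewrite Pt'; move: Kt.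
  by move: (theta I) (theta K) => a b; lia.
have [C [c sesC]] := mono_ses ji.
have Ct : theta C = 0 by have := theta_ses d sesC; rewrite Rt It add0r.
have Cr := reg_quot Rreg sesC Ct.
have [C0|Cn] := pselect (is_zero C).
  have js : surjective_hom j.
    apply: (inj_tdim_surj ji); have := ses_tdim sesC.
    by rewrite ((is_zeroP C).1 C0) addn0 => ->.
  by rewrite gI; apply: surj_comp (ses_surj ses) js.
have [S [s [Ss ss]]] := stab_quot Cr Cn; pose u := comph s c.
have us : surjective_hom u := surj_comp (ses_surj sesC) ss.
have [_ Sn _] := Ss.
have ug : comph u g = zeroh _ _.
  by apply: hom_eq0 => v x; rewrite gI !comphE (ses_comp sesC) linear0.
have Sr : indec_regular S.
  by apply/(indec_regularP ac tf); split; [apply: stab_indec Ss|case: Ss => -[]].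
have [j0 uj0] : exists j0, comph u (q j0) <> zeroh _ _.
  apply: contrapT => /forallNP h; apply: (surj_nonzero us Sn); apply: ext => l.
  have /contrapT -> := h l.
  by symmetry; apply: hom_eq0 => v x; rewrite comphE zerohE.
have link l : comph u (q l) <> zeroh _ _ -> same_tube (R_ l) S.
  by move=> ul; apply: rst_step; split=> //; apply/hom_nonzeroP; exists (comph u (q l)).
(* If u were nonzero on two summands, both would be linked to S and would share a tube. *)
have uE : u = comph (comph u (q j0)) (p j0).
  apply: ext => l; rewrite -comphA.
  have [->|/eqP jl] := eqVneq l j0; first by rewrite pq comph1.
  rewrite pq0 //; have [->|ul] := pselect (comph u (q l) = zeroh _ _).
    by apply: hom_ext => v x; rewrite comphE !zerohE linear0.
  by case: (tubes l j0 jl); apply: rst_trans (link l ul) (rst_sym _ _ _ _ (link j0 uj0)).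
case: uj0; apply: (svalP (lifts j0)) => //=.
by rewrite -gE comphA -uE.
Qed.

Lemma ses_of_surjection (g : rep_hom P' R) : indecomposable P -> theta P = -1 -> surjective_hom g ->
  (forall i, dv P i + dv R i = dv P' i) -> exists f : rep_hom P P', short_exact f g.
Proof.
move=> Pi Pt gs dvE; have [K [i ses]] := epi_ses gs.
have Pn : neg P by apply: neg_indec => //; rewrite Pt.
have KP : dv K = dv P.
  by apply/funext => v; apply: (addIr (dv R v)); rewrite dvE (ses_dv ses).
have Kt : theta K = -1 by rewrite -Pt /theta KP.
have Kn : neg K := neg_sub (ses_inj ses) Pn'.
have Ktd : tdim K = tdim P.
  by apply: eq_bigr => v _; have := congr1 (fun x => x v) KP => -[].
have [f fn] : exists f : rep_hom P K, f <> zeroh P K.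
  apply: hd_nonzero; have := euler_formula P K; rewrite KP (neg1_q ac tf Pi Pt).
  by case: (hd P K) => //; lia.
have fi := neg1_inj Pt Pn Kn fn.
have fs : surjective_hom f by apply: (inj_tdim_surj fi); rewrite Ktd.
exists (comph i f); split=> // [|v]; first exact: inj_comp fi (ses_inj ses).
by rewrite img_comp_surj //; case: ses.
Qed.

Lemma surjection_ker_unique (g1 g2 : rep_hom P' R) :
  surjective_hom g1 -> surjective_hom g2 -> forall v, lker (g1 v) = lker (g2 v).
Proof.
have [p [q [pq _ _ jinj _]]] := bigdsum_decomposition isoR.
have ps j : surjective_hom (p j).
  by move=> i; apply/limg_surj => y; exists (q j i y); rewrite -comphE pq idhE.
suff H (h1 h2 : rep_hom P' R) : surjective_hom h1 -> surjective_hom h2 ->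
    forall v x, h1 v x = 0 -> h2 v x = 0.
  move=> s1 s2 v; apply/vspaceP => x; rewrite !memv_ker.
  by apply/eqP/eqP; apply: H.
move=> s1 s2 v x hx; apply: jinj => j; rewrite -comphE.
apply: (local_ker_le ac tf (g1 := comph (p j) h1) (R_local j) Pi' Pt').
- exact: surj_comp s1 (ps j).
- exact: surj_comp s2 (ps j).
by rewrite comphE hx linear0.
Qed.

Lemma hall_number_one (f : rep_hom P P') (g : rep_hom P' R) : short_exact f g ->
  hall_number R P P' = 1%N.
Proof.
move=> fg; have gs := ses_surj fg; have Xs := ker_stable g.
pose K : subspaces P' := [ffun i => lker (g i)].
rewrite /hall_number (eq_card (B := pred1 K)) ?card1 // => X.
(* A subobject with quotient R is the kernel of a surjection P' -> R, and all these kernels are K;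
   conversely f identifies P with K. *)
rewrite !inE; apply/asboolP/eqP => [[{}Xs _ /rep_isoP [h [hi hs]]]|->].
  apply/ffunP => i; rewrite ffunE -(quop_ker Xs) -(ker_comp_inj (h := h)) //.
  by apply: surjection_ker_unique => //; apply: surj_comp (quop_surj Xs) hs.
split=> //; last by apply: (quorep_iso Xs gs) => i; rewrite ffunE.
have ses : short_exact (subi Xs) g.
  by split=> [||i] //; [apply: subi_inj|rewrite subi_img ffunE].
have [f' fE] : exists f', f = comph (subi Xs) f'.
  by apply: (ses_factor_l ses); apply: hom_eq0 => i x; rewrite comphE (ses_comp fg).
apply: rep_iso_sym; apply/rep_isoP; exists f'.
have fi : injective_hom f'.
  by apply: (@inj_factor_inj _ _ _ _ _ (subi Xs)); rewrite -fE; apply: ses_inj fg.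
split=> //; apply: (inj_tdim_surj fi).
by rewrite -(leq_add2r (tdim R)) -(ses_tdim fg) -(ses_tdim ses).
Qed.
End Proposition.

Theorem proposition5p2 (Q : quiver) (hQ : tame Q) (hacyc : acyclic Q)
    (k : finFieldType)
    (delta : vertex Q -> int) (hdelta : minimal_positive_imaginary_root delta)
    (P P' : rep k Q)
    (hP : indec_preprojective P) (hP' : indec_preprojective P')
    (dP : defect delta P = -1) (dP' : defect delta P' = -1)
    (R : rep k Q) (n : nat) (R_ : 'I_n -> rep k Q)
    (hR : rep_iso R (bigdsum R_))
    (hreg : forall j, indec_regular (R_ j))
    (htubes : forall j l, j <> l -> ~ same_tube (R_ j) (R_ l)) :
  ((exists (f : rep_hom P P') (g : rep_hom P' R), short_exact f g) <->
     (K0_eq (K0_add (K0_class P) (K0_class R)) (K0_class P') /\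
      forall j, hom_nonzero P' (relative_top (R_ j)))) /\
  ((exists (f : rep_hom P P') (g : rep_hom P' R), short_exact f g) ->
     hall_number R P P' = 1%N).
Proof.
have tf := tame_tame_form hQ hdelta.1.
have [Pi _ _ _] := preproj_props hacyc tf hP.
have [Pi' _ _ _] := preproj_props hacyc tf hP'.
split; last by case=> f [g fg]; apply: (hall_number_one hacyc tf Pi' dP' hR hreg fg).
split=> [[f [g fg]]|[/K0_eq_dv dvE top]].
  split; first exact: K0_sym (K0_exact fg).
  by move=> j; apply: (ses_top_nonzero hacyc tf hR hreg j fg).
(* Equality in the Grothendieck group gives equality of dimension vectors, and P is nonzero. *)
have ltR : (tdim R < tdim P')%N.
  have -> : tdim P' = (tdim P + tdim R)%N.
    rewrite /tdim -big_split; apply: eq_bigr => i _.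
    by have := dvE i; rewrite /= /dv /dim_vector -PoszD => -[].
  by have [/nonzeroP] := Pi; lia.
have [g gs] := top_surjection hacyc tf Pi' dP' hR hreg htubes ltR top.
have [f fg] := ses_of_surjection hacyc tf Pi' dP' Pi dP gs dvE.
by exists f, g.
Qed.
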